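(* There is a polynomial-time algorithm that, given a problem instance $(N,M,V,G)$ with $|N|>\Delta(G)$, finds an $\alpha$-approximate MMS allocation, with $\alpha>1/\Delta(G)$ when $\Delta(G)>2$. Specifically, $$\alpha=\begin{cases}1/2 & \text{if } \Delta(G)=1,\\ 3/7 & \text{if } \Delta(G)=2,\\ 2/(\Delta(G)+2) & \text{if } \Delta(G)>2.\end{cases}$$
   Context: A problem instance is a quadruple $(N,M,V,G)$, where $N$ is a finite set of $n$ agents, $M$ is a finite set of $m$ items, $V$ is a family of additive valuation functions $v_i:2^M\to\mathbb{R}_{\ge 0}$, $i\in N$ (given by the item values $v_{ij}=v_i(\{j\})$), and $G=(M,E)$ is an undirected (simple) conflict graph on the items. An allocation is an ordered partition $A=\langle A_i\rangle_{i\in N}$ of $M$ into $|N|$ (possibly empty) bundles, bundle $A_i$ going to agent $i$; it is feasible if every bundle is an independent set of $G$. The maximin share of agent $i$ is $\mu_i=\max_{A}\min_{k\in N}v_i(A_k)$, where the maximum is over all feasible allocations $A$. A feasible allocation $A$ is $\alpha$-approximate MMS if $v_i(A_i)\ge\alpha\mu_i$ for all $i\in N$. $\Delta(G)$ is the maximum degree of $G$. Polynomial time is measured in the number of agents and items. *)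

(* Defs.v *)
From HB Require Import structures.
From mathcomp Require Import all_boot all_order all_algebra.
From mathcomp Require Import reals.
Set Implicit Arguments.
Unset Strict Implicit.
Unset Printing Implicit Defensive.
Import Order.TTheory GRing.Theory Num.Theory.
Local Open Scope ring_scope.

(* Agents and items are numbered, as the input of an algorithm
   has to be: N = 'I_n and M = 'I_m. *)

Record instance (R : realType) (n m : nat) := Instance {
  item_value : 'I_n -> 'I_m -> R;
  conflict : rel 'I_m;
  item_value_ge0 : forall i j, 0 <= item_value i j;
  conflict_sym : symmetric conflict;
  conflict_irr : irreflexive conflict
}.

Section Instances.
Variables (R : realType) (n m : nat) (I : instance R n m).

Definition valuation (i : 'I_n) (S : {set 'I_m}) : R :=
  \sum_(j in S) item_value I i j.

Definition max_degree : nat := \max_(j < m) #|[set k | conflict I j k]|.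

Definition independent (S : {set 'I_m}) : bool :=
  [forall j in S, forall k in S, ~~ conflict I j k].

Definition is_allocation (A : {ffun 'I_n -> {set 'I_m}}) : bool :=
  [forall i, forall k, (i != k) ==> [disjoint A i & A k]] &&
  (\bigcup_(i < n) A i == [set: 'I_m]).

Definition feasible (A : {ffun 'I_n -> {set 'I_m}}) : bool :=
  is_allocation A && [forall i, independent (A i)].

(* The default values are neutral: every bundle is worth between 0 and v_i(M).
   So this is the true max-min as soon as n > 0 and some allocation is
   feasible, both of which follow from max_degree < n. *)
Definition mms (i : 'I_n) : R :=
  \big[Num.max/0]_(A : {ffun 'I_n -> {set 'I_m}} | feasible A)
    \big[Num.min/valuation i [set: 'I_m]]_(k < n) valuation i (A k).

Definition approx_MMS (alpha : R) (A : {ffun 'I_n -> {set 'I_m}}) : Prop :=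
  feasible A /\ forall i, alpha * mms i <= valuation i (A i).

End Instances.

(* Only meant for d > 0. *)
Definition mms_ratio (R : realType) (d : nat) : R :=
  match d with
  | 1 => 1 / 2%:R
  | 2 => 3%:R / 7%:R
  | _ => 2%:R / (d%:R + 2%:R)
  end.

(* Model of computation: structured programs for a random access machine with a
   memory of natural numbers and a memory of real numbers, each organised in
   numbered two-dimensional arrays, at unit cost per operation.
   Programs contain no real constants, there is no rounding of reals to
   integers, and neither two naturals nor two reals can be multiplied in one
   step. Hence t steps cannot create naturals of more than O(t) extra bits, nor,
   when the item values are rational, numbers whose bit length is more than
   polynomial in t and in that of the input. *)

Inductive nexp : Type :=
| NConst of nat
| NGet of nat & nexp & nexp
| NAdd of nexp & nexp
| NSub of nexp & nexp.

Inductive rexp : Type :=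
| RNat of nexp
| RGet of nat & nexp & nexp
| RAdd of rexp & rexp
| RSub of rexp & rexp
| RMuln of rexp & nexp
| RDivn of rexp & nexp.

Inductive bexp : Type :=
| NLe of nexp & nexp
| RLe of rexp & rexp
| BNot of bexp
| BAnd of bexp & bexp.

Inductive cmd : Type :=
| Skip
| NSet of nat & nexp & nexp & nexp
| RSet of nat & nexp & nexp & rexp
| Seq of cmd & cmd
| If of bexp & cmd & cmd
| While of bexp & cmd.

Fixpoint ncost (e : nexp) : nat :=
  match e with
  | NConst _ => 1
  | NGet _ e1 e2 | NAdd e1 e2 | NSub e1 e2 => (ncost e1 + ncost e2).+1
  end.

Fixpoint rcost (e : rexp) : nat :=
  match e with
  | RNat e1 => (ncost e1).+1
  | RGet _ e1 e2 => (ncost e1 + ncost e2).+1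
  | RAdd e1 e2 | RSub e1 e2 => (rcost e1 + rcost e2).+1
  | RMuln e1 e2 | RDivn e1 e2 => (rcost e1 + ncost e2).+1
  end.

Fixpoint bcost (b : bexp) : nat :=
  match b with
  | NLe e1 e2 => (ncost e1 + ncost e2).+1
  | RLe e1 e2 => (rcost e1 + rcost e2).+1
  | BNot b1 => (bcost b1).+1
  | BAnd b1 b2 => (bcost b1 + bcost b2).+1
  end.

Section Semantics.
Variable R : realType.

(* nmem s a x y is the cell (x, y) of the array a. *)
Record state := State {
  nmem : nat -> nat -> nat -> nat;
  rmem : nat -> nat -> nat -> R
}.

Definition update (T : Type) (f : nat -> nat -> nat -> T) (a x y : nat) (v : T) :
    nat -> nat -> nat -> T :=
  fun a' x' y' => if [&& a' == a, x' == x & y' == y] then v else f a' x' y'.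

Fixpoint neval (s : state) (e : nexp) : nat :=
  match e with
  | NConst c => c
  | NGet a e1 e2 => nmem s a (neval s e1) (neval s e2)
  | NAdd e1 e2 => (neval s e1 + neval s e2)%N
  | NSub e1 e2 => (neval s e1 - neval s e2)%N
  end.

Fixpoint reval (s : state) (e : rexp) : R :=
  match e with
  | RNat e1 => (neval s e1)%:R
  | RGet a e1 e2 => rmem s a (neval s e1) (neval s e2)
  | RAdd e1 e2 => reval s e1 + reval s e2
  | RSub e1 e2 => reval s e1 - reval s e2
  | RMuln e1 e2 => reval s e1 * (neval s e2)%:R
  | RDivn e1 e2 => reval s e1 / (neval s e2)%:R
  end.

Fixpoint beval (s : state) (b : bexp) : bool :=
  match b with
  | NLe e1 e2 => (neval s e1 <= neval s e2)%N
  | RLe e1 e2 => reval s e1 <= reval s e2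
  | BNot b1 => ~~ beval s b1
  | BAnd b1 b2 => beval s b1 && beval s b2
  end.

(* exec c s s' t: started in s, the program c halts in s' after t steps. *)
Inductive exec : cmd -> state -> state -> nat -> Prop :=
| exec_Skip s : exec Skip s s 1
| exec_NSet s a x y e :
    exec (NSet a x y e) s
      (State (update (nmem s) a (neval s x) (neval s y) (neval s e)) (rmem s))
      (ncost x + ncost y + ncost e).+1
| exec_RSet s a x y e :
    exec (RSet a x y e) s
      (State (nmem s) (update (rmem s) a (neval s x) (neval s y) (reval s e)))
      (ncost x + ncost y + rcost e).+1
| exec_Seq c1 c2 s1 s2 s3 t1 t2 :
    exec c1 s1 s2 t1 -> exec c2 s2 s3 t2 -> exec (Seq c1 c2) s1 s3 (t1 + t2)
| exec_If b c1 c2 s s' t :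
    exec (if beval s b then c1 else c2) s s' t ->
    exec (If b c1 c2) s s' (bcost b + t).+1
| exec_While_end b c s :
    ~~ beval s b -> exec (While b c) s s (bcost b).+1
| exec_While_loop b c s1 s2 s3 t1 t2 :
    beval s1 b -> exec c s1 s2 t1 -> exec (While b c) s2 s3 t2 ->
    exec (While b c) s1 s3 (bcost b + t1 + t2).+1.

Lemma exec_det c s s1 s2 t1 t2 :
  exec c s s1 t1 -> exec c s s2 t2 -> s1 = s2 /\ t1 = t2.
Proof.
move=> H; elim: H s2 t2 => {c s s1 t1}.
- by move=> s s2 t2 H; inversion H.
- by move=> s a x y e s2 t2 H; inversion H.
- by move=> s a x y e s2 t2 H; inversion H.
- move=> c1 c2 s1 s2 s3 t1 t2 _ IH1 _ IH2 s' t' H.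
  inversion H as [| | |? ? ? ? ? ? ? E1 E2| | |]; subst.
  have [? ?] := IH1 _ _ E1; subst.
  by have [? ?] := IH2 _ _ E2; subst.
- move=> b c1 c2 s s' t _ IH s2 t2 H.
  inversion H as [| | | |? ? ? ? ? ? E| |]; subst.
  by have [? ?] := IH _ _ E; subst.
- move=> b c s nb s2 t2 H.
  inversion H as [| | | | | |? ? ? ? ? ? ? E]; subst => //.
  by rewrite E in nb.
- move=> b c s1 s2 s3 t1 t2 bs _ IH1 _ IH2 s' t' H.
  inversion H as [| | | | |? ? ? nb|? ? ? ? ? ? ? ? E1 E2]; subst.
    by rewrite bs in nb.
  have [? ?] := IH1 _ _ E1; subst.
  by have [? ?] := IH2 _ _ E2; subst.
Qed.

Section InputOutput.
Variables (n m : nat).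

(* Natural arrays: 0 holds n, 1 holds m (both in cell (0, 0)) and 2 holds the
   adjacency matrix of the conflict graph. Real array 0 holds the matrix of the
   item values. All other cells are 0. *)
Definition input (I : instance R n m) : state :=
  State
    (fun a x y =>
       match a with
       | 0 => if (x == 0) && (y == 0) then n else 0
       | 1 => if (x == 0) && (y == 0) then m else 0
       | 2 => match insub x, insub y with
              | Some j, Some k => conflict I j k : nat
              | _, _ => 0
              end
       | _ => 0
       end%N)
    (fun a x y =>
       match a, insub x, insub y with
       | 0%N, Some i, Some j => item_value I i j
       | _, _, _ => 0
       end).

(* Cell (0, j) of the natural array 3 holds the agent who receives item j. An
   item whose cell is not below n ends up in no bundle, so that the output is
   then not an allocation. *)
Definition output (s : state) : {ffun 'I_n -> {set 'I_m}} :=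
  [ffun i : 'I_n => [set j : 'I_m | nmem s 3 0 j == i :> nat]].

End InputOutput.

(* The program c solves, in time polynomial in the numbers of agents and items,
   the problem of finding an allocation A with Q I A, given an instance I with
   P I. *)
Definition solves_in_poly_time (c : cmd)
    (P : forall n m : nat, instance R n m -> Prop)
    (Q : forall n m : nat, instance R n m -> {ffun 'I_n -> {set 'I_m}} -> Prop) :
    Prop :=
  exists a k : nat, forall (n m : nat) (I : instance R n m), P n m I ->
    exists (s : state) (t : nat),
      [/\ exec c (input I) s t, (t <= a * (n + m) ^ k)%N & Q n m I (output n m s)].

End Semantics.

(* Main.v *)
Require Import Defs.
From mathcomp Require Import all_boot all_order all_algebra.
From mathcomp Require Import reals.
From mathcomp Require Import lra zify.
Set Implicit Arguments.
Unset Strict Implicit.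
Unset Printing Implicit Defensive.
Import Order.TTheory GRing.Theory Num.Theory.
Local Open Scope ring_scope.

(* The program builds a partial allocation; in the end first fit places the
   items that are left, which is possible since n > Delta.

   As long as some item is worth alpha times an equal share of the free items U
   to an agent without bundle, that agent gets it. This keeps, for every other
   agent i, as many disjoint independent subsets of U worth mu_i as there are
   agents left. If r agents are left then, no item exceeds the threshold
   t_i = alpha v_i(U) / r, which is at least alpha mu_i.

   Bag filling: colour U by first fit with Delta + 1 colours, and take the least
   initial segment of a colour class that some agent values at its threshold.
   Any other agent i loses at most 2 t_i, so all r agents can be served if
   v_i(U) >= (Delta + 1) t_i + 2 (r - 1) t_i. This holds if r > 2 and Delta is
   even.

   If Delta is odd, bag filling stops at two agents, with
   v_i(U) >= (Delta + 2) t_i. By local search (Lovasz) the items fall into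
   (Delta + 1) / 2 groups in which all degrees are at most 1, so that the
   heavier ends of the edges of a group form an independent set worth half of
   it. Either two of these sets reach t_i for the first agent i, or some group is
   worth 3 t_i and splits evenly into two independent sets. The second agent
   chooses one of them, or else the first one takes it and the second agent keeps
   v(U) - t >= (Delta + 1) t.

   If Delta is even and r = 2, the same is done with Delta independent groups.
   First fit with Delta - 2 colours leaves a graph of degree at most 2, whose
   items are inserted by decreasing value for the first agent i into two more
   classes, after a Kempe exchange if necessary. An item is dropped only if it is
   the least one of an odd cycle; as two independent sets miss an item of
   that cycle, the coloured items are still worth 2 mu_i.

   A single agent gets the heavier ends in the best of floor(Delta / 2) + 1
   groups. *)

(** * A language with bounded loops, sums and searches, and its compiler *)

(** The constants come from counting thresholds. Bag filling for r agents needs (Delta + 2 r - 1)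
    alpha <= r; for even Delta this holds from r = 3 on, with equality for r = 3 and Delta = 2, the
    origin of 3/7. With r = 2 it would need alpha <= 2 / (Delta + 3), one threshold short, so pairs
    are treated apart.

    Let t be the threshold of the first agent, and let each of p groups contain an independent set
    worth at least 1/c of it. If at most one group yields a set worth t, the others are worth at
    most c t each, so a total of (c (p - 1) + 3) t leaves 3 t for that group, and an even split
    gives t on both sides as no item exceeds t. Matchings have c = 2 and p = floor(Delta / 2) + 1:
    the total is Delta + 2 thresholds if Delta is odd, but Delta + 3 if it is even. Hence the
    independent groups in the even case, with c = 1 and p = Delta. A colouring of all items with
    Delta colours need not exist; this is why items are dropped and the first agent's threshold is
    measured on the coloured items only.

    Since all loops of the source language are bounded by n or m, every program in it is polynomial,
    and the algorithm itself only has to be proved correct. *)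

Definition poly_bounded (f : nat -> nat) : Prop :=
  exists a k, forall N, (0 < N)%N -> (f N <= a * N ^ k)%N.

Lemma poly_bounded_const c : poly_bounded (fun=> c).
Proof. by exists c, 0 => N _; rewrite expn0 muln1. Qed.

Lemma poly_bounded_id : poly_bounded id.
Proof. by exists 1%N, 1%N => N _; rewrite expn1 mul1n. Qed.

Lemma poly_boundedD f g :
  poly_bounded f -> poly_bounded g -> poly_bounded (fun N => f N + g N)%N.
Proof.
move=> [a [k fP]] [b [l gP]]; exists (a + b)%N, (k + l)%N => N N0.
rewrite mulnDl; apply: leq_add.
  apply: leq_trans (fP N N0) _; rewrite leq_mul2l leq_pexp2l ?orbT //.
  exact: leq_addr.
apply: leq_trans (gP N N0) _; rewrite leq_mul2l leq_pexp2l ?orbT //.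
exact: leq_addl.
Qed.

Lemma poly_boundedM f g :
  poly_bounded f -> poly_bounded g -> poly_bounded (fun N => f N * g N)%N.
Proof.
move=> [a [k fP]] [b [l gP]]; exists (a * b)%N, (k + l)%N => N N0.
by rewrite expnD mulnACA leq_mul ?fP ?gP.
Qed.

Inductive range := Agents | Items.

(** Counts, searches and sums range over agents or items only, so that evaluating an expression
    takes polynomial time whatever the store holds. *)
Inductive hnexp : Type :=
| HConst of nat
| HVar of nat
| HBound of range
| HGet of nat & hnexp
| HAdd of hnexp & hnexp
| HSub of hnexp & hnexp
| HCount of nat & range & hbexp
| HFind of nat & range & hbexp
with hrexp : Type :=
| HVal of hnexp & hnexp
| HMuln of hrexp & hnexp
| HSum of nat & range & hbexp & hrexp
with hbexp : Type :=
| HLe of hnexp & hnexp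
| HRLe of hrexp & hrexp
| HNot of hbexp
| HAnd of hbexp & hbexp
| HAdj of hnexp & hnexp.

Scheme hnexp_ind' := Induction for hnexp Sort Prop
with hrexp_ind' := Induction for hrexp Sort Prop
with hbexp_ind' := Induction for hbexp Sort Prop.
Combined Scheme hexp_ind from hnexp_ind', hrexp_ind', hbexp_ind'.

Inductive hcmd : Type :=
| HSkip
| HSet of nat & hnexp & hnexp
| HSeq of hcmd & hcmd
| HIf of hbexp & hcmd & hcmd
| HFor of nat & range & hcmd.

Definition bind (env : nat -> nat) (x v : nat) : nat -> nat :=
  fun y => if y == x then v else env y.

(** Only naturals are stored: a real is always computed afresh from the item values, inside a
    comparison. *)
Definition store := nat -> nat -> nat.

Definition put (H : store) (a x v : nat) : store :=
  fun b y => if (b == a) && (y == x) then v else H b y.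

(** * Meaning of the source language *)

Section Source.
Variables (R : realType) (n m : nat) (I : instance R n m).

Definition conflict_at (x y : nat) : bool :=
  match insub x, insub y with
  | Some j, Some k => conflict I j k
  | _, _ => false
  end.

Definition value_at (x y : nat) : R :=
  match insub x, insub y with
  | Some i, Some j => item_value I i j
  | _, _ => 0
  end.

Definition bound (k : range) : nat := if k is Agents then n else m.

Fixpoint hneval (env : nat -> nat) (H : store) (e : hnexp) : nat :=
  match e with
  | HConst c => c
  | HVar x => env x
  | HBound k => bound k
  | HGet a e1 => H a (hneval env H e1)
  | HAdd e1 e2 => (hneval env H e1 + hneval env H e2)%N
  | HSub e1 e2 => (hneval env H e1 - hneval env H e2)%N
  | HCount x k b => count (fun i => hbeval (bind env x i) H b) (iota 0 (bound k))
  | HFind x k b => find (fun i => hbeval (bind env x i) H b) (iota 0 (bound k))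
  end
with hreval (env : nat -> nat) (H : store) (e : hrexp) : R :=
  match e with
  | HVal e1 e2 => value_at (hneval env H e1) (hneval env H e2)
  | HMuln e1 e2 => hreval env H e1 * (hneval env H e2)%:R
  | HSum x k b e1 =>
      \sum_(i <- iota 0 (bound k) | hbeval (bind env x i) H b)
        hreval (bind env x i) H e1
  end
with hbeval (env : nat -> nat) (H : store) (b : hbexp) : bool :=
  match b with
  | HLe e1 e2 => (hneval env H e1 <= hneval env H e2)%N
  | HRLe e1 e2 => hreval env H e1 <= hreval env H e2
  | HNot b1 => ~~ hbeval env H b1
  | HAnd b1 b2 => hbeval env H b1 && hbeval env H b2
  | HAdj e1 e2 => conflict_at (hneval env H e1) (hneval env H e2)
  end.

Fixpoint hrun (env : nat -> nat) (c : hcmd) (H : store) : store :=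
  match c with
  | HSkip => H
  | HSet a e1 e2 => put H a (hneval env H e1) (hneval env H e2)
  | HSeq c1 c2 => hrun env c2 (hrun env c1 H)
  | HIf b c1 c2 => if hbeval env H b then hrun env c1 H else hrun env c2 H
  | HFor x k c1 =>
      foldl (fun H' i => hrun (bind env x i) c1 H') H (iota 0 (bound k))
  end.

End Source.

(* The compiled program keeps each variable in a cell of its own, so enclosing
   binders must bind distinct variables. *)
Fixpoint nscoped (P : seq nat) (e : hnexp) : bool :=
  match e with
  | HConst _ | HBound _ => true
  | HVar x => x \in P
  | HGet _ e1 => nscoped P e1
  | HAdd e1 e2 | HSub e1 e2 => nscoped P e1 && nscoped P e2
  | HCount x _ b | HFind x _ b => (x \notin P) && bscoped (x :: P) b
  end
with rscoped (P : seq nat) (e : hrexp) : bool :=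
  match e with
  | HVal e1 e2 => nscoped P e1 && nscoped P e2
  | HMuln e1 e2 => rscoped P e1 && nscoped P e2
  | HSum x _ b e1 => [&& x \notin P, bscoped (x :: P) b & rscoped (x :: P) e1]
  end
with bscoped (P : seq nat) (b : hbexp) : bool :=
  match b with
  | HLe e1 e2 => nscoped P e1 && nscoped P e2
  | HRLe e1 e2 => rscoped P e1 && rscoped P e2
  | HNot b1 => bscoped P b1
  | HAnd b1 b2 => bscoped P b1 && bscoped P b2
  | HAdj e1 e2 => nscoped P e1 && nscoped P e2
  end.

Fixpoint scoped (P : seq nat) (c : hcmd) : bool :=
  match c with
  | HSkip => true
  | HSet _ e1 e2 => nscoped P e1 && nscoped P e2
  | HSeq c1 c2 => scoped P c1 && scoped P c2
  | HIf b c1 c2 => [&& bscoped P b, scoped P c1 & scoped P c2]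
  | HFor x _ c1 => (x \notin P) && scoped (x :: P) c1
  end.

(* Array 4 holds the variables, array 5 and the real array 1 hold a stack of
   intermediate results. Array 0 of a store is the output array 3. *)
Definition address (a : nat) : nat := if a is a'.+1 then a'.+4.+2 else 3.

Definition ecell (a x : nat) : nexp := NGet a (NConst 0) (NConst x).

Definition ebound (k : range) : nexp := ecell (if k is Agents then 0 else 1) 0.

Definition loop (x : nat) (k : range) (c : cmd) : cmd :=
  Seq (NSet 4 (NConst 0) (NConst x) (NConst 0))
    (While (NLe (NAdd (ecell 4 x) (NConst 1)) (ebound k))
      (Seq c (NSet 4 (NConst 0) (NConst x) (NAdd (ecell 4 x) (NConst 1))))).

(* The triple is the code that has to run first, the expression that then holds
   the result, and the height of the stack. *)
Fixpoint ncompile (d : nat) (e : hnexp) : cmd * nexp * nat :=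
  match e with
  | HConst c => (Skip, NConst c, d)
  | HVar x => (Skip, ecell 4 x, d)
  | HBound k => (Skip, ebound k, d)
  | HGet a e1 =>
      let: (c1, y1, d1) := ncompile d e1 in
      (c1, NGet (address a) (NConst 0) y1, d1)
  | HAdd e1 e2 =>
      let: (c1, y1, d1) := ncompile d e1 in
      let: (c2, y2, d2) := ncompile d1 e2 in
      (Seq c1 c2, NAdd y1 y2, d2)
  | HSub e1 e2 =>
      let: (c1, y1, d1) := ncompile d e1 in
      let: (c2, y2, d2) := ncompile d1 e2 in
      (Seq c1 c2, NSub y1 y2, d2)
  | HCount x k b =>
      let: (c, y, _) := bcompile d.+1 b in
      (Seq (NSet 5 (NConst 0) (NConst d) (NConst 0))
         (loop x k (Seq c (If y (NSet 5 (NConst 0) (NConst d)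
                                   (NAdd (ecell 5 d) (NConst 1))) Skip))),
       ecell 5 d, d.+1)
  | HFind x k b =>
      let: (c, y, _) := bcompile d.+1 b in
      (Seq (NSet 5 (NConst 0) (NConst d) (ebound k))
         (loop x k (Seq c (If (BAnd y (NLe (ebound k) (ecell 5 d)))
                              (NSet 5 (NConst 0) (NConst d) (ecell 4 x)) Skip))),
       ecell 5 d, d.+1)
  end
with rcompile (d : nat) (e : hrexp) : cmd * rexp * nat :=
  match e with
  | HVal e1 e2 =>
      let: (c1, y1, d1) := ncompile d e1 in
      let: (c2, y2, d2) := ncompile d1 e2 in
      (Seq c1 c2, RGet 0 y1 y2, d2)
  | HMuln e1 e2 =>
      let: (c1, y1, d1) := rcompile d e1 in
      let: (c2, y2, d2) := ncompile d1 e2 in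
      (Seq c1 c2, RMuln y1 y2, d2)
  | HSum x k b e1 =>
      let: (c, y, d1) := bcompile d.+1 b in
      let: (c1, y1, _) := rcompile d1 e1 in
      (Seq (RSet 1 (NConst 0) (NConst d) (RNat (NConst 0)))
         (loop x k (Seq (Seq c c1)
            (If y (RSet 1 (NConst 0) (NConst d)
                     (RAdd (RGet 1 (NConst 0) (NConst d)) y1)) Skip))),
       RGet 1 (NConst 0) (NConst d), d.+1)
  end
with bcompile (d : nat) (b : hbexp) : cmd * bexp * nat :=
  match b with
  | HLe e1 e2 =>
      let: (c1, y1, d1) := ncompile d e1 in
      let: (c2, y2, d2) := ncompile d1 e2 in
      (Seq c1 c2, NLe y1 y2, d2)
  | HRLe e1 e2 =>
      let: (c1, y1, d1) := rcompile d e1 in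
      let: (c2, y2, d2) := rcompile d1 e2 in
      (Seq c1 c2, RLe y1 y2, d2)
  | HNot b1 => let: (c1, y1, d1) := bcompile d b1 in (c1, BNot y1, d1)
  | HAnd b1 b2 =>
      let: (c1, y1, d1) := bcompile d b1 in
      let: (c2, y2, d2) := bcompile d1 b2 in
      (Seq c1 c2, BAnd y1 y2, d2)
  | HAdj e1 e2 =>
      let: (c1, y1, d1) := ncompile d e1 in
      let: (c2, y2, d2) := ncompile d1 e2 in
      (Seq c1 c2, NLe (NConst 1) (NGet 2 y1 y2), d2)
  end.

Fixpoint compile (c : hcmd) : cmd :=
  match c with
  | HSkip => Skip
  | HSet a e1 e2 =>
      let: (c1, y1, d1) := ncompile 0 e1 in
      let: (c2, y2, d2) := ncompile d1 e2 in
      Seq (Seq c1 c2) (NSet (address a) (NConst 0) y1 y2)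
  | HSeq c1 c2 => Seq (compile c1) (compile c2)
  | HIf b c1 c2 =>
      let: (c, y, _) := bcompile 0 b in
      Seq c (If y (compile c1) (compile c2))
  | HFor x k c1 => loop x k (compile c1)
  end.

(** * Simulation of the source language by the compiled program *)

Section Correctness.
Variable R : realType.

Section Simulation.
Variables (n m : nat) (I : instance R n m).

Record represents (P : seq nat) (env : nat -> nat) (H : store) (s : state R) :
    Prop := Represents {
  rep_bound : forall k, neval s (ebound k) = bound n m k;
  rep_conflict : forall x y, nmem s 2 x y = conflict_at I x y;
  rep_value : forall x y, rmem s 0 x y = value_at I x y;
  rep_store : forall a x, nmem s (address a) 0 x = H a x;
  rep_var : {in P, forall x, nmem s 4 0 x = env x}
}.

(** Code compiled at stack height d leaves the d cells below intact, so that operands computed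
    earlier survive. *)
Definition agree_below (d : nat) (s s' : state R) : Prop :=
  forall k, (k < d)%N -> nmem s' 5 0 k = nmem s 5 0 k /\ rmem s' 1 0 k = rmem s 1 0 k.

Lemma agree_below_refl d s : agree_below d s s.
Proof. by []. Qed.

Lemma agree_below_trans d s1 s2 s3 :
  agree_below d s1 s2 -> agree_below d s2 s3 -> agree_below d s1 s3.
Proof.
by move=> A B k kd; have [-> ->] := B _ kd; exact: A.
Qed.

Lemma agree_belowW d d' s s' :
  (d <= d')%N -> agree_below d' s s' -> agree_below d s s'.
Proof. by move=> dd' A k kd; apply: A; exact: leq_trans dd'. Qed.

Lemma represents_ntmp P env H s x v :
  represents P env H s ->
  represents P env H (State (update (nmem s) 5 0 x v) (rmem s)).
Proof.
move=> [h1 h2 h3 h4 h5]; split=> //=.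
- by move=> k; rewrite -h1; case: k.
- by move=> [|a] y; rewrite -h4 /update //=.
Qed.

Lemma represents_rtmp P env H s x v :
  represents P env H s ->
  represents P env H (State (nmem s) (update (rmem s) 1 0 x v)).
Proof. by case. Qed.

Lemma represents_bind P env H s x v :
  represents P env H s ->
  represents (x :: P) (bind env x v) H
    (State (update (nmem s) 4 0 x v) (rmem s)).
Proof.
move=> [h1 h2 h3 h4 h5]; split=> //=.
- by move=> k; rewrite -h1; case: k.
- by move=> [|a] y; rewrite -h4 /update //=.
- move=> y; rewrite inE /update /bind /=; case: eqP => //= _ yP.
  exact: h5.
Qed.

Lemma represents_unbind P env H s x v : x \notin P ->
  represents (x :: P) (bind env x v) H s -> represents P env H s.
Proof.
move=> xP [h1 h2 h3 h4 h5]; split=> // y yP.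
rewrite h5 ?inE ?yP ?orbT // /bind; case: eqP => // yx.
by rewrite -yx yP in xP.
Qed.

Lemma represents_put P env H s a x v :
  represents P env H s ->
  represents P env (put H a x v)
    (State (update (nmem s) (address a) 0 x v) (rmem s)).
Proof.
move=> [h1 h2 h3 h4 h5]; split=> //=.
- by move=> k; rewrite -h1; case: k; case: a => [|a] //=.
- by move=> y z; rewrite -h2; case: a => [|a] //=.
- move=> b y; rewrite /put -h4 /update /=.
  by case: a => [|a]; case: b => [|b] //=.
- by move=> y /h5 <-; case: a => [|a] //=.
Qed.

End Simulation.

Lemma while_spec (b : bexp) (c : cmd) (k T : nat) (J : nat -> state R -> Prop) :
  (forall i s, J i s -> beval s b = (i < k)%N) ->
  (forall i s, (i < k)%N -> J i s ->
     exists s' t, [/\ exec c s s' t, (t <= T)%N & J i.+1 s']) ->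
  forall s, J 0%N s ->
  exists s' t, [/\ exec (While b c) s s' t,
                   (t <= k * (T + bcost b).+1 + (bcost b).+1)%N & J k s'].
Proof.
move=> Jb Jc s J0.
suff: forall q i s, (i + q)%N = k -> J i s -> exists s' t,
    [/\ exec (While b c) s s' t, (t <= q * (T + bcost b).+1 + (bcost b).+1)%N
      & J k s'] by move=> /(_ k 0%N s); apply.
elim=> [|q IH] i s1 iq Ji.
  exists s1, (bcost b).+1; rewrite addn0 in iq; split=> //; last by rewrite -iq.
  by apply: exec_While_end; rewrite (Jb _ _ Ji) iq ltnn.
have ik : (i < k)%N by rewrite -iq -[X in (X < _)%N]addn0 ltn_add2l.
have [s2 [t2 [E2 t2T J2]]] := Jc _ _ ik Ji.
have [|s3 [t3 [E3 t3T J3]]] := IH i.+1 s2 _ J2; first by rewrite addSnnS.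
exists s3, (bcost b + t2 + t3).+1; split=> //.
  by apply: exec_While_loop E2 E3; rewrite (Jb _ _ Ji).
rewrite mulSn -[X in (_ <= X)%N]addnA addSn ltnS; apply: leq_add => //.
by rewrite addnC leq_add2r.
Qed.

(** [H i] is the store after i rounds and [J i] what is known besides it. [J] has to survive a write
    to array 4, since the counter is initialised and increased there. *)
Lemma loop_spec n m (I : instance R n m) P env H x k (c : cmd) (T : nat)
    (J : nat -> state R -> Prop) :
  x \notin P ->
  (forall i s v, J i s -> J i (State (update (nmem s) 4 0 x v) (rmem s))) ->
  (forall i s, (i < bound n m k)%N -> represents I (x :: P) (bind env x i) (H i) s ->
     J i s ->
     exists s' t, [/\ exec c s s' t, (t <= T)%N, J i.+1 s'
                    & represents I (x :: P) (bind env x i) (H i.+1) s']) ->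
  forall s, represents I P env (H 0%N) s -> J 0%N s ->
  exists s' t, [/\ exec (loop x k c) s s' t,
    (t <= bound n m k * (T + 20) + 20)%N, J (bound n m k) s'
    & represents I P env (H (bound n m k)) s'].
Proof.
move=> xP Jx Jc s rs J0.
pose J' i s := J i s /\ represents I (x :: P) (bind env x i) (H i) s.
have [|i s1 ik [Ji ri]||s' [t [E tT [Jk rk]]]] := @while_spec
  (NLe (NAdd (ecell 4 x) (NConst 1)) (ebound k))
  (Seq c (NSet 4 (NConst 0) (NConst x) (NAdd (ecell 4 x) (NConst 1))))
  (bound n m k) (T + 8)%N J' _ _
  (State (update (nmem s) 4 0 x 0%N) (rmem s)).
- move=> i s1 [_ r1]; have := rep_bound r1 k.
  rewrite /= => ->; rewrite (rep_var r1) ?mem_head // /bind eqxx addn1.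
  by [].
- have [s2 [t2 [E2 t2T J2 r2]]] := Jc _ _ ik ri Ji.
  have vi : nmem s2 4 0 x = i by rewrite (rep_var r2) ?mem_head // /bind eqxx.
  exists (State (update (nmem s2) 4 0 x i.+1) (rmem s2)), (t2 + 8)%N.
  split; first apply: exec_Seq E2 _; last 2 first.
  + by rewrite leq_add2r.
  + split; first exact: Jx.
    by apply/represents_bind/(represents_unbind xP r2).
  have := exec_NSet s2 4 (NConst 0) (NConst x) (NAdd (ecell 4 x) (NConst 1)).
  by rewrite /= vi addn1.
- split; first exact: Jx.
  exact: represents_bind.
exists s', (4 + t)%N; split=> //.
- apply: exec_Seq E.
  exact: (exec_NSet s 4 (NConst 0) (NConst x) (NConst 0)).
- have bE : bcost (NLe (NAdd (ecell 4 x) (NConst 1)) (ebound k)) = 9.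
    by case: (k).
  rewrite bE in tT; apply: (leq_trans (leq_add (leqnn 4) tT)).
  rewrite addnCA leq_add // leq_mul // -addnA -addnS leq_add2l.
  by [].
- exact: represents_unbind rk.
Qed.

Section Expressions.
Variables (E V : Type) (ev : state R -> E -> V).
Variable hv : forall n m, instance R n m -> (nat -> nat) -> store -> V.

(** The value is required in every later state that represents the same store and agrees on the
    stack below d', because the code of a second operand runs between the code of the first and the
    use of its value. *)
Definition correct (P : seq nat) (d : nat) (r : cmd * E * nat) : Prop :=
  let: (c, y, d') := r in
  (d <= d')%N /\ exists2 T, poly_bounded T &
  forall n m (I : instance R n m) env H s, (0 < n + m)%N ->
    represents I P env H s ->
  exists s' t, [/\ exec c s s' t, (t <= T (n + m))%N, agree_below d s s',
    represents I P env H s' &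
    forall s'', represents I P env H s'' -> agree_below d' s' s'' ->
      ev s'' y = hv I env H].

Lemma correct_skip P d y :
  (forall n m (I : instance R n m) env H s,
     represents I P env H s -> ev s y = hv I env H) ->
  correct P d (Skip, y, d).
Proof.
move=> yP; split=> //; exists (fun=> 1%N); first exact: poly_bounded_const.
move=> n m I env H s _ rs; exists s, 1%N; split=> //; first exact: exec_Skip.
by move=> s2 r2 _; exact: yP.
Qed.

(** Counts, searches and sums are loops with an accumulator in cell d of the stack; [acc] gives its
    content after i rounds. *)
Lemma correct_acc P d x k c0 c y
    (acc : forall n m, instance R n m -> (nat -> nat) -> store -> nat -> V) :
  x \notin P ->
  (forall s s', agree_below d.+1 s s' -> ev s' y = ev s y) ->
  (forall n m (I : instance R n m) env H s, represents I P env H s ->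
     exists s' t, [/\ exec c0 s s' t, (t <= 20)%N, agree_below d s s',
       represents I P env H s' & ev s' y = acc n m I env H 0%N]) ->
  (exists2 T, poly_bounded T &
     forall n m (I : instance R n m) env H i s, (0 < n + m)%N ->
     (i < bound n m k)%N -> represents I (x :: P) (bind env x i) H s ->
     ev s y = acc n m I env H i ->
     exists s' t, [/\ exec c s s' t, (t <= T (n + m))%N, agree_below d s s',
       represents I (x :: P) (bind env x i) H s'
       & ev s' y = acc n m I env H i.+1]) ->
  (forall n m (I : instance R n m) env H,
     hv I env H = acc n m I env H (bound n m k)) ->
  correct P d (Seq c0 (loop x k c), y, d.+1).
Proof.
move=> xP ydep c0P [T pT cP] hvE; split=> //.
(* Both ranges have at most n + m elements. *)
exists (fun N => 20 + (N * (T N + 20) + 20))%N.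
  do ![apply: poly_boundedD | apply: poly_boundedM | exact: poly_bounded_const
      | exact: poly_bounded_id] => //.
move=> n m I env H s nm rs.
have [s0 [t0 [E0 b0 A0 r0 V0]]] := c0P _ _ _ _ _ _ rs.
pose J i s' := agree_below d s0 s' /\ ev s' y = acc n m I env H i.
have [||i s1 ik r1 [A1 V1]||s1 [t1 [E1 b1 [A1 V1] r1]]] :=
    @loop_spec _ _ I P env (fun=> H) x k c (T (n + m)) J _ _ _ s0 r0.
- by [].
- move=> i s1 v [A V1]; split; first by move=> j jd; have := A j jd.
  by rewrite -V1; apply: ydep => j _.
- have [s2 [t2 [E2 b2 A2 r2 V2]]] := cP _ _ _ _ _ _ _ nm ik r1 V1.
  by exists s2, t2; split=> //; split=> //; exact: agree_below_trans A2.
- by split.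
exists s1, (t0 + t1)%N; split=> //.
- exact: exec_Seq E1.
- apply: leq_add => //; apply: leq_trans b1 _; rewrite leq_add2r leq_mul2r.
  by case: (k); rewrite ?leq_addr ?leq_addl orbT.
- exact: agree_below_trans A1.
- by move=> s2 _ A2; rewrite hvE -V1; exact: ydep.
Qed.

End Expressions.

Lemma correct_pair E1 V1 ev1 hv1 E2 V2 ev2 hv2 E V (ev : state R -> E -> V) hv
    P d c1 (y1 : E1) d1 c2 (y2 : E2) d2 (y : E) :
  @correct E1 V1 ev1 hv1 P d (c1, y1, d1) ->
  @correct E2 V2 ev2 hv2 P d1 (c2, y2, d2) ->
  (forall n m (I : instance R n m) env H s, represents I P env H s ->
    ev1 s y1 = hv1 _ _ I env H -> ev2 s y2 = hv2 _ _ I env H ->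
    ev s y = hv _ _ I env H) ->
  correct ev hv P d (Seq c1 c2, y, d2).
Proof.
move=> [dd1 [T1 pT1 S1]] [dd2 [T2 pT2 S2]] yP.
split; first exact: leq_trans dd2.
exists (fun N => T1 N + T2 N)%N; first exact: poly_boundedD.
move=> n m I env H s nm rs.
have [s1 [t1 [X1 b1 A1 r1 W1]]] := S1 _ _ _ _ _ _ nm rs.
have [s2 [t2 [X2 b2 A2 r2 W2]]] := S2 _ _ _ _ _ _ nm r1.
exists s2, (t1 + t2)%N; split=> //.
- exact: exec_Seq X2.
- exact: leq_add.
- exact: agree_below_trans (agree_belowW dd1 A2).
move=> s3 r3 A3; apply: yP (W2 _ r3 A3) => //; apply: W1 => //.
exact: agree_below_trans (agree_belowW dd2 A3).
Qed.

Lemma correct_map E1 V1 ev1 hv1 E V (ev : state R -> E -> V) hv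
    P d c1 (y1 : E1) d1 (y : E) :
  @correct E1 V1 ev1 hv1 P d (c1, y1, d1) ->
  (forall n m (I : instance R n m) env H s, represents I P env H s ->
    ev1 s y1 = hv1 _ _ I env H -> ev s y = hv _ _ I env H) ->
  correct ev hv P d (c1, y, d1).
Proof.
move=> [dd1 [T1 pT1 S1]] yP; split=> //; exists T1 => // n m I env H s nm rs.
have [s1 [t1 [X1 b1 A1 r1 W1]]] := S1 _ _ _ _ _ _ nm rs.
by exists s1, t1; split=> // s2 r2 A2; apply: yP => //; exact: W1.
Qed.

Notation ncorrect e := (forall P d, nscoped P e ->
  correct (@neval R) (fun n m (I : instance R n m) env H => hneval I env H e)
    P d (ncompile d e)).
Notation rcorrect e := (forall P d, rscoped P e ->
  correct (@reval R) (fun n m (I : instance R n m) env H => hreval I env H e)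
    P d (rcompile d e)).
Notation bcorrect e := (forall P d, bscoped P e ->
  correct (@beval R) (fun n m (I : instance R n m) env H => hbeval I env H e)
    P d (bcompile d e)).

(** One round of such a loop: the code of the test, compiled above the accumulator and hence
    harmless to it, followed by the update [U]. *)
Lemma fold_spec E W (ev : state R -> E -> W) hv P d c (y : E) d' U V
    (val : state R -> V)
    (step : forall n m, instance R n m -> (nat -> nat) -> store -> V -> V) K :
  correct ev hv P d.+1 (c, y, d') ->
  (forall s s', agree_below d.+1 s s' -> val s' = val s) ->
  (forall n m (I : instance R n m) env H s, represents I P env H s ->
     ev s y = hv _ _ I env H ->
     exists s' t, [/\ exec U s s' t, (t <= K)%N, agree_below d s s',
       represents I P env H s' & val s' = step _ _ I env H (val s)]) ->
  exists2 T, poly_bounded T &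
    forall n m (I : instance R n m) env H s, (0 < n + m)%N ->
      represents I P env H s ->
      exists s' t, [/\ exec (Seq c U) s s' t, (t <= T (n + m))%N,
        agree_below d s s', represents I P env H s'
        & val s' = step _ _ I env H (val s)].
Proof.
move=> [dd1 [T1 pT1 S1]] vdep UP; exists (fun N => T1 N + K)%N.
  by apply: poly_boundedD => //; exact: poly_bounded_const.
move=> n m I env H s nm rs.
have [s1 [t1 [X1 b1 A1 r1 W1]]] := S1 _ _ _ _ _ _ nm rs.
have [s2 [t2 [X2 b2 A2 r2 W2]]] := UP _ _ _ _ _ _ r1 (W1 _ r1 (@agree_below_refl _ _)).
exists s2, (t1 + t2)%N; split=> //.
- exact: exec_Seq X2.
- exact: leq_add.
- exact: agree_below_trans (agree_belowW (leqnSn d) A1) A2.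
- by rewrite W2 (vdep _ _ A1).
Qed.

Lemma agree_nset d s y v :
  agree_below d s (State (update (nmem s) 5 0 d v) y) <-> 
  (forall k, (k < d)%N -> y 1 0 k = rmem s 1 0 k).
Proof.
rewrite /agree_below /update /=; split=> [A k kd|A k kd]; first by have [] := A k kd.
by split; [rewrite (ltn_eqF kd) | exact: A].
Qed.

Ltac compile_pair IH1 IH2 :=
  let compiled C := match goal with |- correct _ _ _ _ ?t -> _ =>
    let c := fresh "c" in let y := fresh "y" in let d := fresh "d" in
    destruct t as [[c y] d]; intros C end in
  let P := fresh "P" in let d := fresh "d" in
  let C1 := fresh "C" in let C2 := fresh "C" in
  intros P d; move=> /= /andP; intros [w1 w2];
  generalize (IH1 P d w1); compiled C1;
  match type of C1 with correct _ _ _ _ (_, _, ?d1) => generalize (IH2 P d1 w2) end;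
  compiled C2; apply: correct_pair C1 C2 _.

Lemma compile_exp :
  (forall e, ncorrect e) /\ (forall e, rcorrect e) /\ (forall b, bcorrect b).
Proof.
apply: hexp_ind.
- by move=> c P d _; exact: correct_skip.
- by move=> x P d xP; apply: correct_skip => n m I env H s rs /=; exact: rep_var rs _ xP.
- by move=> k P d _; apply: correct_skip => n m I env H s rs; exact: rep_bound rs k.
- move=> a e IH P d /= w; have := IH P d w; case: ncompile => [[c1 y1] d1] C1.
  apply: correct_map C1 _ => n m I env H s rs /= ->; exact: rep_store rs _ _.
- by move=> e1 IH1 e2 IH2; compile_pair IH1 IH2 => n m I env H s rs /= -> ->.
- by move=> e1 IH1 e2 IH2; compile_pair IH1 IH2 => n m I env H s rs /= -> ->.
- move=> x k b IH P d /= /andP[xP w].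
  have := IH (x :: P) d.+1 w; case: bcompile => [[c y] d1] C.
  apply: (@correct_acc _ _ _ _ _ _ _ _ _ _ _ (fun n m I env H i =>
    count (fun i => hbeval I (bind env x i) H b) (iota 0 i))) => //.
  + by move=> s s' A; have [] := A d (ltnSn d).
  + move=> n m I env H s rs; eexists; exists 4%N; split.
    * exact: (exec_NSet s 5 (NConst 0) (NConst d) (NConst 0)).
    * by [].
    * by apply/agree_nset.
    * exact: represents_ntmp.
    * by rewrite /= /update !eqxx.
  + have [||T pT S] := @fold_spec _ _ _ _ _ _ _ _ _ (If y (NSet 5 (NConst 0) (NConst d)
         (NAdd (ecell 5 d) (NConst 1))) Skip) _ (fun s => nmem s 5 0 d)
         (fun n m I env H v => hbeval I env H b + v)%N (bcost y + 20).+1 C.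
    * by move=> s s' A; have [] := A d (ltnSn d).
    * move=> n m I env H s rs yb.
      case bE : (hbeval I env H b).
      - exists (State (update (nmem s) 5 0 d (nmem s 5 0 d).+1) (rmem s)), (bcost y + 8).+1.
        split=> //.
        + apply: exec_If; rewrite yb bE -[(nmem s 5 0 d).+1]addn1.
          exact: (exec_NSet s 5 (NConst 0) (NConst d) (NAdd (ecell 5 d) (NConst 1))).
        + by rewrite ltnS leq_add2l.
        + by apply/agree_nset.
        + exact: represents_ntmp.
        + by rewrite /= /update !eqxx.
      - exists s, (bcost y + 1).+1; split=> //.
        + by apply: exec_If; rewrite yb bE; exact: exec_Skip.
        + by rewrite ltnS leq_add2l.
    exists T => // n m I env H i s nm ik rs si.
    have [s' [t [X bt A r' V']]] := S _ _ _ _ _ _ nm rs; exists s', t; split=> //.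
    by apply: (etrans V'); cbv beta; rewrite /= in si; rewrite si -[i.+1]addn1 iotaD count_cat /= addn0 addnC.
- move=> x k b IH P d /= /andP[xP w].
  have := IH (x :: P) d.+1 w; case: bcompile => [[c y] d1] C.
  (* A failing search among the first i numbers would return i, whereas the cell keeps its initial
     value, the full bound; hence the case distinction. *)
  apply: (@correct_acc _ _ _ _ _ _ _ _ _ _ _ (fun n m I env H i =>
    let p := fun i => hbeval I (bind env x i) H b in
    if has p (iota 0 i) then find p (iota 0 i) else bound n m k)) => //.
  + by move=> s s' A; have [] := A d (ltnSn d).
  + move=> n m I env H s rs.
    exists (State (update (nmem s) 5 0 d (bound n m k)) (rmem s)), 6%N; split.
    * have := exec_NSet s 5 (NConst 0) (NConst d) (ebound k).
      by rewrite (rep_bound rs); case: (k).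
    * by [].
    * by apply/agree_nset.
    * exact: represents_ntmp.
    * by rewrite /= /update !eqxx.
  + have [||T pT S] := @fold_spec _ _ _ _ _ _ _ _ _ (If (BAnd y (NLe (ebound k) (ecell 5 d)))
                              (NSet 5 (NConst 0) (NConst d) (ecell 4 x)) Skip) _ (fun s => nmem s 5 0 d)
         (fun n m I env H v => if hbeval I env H b && (bound n m k <= v)%N then env x else v)%N (bcost y + 30).+1 C.
    * by move=> s s' A; have [] := A d (ltnSn d).
    * move=> n m I env H s rs yb.
      have cE : beval s (BAnd y (NLe (ebound k) (ecell 5 d))) =
                hbeval I env H b && (bound n m k <= nmem s 5 0 d)%N.
        by rewrite -(rep_bound rs) -yb.
      have bE : bcost (BAnd y (NLe (ebound k) (ecell 5 d))) = (bcost y + 7).+1.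
        by case: (k).
      case: ifP => bb.
      - exists (State (update (nmem s) 5 0 d (env x)) (rmem s)), ((bcost y + 7).+1 + 6).+1.
        split=> //.
        + rewrite -bE; apply: exec_If; rewrite cE bb -(rep_var rs (mem_head x P)).
          exact: (exec_NSet s 5 (NConst 0) (NConst d) (ecell 4 x)).
        + by rewrite ltnS addSn -addnA -addnS leq_add2l.
        + by apply/agree_nset.
        + exact: represents_ntmp.
        + by rewrite /= /update !eqxx.
      - exists s, ((bcost y + 7).+1 + 1).+1; split=> //.
        + by rewrite -bE; apply: exec_If; rewrite cE bb; exact: exec_Skip.
        + by rewrite ltnS addSn -addnA -addnS leq_add2l.
    exists T => // n m I env H i s nm ik rs si.
    have [s' [t [X bt A r' V']]] := S _ _ _ _ _ _ nm rs; exists s', t; split=> //.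
    have bx : bind env x i x = i by rewrite /bind eqxx.
    apply: (etrans V'); rewrite /= in si; cbv beta zeta; rewrite si bx.
    rewrite -[i.+1]addn1 iotaD has_cat find_cat size_iota add0n.
    set p := fun _ => hbeval _ _ _ _; rewrite -[hbeval _ _ _ _]/(p i).
    have -> : has p (iota i 1) = p i by rewrite /= orbF.
    have -> : find p (iota i 1) = ~~ p i by rewrite /=; case: (p i).
    case hp: (has p (iota 0 i)) => /=; last first.
      by rewrite leqnn andbT; case: (p i); rewrite ?addn0.
    (* A hit among the first i numbers is below the bound, so the guard blocks any later
       overwrite. *)
    rewrite leqNgt (ltn_trans _ ik) ?andbF //.
    by rewrite -[X in (_ < X)%N](size_iota 0 i) -has_find.
  + move=> n m I env H /=; case: ifP => // /negbT hp.
    by rewrite hasNfind // size_iota.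
- by move=> e1 IH1 e2 IH2; compile_pair IH1 IH2 => n m I env H s rs /= -> ->; exact: rep_value rs _ _.
- by move=> e1 IH1 e2 IH2; compile_pair IH1 IH2 => n m I env H s rs /= -> ->.
- move=> x k b IHb e IHe P d /= /and3P[xP wb we].
  have := IHb (x :: P) d.+1 wb; case: bcompile => [[c y] d1] Cb.
  have := IHe (x :: P) d1 we; case: rcompile => [[c1 y1] d2] Ce.
  (* Test and summand are both computed before the conditional, which only guards the addition. *)
  have C := @correct_pair _ _ _ _ _ _ _ _ _ _
    (fun (s : state R) z => (beval s z.1, reval s z.2))
    (fun n m (I : instance R n m) env H => (hbeval I env H b, hreval I env H e))
    _ _ _ _ _ _ _ _ (y, y1) Cb Ce.
  apply: (@correct_acc _ _ _ _ _ _ _ _ _ _ _ (fun n m I env H i =>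
    \sum_(i <- iota 0 i | hbeval I (bind env x i) H b) hreval I (bind env x i) H e)) => //.
  + by move=> s s' A; have [] := A d (ltnSn d).
  + move=> n m I env H s rs; eexists; exists 5%N; split.
    * exact: (exec_RSet s 1 (NConst 0) (NConst d) (RNat (NConst 0))).
    * by [].
    * by move=> j jd; rewrite /= /update (ltn_eqF jd).
    * exact: represents_rtmp.
    * by rewrite /= /update !eqxx big_nil.
  + have [|||T pT S] := @fold_spec _ _ _ _ _ _ _ _ _ (If y (RSet 1 (NConst 0) (NConst d)
                     (RAdd (RGet 1 (NConst 0) (NConst d)) y1)) Skip) _ (fun s => rmem s 1 0 d)
         (fun n m I env H v => if hbeval I env H b then v + hreval I env H e else v) (bcost y + rcost y1 + 30).+1 (C _).
    * by move=> n m I env H s rs /= -> ->.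
    * by move=> s s' A; have [] := A d (ltnSn d).
    * move=> n m I env H s rs /= [yb ye].
      case: ifP => bE.
      - exists (State (nmem s) (update (rmem s) 1 0 d (rmem s 1 0 d + hreval I env H e))), (bcost y + (rcost y1 + 7)).+1.
        split=> //.
        + apply: exec_If; rewrite yb bE -ye [(rcost y1 + 7)%N]addnC.
          exact: (exec_RSet s 1 (NConst 0) (NConst d)
                    (RAdd (RGet 1 (NConst 0) (NConst d)) y1)).
        + by rewrite ltnS -!addnA !leq_add2l.
        + by move=> j jd; rewrite /= /update (ltn_eqF jd).
        + exact: represents_rtmp.
        + by rewrite /= /update !eqxx.
      - exists s, (bcost y + 1).+1; split=> //.
        + by apply: exec_If; rewrite yb bE; exact: exec_Skip.
        + by rewrite ltnS -addnA leq_add2l addn_gt0 orbT.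
    exists T => // n m I env H i s nm ik rs si.
    have [s' [t [X bt A r' V']]] := S _ _ _ _ _ _ nm rs; exists s', t; split=> //.
    apply: (etrans V'); cbv beta; rewrite /= in si; rewrite si -[i.+1]addn1 iotaD big_cat /= big_cons big_nil add0n addr0.
    by case: ifP => //; rewrite addr0.
- by move=> e1 IH1 e2 IH2; compile_pair IH1 IH2 => n m I env H s rs /= -> ->.
- by move=> e1 IH1 e2 IH2; compile_pair IH1 IH2 => n m I env H s rs /= -> ->.
- move=> b IH P d /= w; have := IH P d w; case: bcompile => [[c1 y1] d1] C1.
  by apply: correct_map C1 _ => n m I env H s rs /= ->.
- by move=> e1 IH1 e2 IH2; compile_pair IH1 IH2 => n m I env H s rs /= -> ->.
- move=> e1 IH1 e2 IH2; compile_pair IH1 IH2 => n m I env H s rs /= -> ->.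
  by rewrite (rep_conflict rs); case: conflict_at.
Qed.

(** Induction on the program: a loop multiplies the time bound of its body by n + m. [T] is chosen
    before the instance and the store. *)
Lemma compile_spec (c : hcmd) P : scoped P c ->
  exists2 T, poly_bounded T &
  forall n m (I : instance R n m) env H s, (0 < n + m)%N ->
    represents I P env H s ->
  exists s' t, [/\ exec (compile c) s s' t, (t <= T (n + m))%N
    & represents I P env (hrun I env c H) s'].
Proof.
have [nP [_ bP]] := compile_exp.
elim: c P => [|a e1 e2|c1 IH1 c2 IH2|b c1 IH1 c2 IH2|x k c IH] P /=.
- move=> _; exists (fun=> 1%N); first exact: poly_bounded_const.
  by move=> n m I env H s _ rs; exists s, 1%N; split=> //; exact: exec_Skip.
- move=> /andP[w1 w2].
  have := nP e1 P 0%N w1; case: ncompile => [[c1 y1] d1] C1.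
  have := nP e2 P d1 w2; case: ncompile => [[c2 y2] d2] C2.
  have [|_ [T pT S]] := @correct_pair _ _ _ _ _ _ _ _ _ _
    (fun (s : state R) z => (neval s z.1, neval s z.2))
    (fun n m (I : instance R n m) env H => (hneval I env H e1, hneval I env H e2))
    _ _ _ _ _ _ _ _ (y1, y2) C1 C2.
    by move=> n m I env H s rs /= -> ->.
  exists (fun N => T N + (1 + ncost y1 + ncost y2).+1)%N.
    by apply: poly_boundedD => //; exact: poly_bounded_const.
  move=> n m I env H s nm rs.
  have [s1 [t1 [X1 b1 A1 r1 W1]]] := S _ _ _ _ _ _ nm rs.
  have [V1 V2] := W1 _ r1 (@agree_below_refl _ _).
  exists (State (update (nmem s1) (address a) 0 (neval s1 y1) (neval s1 y2)) (rmem s1)).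
  exists (t1 + (1 + ncost y1 + ncost y2).+1)%N; split.
  + apply: exec_Seq X1 _.
    exact: (exec_NSet s1 (address a) (NConst 0) y1 y2).
  + by rewrite leq_add2r.
  + by rewrite V1 V2; exact: represents_put.
- move=> /andP[/IH1[T1 pT1 S1] /IH2[T2 pT2 S2]].
  exists (fun N => T1 N + T2 N)%N; first exact: poly_boundedD.
  move=> n m I env H s nm rs.
  have [s1 [t1 [X1 b1 r1]]] := S1 _ _ _ _ _ _ nm rs.
  have [s2 [t2 [X2 b2 r2]]] := S2 _ _ _ _ _ _ nm r1.
  exists s2, (t1 + t2)%N; split=> //; first exact: exec_Seq X2.
  exact: leq_add.
- move=> /and3P[wb /IH1[T1 pT1 S1] /IH2[T2 pT2 S2]].
  have := bP b P 0%N wb; case: bcompile => [[c y] d] [_ [T pT S]].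
  exists (fun N => T N + ((bcost y).+1 + (T1 N + T2 N)))%N.
    do ![apply: poly_boundedD => //]; exact: poly_bounded_const.
  move=> n m I env H s nm rs.
  have [s1 [t1 [X1 b1 A1 r1 W1]]] := S _ _ _ _ _ _ nm rs.
  have V1 := W1 _ r1 (@agree_below_refl _ _).
  have [s2 [t2 [X2 b2 r2]]] : exists s2 t2,
      [/\ exec (if beval s1 y then compile c1 else compile c2) s1 s2 t2,
          (t2 <= T1 (n + m) + T2 (n + m))%N
        & represents I P env
            (if hbeval I env H b then hrun I env c1 H else hrun I env c2 H) s2].
    rewrite V1; case: ifP => _.
      have [s2 [t2 [X2 b2 r2]]] := S1 _ _ _ _ _ _ nm r1.
      by exists s2, t2; split=> //; rewrite (leq_trans b2) ?leq_addr.
    have [s2 [t2 [X2 b2 r2]]] := S2 _ _ _ _ _ _ nm r1.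
    by exists s2, t2; split=> //; rewrite (leq_trans b2) ?leq_addl.
  exists s2, (t1 + (bcost y + t2).+1)%N; split=> //.
    by apply: exec_Seq X1 _; exact: exec_If.
  by apply: leq_add => //; rewrite addSn ltnS leq_add2l.
- move=> /andP[xP /IH[T pT S]].
  exists (fun N => N * (T N + 20) + 20)%N.
    do ![apply: poly_boundedD | apply: poly_boundedM | exact: poly_bounded_const
        | exact: poly_bounded_id] => //.
  move=> n m I env H s nm rs.
  pose f H' i := hrun I (bind env x i) c H'.
  have [|i s1 ik r1 _||s1 [t1 [E1 b1 _ r1]]] := @loop_spec _ _ I P env
    (fun i => foldl f H (iota 0 i)) x k (compile c) (T (n + m)) (fun _ _ => True) xP _ _ s rs.
  + by [].
  + have [s2 [t2 [X2 b2 r2]]] := S _ _ _ _ _ _ nm r1.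
    exists s2, t2; split=> //.
    by rewrite -addn1 iotaD foldl_cat.
  + by [].
  exists s1, t1; split=> //; apply: leq_trans b1 _.
  rewrite leq_add2r leq_mul2r.
  by case: (k); rewrite ?leq_addr ?leq_addl orbT.
Qed.

Lemma represents_input n m (I : instance R n m) :
  represents I [::] (fun=> 0%N) (fun _ _ => 0%N) (input I).
Proof.
split=> //=.
- by case.
- move=> x y; rewrite /conflict_at.
  by case: insub => [j|] //; case: insub.
- by case.
Qed.

(** [poly_bounded] speaks of positive arguments only, hence the condition 0 < n + m. *)
Lemma solves_compile (c : hcmd)
    (P : forall n m : nat, instance R n m -> Prop)
    (Q : forall n m : nat, instance R n m -> {ffun 'I_n -> {set 'I_m}} -> Prop) :
  scoped [::] c ->
  (forall n m (I : instance R n m), P n m I -> (0 < n + m)%N) ->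
  (forall n m (I : instance R n m), P n m I ->
     let H := hrun I (fun=> 0%N) c (fun _ _ => 0%N) in
     Q n m I [ffun i : 'I_n => [set j : 'I_m | H 0%N j == i :> nat]]) ->
  solves_in_poly_time (compile c) P Q.
Proof.
move=> /compile_spec[T [a [k pT]] S] P0 PQ; exists a, k => n m I PI.
have nm := P0 _ _ _ PI.
have [s [t [X b r]]] := S _ _ _ _ _ _ nm (represents_input I).
exists s, t; split=> //; first exact: leq_trans (pT _ nm).
rewrite /output; have := PQ _ _ _ PI; congr Q.
by apply/ffunP=> i; rewrite !ffunE; apply/setP=> j; rewrite !inE -(rep_store r).
Qed.

End Correctness.

(** * The program *)

Definition lt_ (e1 e2 : hnexp) : hbexp := HLe (HAdd e1 (HConst 1)) e2.
Definition eq_ (e1 e2 : hnexp) : hbexp := HAnd (HLe e1 e2) (HLe e2 e1).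
Definition true_ : hbexp := HLe (HConst 0) (HConst 0).
Definition or_ (b1 b2 : hbexp) : hbexp := HNot (HAnd (HNot b1) (HNot b2)).
Definition ex_ (x : nat) (k : range) (b : hbexp) : hbexp :=
  lt_ (HFind x k b) (HBound k).
Definition all_ (x : nat) (k : range) (b : hbexp) : hbexp :=
  HNot (ex_ x k (HNot b)).

Definition agents_ : hnexp := HBound Agents.
Definition items_ : hnexp := HBound Items.
Definition get0 (a : nat) : hnexp := HGet a (HConst 0).
Definition set0_ (a : nat) (e : hnexp) : hcmd := HSet a (HConst 0) e.

Fixpoint seq_ (s : seq hcmd) : hcmd :=
  match s with
  | [::] => HSkip
  | [:: c] => c
  | c :: s' => HSeq c (seq_ s')
  end.

Definition when_ (b : hbexp) (c : hcmd) : hcmd := HIf b c HSkip.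

(* The arrays of the program: agent of an item, agents that are done, items that
   were left when the thresholds were fixed, the same for the first of two agents,
   group of an item, processed items, marks, colours, groups of the local search;
   the others hold a single number. *)
Definition OUT := 0%N.
Definition DONE := 1%N.
Definition BASE := 2%N.
Definition BASE1 := 3%N.
Definition GRP := 4%N.
Definition SEEN := 5%N.
Definition MARK := 6%N.
Definition COL := 7%N.
Definition LOC := 8%N.
Definition NUM0 := 9%N.
Definition AG := 10%N.
Definition AG2 := 11%N.
Definition IT := 12%N.
Definition CC := 13%N.
Definition CC2 := 14%N.
Definition SIDE := 15%N.
Definition WHO := 16%N.

(** The number n stands for no agent and for no colour. It is also the result of an unsuccessful
    [HFind] over the agents, so a failed choice needs no special treatment. *)
Definition free_ (e : hnexp) : hbexp := HLe agents_ (HGet OUT e).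
Definition active_ (e : hnexp) : hbexp := HLe (HGet DONE e) (HConst 0).
Definition nactive_ : hnexp := HCount 90 Agents (active_ (HVar 90)).

(** Quantities up to Delta are found by a search among the agents, whose numbers reach that far
    since Delta < n. *)
Definition degree_ : hnexp :=
  HFind 91 Agents
    (all_ 92 Items (HLe (HCount 93 Items (HAdj (HVar 92) (HVar 93))) (HVar 91))).

(* 1 if the maximum degree is 1, resp. 2, and 0 if it is any other positive
   number. *)
Definition is1_ : hnexp := HSub (HConst 2) degree_.
Definition is2_ : hnexp := HSub (HSub (HSub (HConst 3) degree_) is1_) is1_.
(** Together with [den_] this gives alpha as 2 / (Delta + 2), corrected by the indicators of the
    degrees 1 and 2 to 1/2 and 3/7. *)
Definition num_ : hnexp := HAdd (HSub (HConst 2) is1_) is2_.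
Definition den_ : hnexp :=
  HAdd (HSub (HAdd degree_ (HConst 2)) is1_) (HAdd is2_ (HAdd is2_ is2_)).

Definition odd_ : hbexp :=
  HNot (ex_ 94 Agents (eq_ (HAdd (HVar 94) (HVar 94)) degree_)).
(** The least p with Delta < 2 p: among that many groups, one contains at most one neighbour of a
    given item. *)
Definition ngroups_ : hnexp :=
  HFind 94 Agents (lt_ degree_ (HAdd (HVar 94) (HVar 94))).

Definition value_ (x : nat) (i : hnexp) (b : hbexp) : hrexp :=
  HSum x Items b (HVal i (HVar x)).

(** The comparison of e with a threshold alpha v_i(b) / k, cross-multiplied. *)
Definition enough_ (i : hnexp) (b : hbexp) (k : hnexp) (e : hrexp) : hbexp :=
  HRLe (HMuln (value_ 95 i b) num_) (HMuln (HMuln e k) den_).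

Definition fill (a : nat) (b : hbexp) (e : hnexp) : hcmd :=
  HFor 0 Items (when_ b (HSet a (HVar 0) e)).

Definition give (c : nat) (i : hnexp) : hcmd :=
  HSeq (fill OUT (eq_ (HGet MARK (HVar 0)) (HConst c)) i)
       (HSet DONE i (HConst 1)).

Definition fit_ (a : nat) (k : hnexp) : hnexp :=
  HFind 1 Agents (HAnd (lt_ (HVar 1) k)
        (HNot (ex_ 2 Items (HAnd (HAdj (HVar 0) (HVar 2))
                                 (eq_ (HGet a (HVar 2)) (HVar 1)))))).

Definition first_fit (a : nat) (b : hbexp) (k : hnexp) : hcmd :=
  HFor 0 Items (when_ (HAnd b (HLe agents_ (HGet a (HVar 0))))
    (HSet a (HVar 0)
      (fit_ a k))).

Definition crowded_ : hbexp := HLe (HConst 2) (HCount 3 Items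
      (HAnd (HAdj (HVar 2) (HVar 3))
            (eq_ (HGet LOC (HVar 3)) (HGet LOC (HVar 2))))).
Definition light_ : hbexp := HAnd (lt_ (HVar 2) ngroups_)
        (HLe (HCount 3 Items (HAnd (HAdj (get0 IT) (HVar 3))
                                   (eq_ (HGet LOC (HVar 3)) (HVar 2))))
             (HConst 1)).
Definition search_step : hcmd := seq_ [::
    set0_ IT (HFind 2 Items crowded_);
    when_ (lt_ (get0 IT) items_)
      (HSet LOC (get0 IT) (HFind 2 Agents light_))].
(** m^2 steps suffice: the number of ordered pairs of neighbours in a common group is at most m^2
    and drops with every move. *)
Definition local_search : hcmd :=
  HFor 0 Items (HFor 1 Items search_step).

Definition single_ (i j : hnexp) : hbexp :=
  HAnd (free_ j) (enough_ i (free_ (HVar 95)) nactive_ (HVal i j)).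

Definition give_single : hcmd := seq_ [::
  set0_ IT (HFind 2 Items (single_ (get0 WHO) (HVar 2)));
  HSet OUT (get0 IT) (get0 WHO);
  HSet DONE (get0 WHO) (HConst 1)].
Definition single_step : hcmd := seq_ [::
    set0_ WHO (HFind 1 Agents
      (HAnd (active_ (HVar 1)) (ex_ 2 Items (single_ (HVar 1) (HVar 2)))));
    when_ (lt_ (get0 WHO) agents_) give_single].
Definition singles : hcmd :=
  HFor 0 Agents single_step.

Definition heavy_ (i : hnexp) (a : nat) (g j : hnexp) : hbexp :=
  HAnd (HAnd (free_ j) (eq_ (HGet a j) g))
    (HNot (ex_ 80 Items (HAnd
      (HAnd (free_ (HVar 80)) (eq_ (HGet a (HVar 80)) g))
      (HAnd (HAdj j (HVar 80))
         (or_ (HNot (HRLe (HVal i (HVar 80)) (HVal i j)))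
              (HAnd (HRLe (HVal i j) (HVal i (HVar 80)))
                    (lt_ (HVar 80) j))))))).
Definition heavy_value_ (i : hnexp) (a : nat) (g : hnexp) : hrexp :=
  value_ 81 i (heavy_ i a g (HVar 81)).

Definition first_active : hcmd :=
  set0_ AG (HFind 1 Agents (active_ (HVar 1))).

Definition best_group_ : hbexp :=
  all_ 2 Agents
    (HRLe (heavy_value_ (get0 AG) LOC (HVar 2))
          (heavy_value_ (get0 AG) LOC (HVar 1))).
Definition last_agent : hcmd := seq_ [::
  first_active;
  set0_ CC (HFind 1 Agents best_group_);
  fill MARK true_ (HConst 0);
  fill MARK (heavy_ (get0 AG) LOC (get0 CC) (HVar 0)) (HConst 1);
  give 1 (get0 AG)].

Definition in_bag_ (c j x : hnexp) : hbexp :=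
  HAnd (HAnd (free_ x) (eq_ (HGet COL x) c)) (HLe x j).
Definition claims_ (i c j : hnexp) : hbexp :=
  HAnd (active_ i)
    (enough_ i (HLe (HConst 1) (HGet BASE (HVar 95))) (get0 NUM0)
       (value_ 80 i (in_bag_ c j (HVar 80)))).

Definition bag_step : hcmd := seq_ [::
  fill COL true_ agents_;
  first_fit COL (free_ (HVar 0)) agents_;
  set0_ CC (HFind 1 Agents (ex_ 2 Items (ex_ 3 Agents
    (claims_ (HVar 3) (HVar 1) (HVar 2)))));
  set0_ IT (HFind 2 Items (ex_ 3 Agents (claims_ (HVar 3) (get0 CC) (HVar 2))));
  set0_ WHO (HFind 3 Agents (claims_ (HVar 3) (get0 CC) (get0 IT)));
  fill MARK true_ (HConst 0);
  fill MARK (in_bag_ (get0 CC) (get0 IT) (HVar 0)) (HConst 1);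
  give 1 (get0 WHO)].

Definition bags (stop : nat) : hcmd :=
  HFor 9 Agents (when_ (lt_ (HConst stop) nactive_) bag_step).

(** The two colours that follow the Delta - 2 colours of first fit. *)
Definition col0_ : hnexp := HSub degree_ (HConst 2).
Definition col1_ : hnexp := HSub degree_ (HConst 1).

Definition pending_ (x : hnexp) : hbexp :=
  HAnd (free_ x) (HAnd (HLe agents_ (HGet GRP x)) (HLe (HGet SEEN x) (HConst 0))).
Definition sees_ (x c : hnexp) : hbexp :=
  ex_ 3 Items (HAnd (HAdj x (HVar 3)) (eq_ (HGet GRP (HVar 3)) c)).

Definition fringe_ : hbexp :=
  HAnd (HAnd (HLe (HGet MARK (HVar 1)) (HConst 0))
    (HAnd (HLe col0_ (HGet GRP (HVar 1))) (lt_ (HGet GRP (HVar 1)) agents_)))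
    (ex_ 2 Items (HAnd (HLe (HConst 1) (HGet MARK (HVar 2)))
                       (HAdj (HVar 1) (HVar 2)))).
(** Repeated m times, this enlarges a marked item to its Kempe component, its connected component
    among the items of the last two colours. *)
Definition grow : hcmd := seq_ [::
  set0_ CC (HFind 1 Items fringe_);
  when_ (lt_ (get0 CC) items_) (HSet MARK (get0 CC) (HConst 1))].

(** Replacing a colour c by [col0_] + [col1_] - c exchanges the two colours on the component. *)
Definition flip : hcmd := seq_ [::
  fill MARK true_ (HConst 0);
  HSet MARK (HFind 1 Items (HAnd (HAdj (get0 IT) (HVar 1))
                                 (eq_ (HGet GRP (HVar 1)) col0_))) (HConst 1);
  HFor 8 Items grow;
  fill GRP (HLe (HConst 1) (HGet MARK (HVar 0)))
    (HSub (HAdd col0_ col1_) (HGet GRP (HVar 0)))].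

Definition next_ : hbexp :=
  HAnd (pending_ (HVar 1))
    (all_ 2 Items (or_ (HNot (pending_ (HVar 2)))
      (HRLe (HVal (get0 AG) (HVar 2)) (HVal (get0 AG) (HVar 1))))).
(** An item that still sees both colours after the exchange stays uncoloured and is thereby dropped;
    [SEEN] prevents it from being chosen again. *)
Definition insert : hcmd := seq_ [::
  set0_ IT (HFind 1 Items next_);
  when_ (lt_ (get0 IT) items_) (seq_ [::
    HSet SEEN (get0 IT) (HConst 1);
    when_ (HAnd (sees_ (get0 IT) col0_) (sees_ (get0 IT) col1_)) flip;
    HIf (sees_ (get0 IT) col0_)
      (when_ (HNot (sees_ (get0 IT) col1_)) (HSet GRP (get0 IT) col1_))
      (HSet GRP (get0 IT) col0_)])].

Definition colour_drop : hcmd := seq_ [::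
  fill GRP true_ agents_;
  first_fit GRP (free_ (HVar 0)) col0_;
  fill SEEN true_ (HConst 0);
  HFor 9 Items insert].

(** The threshold measured on the coloured items may be smaller than the one on all free items, so
    an item can reach the former although none reaches the latter. *)
Definition pair_single_ : hbexp :=
  HAnd (lt_ (HGet GRP (HVar 1)) agents_)
    (enough_ (get0 AG) (HLe (HConst 1) (HGet BASE1 (HVar 95))) (get0 NUM0)
       (HVal (get0 AG) (HVar 1))).
Definition even_pair : hcmd := seq_ [::
  first_active;
  colour_drop;
  fill BASE1 true_ (HConst 0);
  fill BASE1 (lt_ (HGet GRP (HVar 0)) agents_) (HConst 1);
  set0_ IT (HFind 1 Items pair_single_);
  when_ (lt_ (get0 IT) items_) (seq_ [::
    HSet OUT (get0 IT) (get0 AG);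
    HSet DONE (get0 AG) (HConst 1)])].

Definition odd_pair : hcmd := seq_ [::
  first_active;
  fill GRP true_ agents_;
  fill GRP (free_ (HVar 0)) (HGet LOC (HVar 0));
  fill BASE1 true_ (HGet BASE (HVar 0))].

Definition marked_value_ (i : hnexp) (c : nat) : hrexp :=
  value_ 80 i (eq_ (HGet MARK (HVar 80)) (HConst c)).

(** The heavier end of an edge goes to the side that is lighter so far. If the item has no partner
    in the group, [IT] is m, which is worth 0 and whose mark is never read. *)
Definition split_step : hcmd :=
  when_ (HAnd (HAnd (free_ (HVar 0)) (eq_ (HGet GRP (HVar 0)) (get0 CC)))
          (eq_ (HGet MARK (HVar 0)) (HConst 0))) (seq_ [::
      set0_ IT (HFind 1 Items (HAnd
        (HAnd (free_ (HVar 1)) (eq_ (HGet GRP (HVar 1)) (get0 CC)))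
        (HAdj (HVar 0) (HVar 1))));
      HIf (HRLe (marked_value_ (get0 AG) 1) (marked_value_ (get0 AG) 2))
        (set0_ SIDE (HConst 1)) (set0_ SIDE (HConst 2));
      HIf (HRLe (HVal (get0 AG) (get0 IT)) (HVal (get0 AG) (HVar 0)))
        (HSeq (HSet MARK (get0 IT) (HSub (HConst 3) (get0 SIDE)))
              (HSet MARK (HVar 0) (get0 SIDE)))
        (HSeq (HSet MARK (get0 IT) (get0 SIDE))
              (HSet MARK (HVar 0) (HSub (HConst 3) (get0 SIDE))))]).

Definition split_group : hcmd := HFor 0 Items split_step.

Definition group_enough_ (g : hnexp) : hbexp :=
  enough_ (get0 AG) (HLe (HConst 1) (HGet BASE1 (HVar 95))) (get0 NUM0)
    (heavy_value_ (get0 AG) GRP g).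

(** Cut and choose: either marked set satisfies the first agent. The second one takes set 1 if it
    suffices; otherwise losing that set costs it less than its threshold. *)
Definition hand_out : hcmd :=
  HIf (enough_ (get0 AG2) (HLe (HConst 1) (HGet BASE (HVar 95))) (get0 NUM0)
         (marked_value_ (get0 AG2) 1))
    (HSeq (give 1 (get0 AG2)) (give 2 (get0 AG)))
    (give 1 (get0 AG)).

Definition serve_pair : hcmd := seq_ [::
  set0_ AG2 (HFind 1 Agents
    (HAnd (active_ (HVar 1)) (HNot (eq_ (HVar 1) (get0 AG)))));
  set0_ CC (HFind 1 Agents (group_enough_ (HVar 1)));
  set0_ CC2 (HFind 1 Agents (HAnd (lt_ (get0 CC) (HVar 1)) (group_enough_ (HVar 1))));
  fill MARK true_ (HConst 0);
  HIf (lt_ (get0 CC2) agents_)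
    (HSeq (fill MARK (heavy_ (get0 AG) GRP (get0 CC) (HVar 0)) (HConst 1))
          (fill MARK (heavy_ (get0 AG) GRP (get0 CC2) (HVar 0)) (HConst 2)))
    split_group;
  hand_out].

Definition late_rounds : hcmd := seq_ [::
  when_ odd_ (HSeq (bags 2) odd_pair);
  when_ (HAnd (eq_ nactive_ (HConst 2)) (or_ odd_ (eq_ (get0 NUM0) (HConst 2))))
    serve_pair;
  bags 0].
Definition rounds : hcmd := seq_ [::
  when_ (HAnd (eq_ (get0 NUM0) (HConst 2)) (HNot odd_)) even_pair;
  when_ (eq_ nactive_ (HConst 1)) last_agent;
  late_rounds].

Definition program : hcmd := seq_ [::
  fill OUT true_ agents_;
  local_search;
  singles;
  fill BASE (free_ (HVar 0)) (HConst 1);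
  set0_ NUM0 nactive_;
  rounds;
  first_fit OUT true_ agents_].

Lemma program_scoped : scoped [::] program.
Proof. by vm_compute. Qed.

Fixpoint writes (c : hcmd) : seq nat :=
  match c with
  | HSkip => [::]
  | HSet a _ _ => [:: a]
  | HSeq c1 c2 | HIf _ c1 c2 => writes c1 ++ writes c2
  | HFor _ _ c1 => writes c1
  end.

Lemma put_frame (H : store) a x e b : b != a -> put H a x e b = H b.
Proof. by move=> ba; apply: boolp.funext => y; rewrite /put (negbTE ba). Qed.

(** * Frame and evaluation lemmas *)

Section Semantics.
Variables (R : realType) (n m : nat) (I : instance R n m).
Implicit Types (H : store) (env : nat -> nat).

Lemma foldl_iota (T : Type) (Inv : nat -> T -> Prop) (f : T -> nat -> T) k x :
  Inv 0%N x -> (forall i y, (i < k)%N -> Inv i y -> Inv i.+1 (f y i)) ->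
  Inv k (foldl f x (iota 0 k)).
Proof.
move=> Inv0; elim: k => [|k IH] InvS; first by [].
rewrite -[k.+1]addn1 iotaD foldl_cat addn1 /=; apply: (InvS) => //.
by apply: IH => i y ik; apply: InvS; exact: ltnW.
Qed.

Lemma hrun_frame env c H a : a \notin writes c -> hrun I env c H a = H a.
Proof.
elim: c env H => [|b e1 e2|c1 IH1 c2 IH2|b c1 IH1 c2 IH2|x k c IH] env H //=.
- by rewrite inE; exact: put_frame.
- by rewrite mem_cat negb_or => /andP[a1 a2]; rewrite IH2 // IH1.
- by rewrite mem_cat negb_or => /andP[a1 a2]; case: ifP => _; rewrite ?IH1 ?IH2.
- move=> ac; apply: (@foldl_iota _ (fun _ H' => H' a = H a)) => // i H' _ <-.
  exact: IH.
Qed.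

Lemma fill_frame env a b e H a' : a' != a -> hrun I env (fill a b e) H a' = H a'.
Proof. by move=> a'a; apply: hrun_frame; rewrite inE. Qed.

Lemma first_fit_frame env a b k H a' :
  a' != a -> hrun I env (first_fit a b k) H a' = H a'.
Proof. by move=> a'a; apply: hrun_frame; rewrite inE. Qed.

Variant find_spec (p : pred nat) (k : nat) : nat -> bool -> Prop :=
| FindSome i of (i < k)%N & p i & (forall j, (j < i)%N -> ~~ p j) : find_spec p k i true
| FindNone of (forall j, (j < k)%N -> ~~ p j) : find_spec p k k false.

Lemma find_iotaP p k : find_spec p k (find p (iota 0 k)) (find p (iota 0 k) < k)%N.
Proof.
case: (boolP (has p (iota 0 k))) => hp.
  have fk : (find p (iota 0 k) < k)%N by rewrite -[X in (_ < X)%N](size_iota 0) -has_find.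
  rewrite fk; constructor=> //.
    by have := nth_find 0%N hp; rewrite nth_iota.
  move=> j jf; have := before_find 0%N jf; rewrite nth_iota ?add0n => [->|] //.
  exact: ltn_trans fk.
rewrite hasNfind // size_iota ltnn; constructor=> j jk.
apply: contra hp => pj; apply/hasP; exists j => //.
by rewrite mem_iota.
Qed.

Lemma ex_E env H x k b :
  hbeval I env H (ex_ x k b) =
  [exists i : 'I_(bound n m k), hbeval I (bind env x i) H b].
Proof.
rewrite /= addn1; case: find_iotaP => [i ik bi _|nb].
  by apply/esym/existsP; exists (Ordinal ik).
by apply/esym/existsP=> -[i bi]; have := nb i (ltn_ord i); rewrite bi.
Qed.

Lemma all_E env H x k b :
  hbeval I env H (all_ x k b) =
  [forall i : 'I_(bound n m k), hbeval I (bind env x i) H b].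
Proof.
rewrite (_ : hbeval I env H _ = ~~ hbeval I env H (ex_ x k (HNot b))) //.
by rewrite ex_E negb_exists; apply: eq_forallb => i /=; rewrite negbK.
Qed.

Lemma count_E p k : count p (iota 0 k) = #|[set i : 'I_k | p i]|.
Proof.
by rewrite -sum1_count -[X in iota 0 X]subn0 -/(index_iota 0 k) big_mkord sum1dep_card.
Qed.

Lemma conflict_atE (j k : 'I_m) : conflict_at I j k = conflict I j k.
Proof. by rewrite /conflict_at !valK. Qed.

Lemma value_atE (i : 'I_n) (j : 'I_m) : value_at I i j = item_value I i j.
Proof. by rewrite /value_at !valK. Qed.

Lemma value_E (i : 'I_n) (p : pred nat) :
  \sum_(j <- iota 0 m | p j) value_at I i j = valuation I i [set j : 'I_m | p j].
Proof.
rewrite /valuation -[X in iota 0 X]subn0 -/(index_iota 0 m) big_mkord.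
apply: eq_big => [j|j _]; first by rewrite inE.
exact: value_atE.
Qed.

End Semantics.

Definition put_array (H : store) (a : nat) (f : nat -> nat) : store :=
  fun b => if b == a then f else H b.

(** A loop with a fixed number of rounds in the role of a while loop: each round lowers the measure
    by d unless the goal is reached, and reaching it is permanent. The step d = m serves for a
    nested loop. *)
Lemma foldl_progress (T : Type) (A : Type) (f : T -> A -> T) (Inv Done : T -> Prop)
    (meas : T -> nat) (d : nat) (s : seq A) x :
  (forall y a, Inv y -> [/\ Inv (f y a), Done y -> Done (f y a) &
     Done (f y a) \/ (meas (f y a) + d <= meas y)%N]) ->
  Inv x -> let z := foldl f x s in
  [/\ Inv z, Done x -> Done z & Done z \/ (meas z + size s * d <= meas x)%N].
Proof.
move=> step; elim: s x => [|a s IH] x Ix /=.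
  by split=> //; right; rewrite mul0n addn0.
have [Ix' D1 D2] := step x a Ix; have [Iz Dz1 Dz2] := IH _ Ix'.
split=> //; first by move=> /D1/Dz1.
case: D2 => [/Dz1|D2]; first by left.
by case: Dz2 => [|Dz2]; [left | right; lia].
Qed.

(** * Numerical facts *)

Section Ratio.
Variable R : realType.

Lemma ratio_frac (d : nat) : (2 < d)%N -> mms_ratio R d * (d%:R + 2) = 2.
Proof.
case: d => [|[|[|d]]] // _; rewrite -[mms_ratio R _]/(2 / (d.+3%:R + 2)) divfK //.
by rewrite -natrD pnatr_eq0.
Qed.

Lemma ratio_twice (d : nat) : (0 < d)%N -> 2 * mms_ratio R d <= 1.
Proof.
move=> d0; have [d2|d3] := leqP d 2.
  by case: d d0 d2 => [|[|[|d]]] // _ _; rewrite /mms_ratio; lra.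
have := ratio_frac d3; have : (3%:R <= d%:R :> R) by rewrite ler_nat.
by move: (mms_ratio R d) => a d3' E; nra.
Qed.

(** With two agents the threshold is alpha v(U) / 2, and Delta + 2 thresholds have to fit into v(U).
    Equality holds for Delta > 2. *)
Lemma ratio_pair (d : nat) : (0 < d)%N -> (d%:R + 2) * mms_ratio R d <= 2.
Proof.
move=> d0; have [d2|d3] := leqP d 2.
  by case: d d0 d2 => [|[|[|d]]] // _ _; rewrite /mms_ratio; lra.
by rewrite mulrC ratio_frac.
Qed.

(** As 2 alpha <= 1, more agents only help. For r = 3 the condition is (Delta + 5) alpha <= 3, which
    for Delta = 2 means alpha <= 3/7. *)
Lemma ratio_even (d r : nat) : (0 < d)%N -> ~~ odd d -> (3 <= r)%N ->
  (d.+1%:R + 2 * (r%:R - 1)) * mms_ratio R d <= r%:R.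
Proof.
move=> d0 ed r3; have r3' : 3 <= r%:R :> R by rewrite ler_nat.
have tw := ratio_twice d0; rewrite -natr1.
have [d2|d3] := leqP d 2.
  by case: d d0 d2 ed tw => [|[|[|d]]] // _ _ _; rewrite /mms_ratio; lra.
have d4 : (4 <= d)%N by case: d d3 ed {tw d0} => [|[|[|[|d]]]].
have E := ratio_frac d3; have d4' : 4 <= d%:R :> R by rewrite ler_nat.
by move: (mms_ratio R d) (r%:R) (d%:R) E d4' tw r3' => a x y; nra.
Qed.

(** Otherwise the groups are worth at most c t each, and c p t < (c (p - 1) + 3) t since c < 3 and t
    > 0. The factor c is 2 for matchings and 1 for independent groups. *)
Lemma some_group (w h : nat -> R) p (c t : R) : (0 < p)%N -> c < 3 -> 0 <= c -> 0 <= t ->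
  (forall d, 0 <= h d) -> (forall d, (d < p)%N -> w d <= c * h d) ->
  (c * (p%:R - 1) + 3) * t <= \sum_(d < p) w d ->
  exists2 d, (d < p)%N & t <= h d.
Proof.
move=> p0 c3 c0 t0 h0 wh le.
case: (boolP [exists d : 'I_p, t <= h d]) => [/existsP[d dh]|]; first by exists d.
rewrite negb_exists => /forallP nh; exfalso.
have ht (d : 'I_p) : h d < t by rewrite ltNge.
have : \sum_(d < p) w d <= \sum_(d < p) (c * t).
  by apply: ler_sum => d _; apply: le_trans (wh d _) _; rewrite // ler_wpM2l // ltW.
rewrite sumr_const card_ord -[c * t *+ _]mulr_natl => le2.
have t1 : 0 < t by apply: le_lt_trans (h0 _) (ht (Ordinal p0)).
have := le_trans le le2; move: (p%:R : R) => x; clear -t1 c3; nra.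
Qed.

(** The other groups take up at most c (p - 1) t of the total. *)
Lemma big_group (w : nat -> R) p (c t : R) g : c < 3 -> 0 <= t -> (forall d, 0 <= w d) ->
  (forall d, (d < p)%N -> d != g -> w d <= c * t) ->
  (c * (p%:R - 1) + 3) * t <= \sum_(d < p) w d -> 3 * t <= w g.
Proof.
move=> c3 t0 w0 wt le.
have [gp|pg] := ltnP g p.
  have : \sum_(d < p) w d <= w g + \sum_(d < p | d != Ordinal gp) (c * t).
    rewrite (bigD1 (Ordinal gp)) //= lerD2l; apply: ler_sum => d dg; exact: wt.
  rewrite sumr_const -[c * t *+ _]mulr_natl.
  have -> : #|[pred d | d != Ordinal gp]| = p.-1.
    by have := cardC1 (Ordinal gp); rewrite card_ord => <-.
  have -> : p.-1%:R = p%:R - 1 :> R.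
    by rewrite -[in RHS](prednK (leq_ltn_trans (leq0n g) gp)) -natr1 addrK.
  by move=> le2; have := le_trans le le2; move: (p%:R : R) => x; clear; lra.
(* If g is beyond the last group, all p groups are small, and c < 3 forces t = 0. *)
have : \sum_(d < p) w d <= \sum_(d < p) (c * t).
  apply: ler_sum => d _; apply: wt => //; rewrite neq_ltn (leq_trans _ pg) //.
rewrite sumr_const card_ord -[c * t *+ _]mulr_natl => le2.
have := le_trans le le2; have := w0 g; move: (p%:R : R) => x; clear -c3 t0; nra.
Qed.

End Ratio.

(** * Shares, heavy items and the phases of the program *)

Section Algorithm.
Variables (R : realType) (n m : nat) (I : instance R n m).
Local Notation v := (valuation I).
Local Notation adj := (conflict I).
Local Notation mu := (mms I).
Local Notation Delta := (max_degree I).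
Local Notation alpha := (mms_ratio R Delta).
Local Notation neval := (hneval I).
Local Notation reval := (hreval I).
Local Notation beval := (hbeval I).

(** * Maximin shares, and heavy ends of matchings *)

Section Combinatorics.
Implicit Types (i : 'I_n) (j k : 'I_m) (S T U G B : {set 'I_m}).

Lemma valuation_ge0 i S : 0 <= v i S.
Proof. by apply: sumr_ge0 => j _; exact: item_value_ge0. Qed.

Lemma valuationID i S T : v i S = v i (S :&: T) + v i (S :\: T).
Proof. by rewrite /valuation (big_setID T). Qed.

Lemma valuationS i S T : S \subset T -> v i S <= v i T.
Proof.
move=> /setIidPr ST; rewrite (valuationID i T S) ST lerDl.
exact: valuation_ge0.
Qed.

Lemma valuation0 i : v i set0 = 0.
Proof. by rewrite /valuation big_set0. Qed.

Lemma valuation1 i j : v i [set j] = item_value I i j.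
Proof. by rewrite /valuation big_set1. Qed.

Lemma valuationU i S T : [disjoint S & T] -> v i (S :|: T) = v i S + v i T.
Proof.
move=> ST; rewrite (valuationID i _ S) (setIidPr (subsetUl S T)).
by rewrite setDUl setDv set0U; congr (_ + v i _); apply/setDidPl; rewrite disjoint_sym.
Qed.

Lemma valuationDS i S T : S \subset T -> v i (T :\: S) = v i T - v i S.
Proof. by move=> /setIidPr ST; rewrite (valuationID i T S) ST addrC addKr. Qed.

Lemma independentP S :
  reflect {in S &, forall j k, ~~ adj j k} (independent I S).
Proof.
apply: (iffP forallP) => [SP j k jS kS|SP j].
  by have /implyP/(_ jS)/forallP/(_ k)/implyP/(_ kS) := SP j.
by apply/implyP=> jS; apply/forallP=> k; apply/implyP=> kS; exact: SP.
Qed.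

Lemma independentS S T : S \subset T -> independent I T -> independent I S.
Proof.
move=> /subsetP ST /independentP TP; apply/independentP=> j k jS kS.
by apply: TP; exact: ST.
Qed.

Lemma degree_le j : (#|[set k | adj j k]| <= Delta)%N.
Proof. exact: (leq_bigmax j). Qed.

Lemma mms_ge0 i : 0 <= mu i.
Proof.
rewrite /mms; elim/big_ind: _ => // [x y x0 y0|A _].
  by rewrite le_max x0.
elim/big_ind: _ => [|x y x0 y0|k _]; try exact: valuation_ge0.
by rewrite le_min x0.
Qed.

(* [r] agents can still be given bundles worth the maximin share of [i]. *)
Definition shares i U (r : nat) : Prop := exists Bs : seq {set 'I_m},
  [/\ (r <= size Bs)%N, pairwise (fun B C : {set 'I_m} => [disjoint B & C]) Bs &
      {in Bs, forall B, [/\ B \subset U, independent I B & mu i <= v i B]}].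

Lemma shares_setT i : shares i [set: 'I_m] n.
Proof.
have [A [Adis Aind]] : exists A : 'I_n -> {set 'I_m},
    (forall a b, a != b -> [disjoint A a & A b]) /\
    forall a, independent I (A a) /\ mu i <= v i (A a).
  (* The maximum is either its default 0, and then empty bundles will do, or attained by a feasible
     allocation. *)
  have : mu i = 0 \/ exists2 A, feasible I A &
      mu i = \big[Num.min/v i [set: 'I_m]]_(a < n) v i (A a).
    rewrite /mms; elim/big_ind: _ => [|x y Px Py|A fA]; first by left.
    - by case: leP => _.
    - by right; exists A.
  case=> [->|[A /andP[/andP[/forallP Adis _] /forallP Aind] muE]].
    exists (fun=> set0); split=> [k l _|k].
      by rewrite -setI_eq0 set0I.
    rewrite valuation_ge0; split=> //; apply/independentP=> j k'.
    by rewrite inE.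
  exists A; split=> [k l kl|k].
    by have /forallP/(_ l)/implyP/(_ kl) := Adis k.
  split; first exact: Aind.
  rewrite muE; move: (mem_index_enum k); elim: (index_enum _) => //= l s IH.
  rewrite inE big_cons ge_min => /orP[/eqP->|/IH ->]; by rewrite ?lexx ?orbT.
exists [seq A a | a <- enum 'I_n]; split.
- by rewrite size_map size_enum_ord.
- rewrite pairwise_map; have := enum_uniq 'I_n; rewrite uniq_pairwise.
  by apply: sub_pairwise => k l /= /Adis.
- by move=> B /mapP[k _ ->]; have [? ?] := Aind k; split=> //; exact: subsetT.
Qed.

(** An item lies in at most one of the disjoint bundles; the others stay intact. *)
Lemma shares_remove i U r j : shares i U r -> shares i (U :\ j) r.-1.
Proof.
move=> [Bs [rs dis BsP]].
have fP : (r.-1 <= size [seq B : {set 'I_m} <- Bs | j \notin B])%N.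
  have : (count (fun B : {set 'I_m} => j \in B) Bs <= 1)%N.
    elim: Bs dis {rs BsP} => //= B Bs IH /andP[/allP BBs /IH {}IH].
    case: (boolP (j \in B)) => // jB; rewrite [X in (_ + X)%N](_ : _ = 0%N) //.
    apply/eqP; rewrite -leqn0 leqNgt -has_count; apply/hasPn=> C /BBs BC.
    by rewrite (disjointFr BC).
  rewrite size_filter.
  have := count_predC (fun B : {set 'I_m} => j \in B) Bs.
  rewrite (_ : count (predC _) Bs = count (fun B : {set 'I_m} => j \notin B) Bs) //.
  lia.
exists [seq B : {set 'I_m} <- Bs | j \notin B]; split=> //.
  by apply: subseq_pairwise dis; exact: filter_subseq.
move=> B; rewrite mem_filter => /andP[jB /BsP[BU Bi Bv]]; split=> //.
by rewrite subsetD1 BU.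
Qed.

Lemma shares_value i U r : shares i U r -> r%:R * mu i <= v i U.
Proof.
move=> [Bs [rs dis BsP]].
apply: (@le_trans _ _ ((size Bs)%:R * mu i)).
  by rewrite ler_wpM2r ?mms_ge0 // ler_nat.
elim: Bs U dis BsP {rs} => [|B Bs IH] U /=.
  by move=> _ _; rewrite mul0r valuation_ge0.
move=> /andP[/allP BBs dis] BsP.
have [BU _ Bv] := BsP B (mem_head _ _).
rewrite (valuationID i U B) (setIidPr BU) -addn1 natrD mulrDl mul1r addrC.
apply: lerD => //; apply: IH => // C CBs.
have [|CU Ci Cv] := BsP C; first by rewrite inE CBs orbT.
by split=> //; rewrite subsetD CU disjoint_sym BBs.
Qed.

Lemma shares1 i U : shares i U 1 ->
  exists B, [/\ B \subset U, independent I B & mu i <= v i B].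
Proof.
move=> [[|B Bs] [//= _ _ BsP]]; exists B; apply: BsP; exact: mem_head.
Qed.

Lemma shares2 i U : shares i U 2 ->
  exists B C : {set 'I_m}, [/\ [disjoint B & C], (B \subset U /\ C \subset U),
    independent I B /\ independent I C & mu i <= v i B /\ mu i <= v i C].
Proof.
move=> [[|B [|C Bs]] [//= _ /andP[/andP[BC _] _] BsP]]; exists B, C.
have [|? ? ?] := BsP B; first exact: mem_head.
have [|? ? ?] := BsP C; first by rewrite !inE eqxx orbT.
by [].
Qed.

(* Ties are broken by the numbers of the items: exactly one end of an isolated
   edge is heavy. *)
Definition heavy i G : {set 'I_m} :=
  [set j in G | [forall k in G, adj j k ==>
     ~~ ((item_value I i j < item_value I i k) ||
         ((item_value I i j <= item_value I i k) && (k < j)%N))]].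

Definition matching G : Prop :=
  {in G, forall j, (#|[set k in G | adj j k]| <= 1)%N}.

Lemma heavy_sub i G : heavy i G \subset G.
Proof. by apply/subsetP=> j; rewrite inE => /andP[]. Qed.

Lemma heavy_independent i G : independent I (heavy i G).
Proof.
apply/independentP=> j k; rewrite !inE => /andP[jG /forallP jP] /andP[kG /forallP kP].
apply/negP=> jk; have := jP k; rewrite kG jk /= => /norP[jk1 jk2].
have := kP j; rewrite jG conflict_sym jk /= => /norP[kj1 kj2].
rewrite -leNgt in jk1; rewrite -leNgt in kj1; move: jk2 kj2.
rewrite jk1 kj1 /= -!leqNgt => jk' kj'.
have jkE : j = k by apply/val_inj/eqP; rewrite eqn_leq jk' kj'.
by rewrite jkE conflict_irr in jk.
Qed.

Lemma matching_independent G : independent I G -> matching G.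
Proof.
move=> /independentP Gi j jG; rewrite (_ : [set k in G | _] = set0) ?cards0 //.
apply/setP=> k; rewrite !inE; case: (boolP (k \in G)) => //= kG.
exact/negbTE/Gi.
Qed.

Lemma heavy_id i G : independent I G -> heavy i G = G.
Proof.
move=> /independentP Gi; apply/setP=> j; rewrite inE.
case: (boolP (j \in G)) => //= jG; apply/forallP=> k; apply/implyP=> kG.
by rewrite (negbTE (Gi _ _ jG kG)).
Qed.

Lemma matching_unique G j k l : matching G -> j \in G -> k \in G -> l \in G ->
  adj j k -> adj j l -> k = l.
Proof.
move=> Gm jG kG lG jk jl; have := Gm j jG; rewrite leqNgt => /negP kl.
apply/eqP; apply: contraT => nkl; case: kl.
by apply/card_gt1P; exists k, l; split; rewrite ?inE ?kG ?lG ?jk ?jl.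
Qed.

(** An item of B that is not heavy has a partner that is heavy, worth at least as much and, by
    independence, outside B. Distinct items have distinct partners, so the exchange does not lower
    the value. *)
Lemma heavy_max i G B : matching G -> B \subset G -> independent I B ->
  v i B <= v i (heavy i G).
Proof.
move=> Gm BG /independentP Bi.
have [p pP] : exists p : 'I_m -> 'I_m, {in B :\: heavy i G, forall j,
    [/\ adj j (p j), p j \in G & item_value I i j <= item_value I i (p j)]}.
  apply: (@fin_all_exists _ (fun=> 'I_m) (fun j k => j \in B :\: heavy i G ->
    [/\ adj j k, k \in G & item_value I i j <= item_value I i k])) => j.
  case: (boolP (j \in B :\: heavy i G)); last by exists j.
  rewrite !inE => /andP[+ jB]; rewrite (subsetP BG _ jB) /= negb_forall.
  case/existsP=> k; rewrite negb_imply => /andP[kG].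
  rewrite negb_imply negbK => /andP[jk /orP jkv]; exists k => _; split=> //.
  by case: jkv => [/ltW|/andP[]].
have partner j k l := @matching_unique G j k l Gm.
have pin : {in B :\: heavy i G &, injective p}.
  move=> j k jD kD pjk; have [jp pG _] := pP j jD; have [kp _ _] := pP k kD.
  move: jD kD; rewrite !in_setD => /andP[_ jB] /andP[_ kB].
  apply: (partner (p j)) => //; try exact: (subsetP BG).
    by rewrite conflict_sym.
  by rewrite pjk conflict_sym.
have pheavy : p @: (B :\: heavy i G) \subset heavy i G :\: B.
  apply/subsetP=> _ /imsetP[j jD ->]; have [jp pG jpv] := pP j jD.
  move: (jD); rewrite in_setD => /andP[jh jB]; have jG := subsetP BG _ jB.
  rewrite in_setD; apply/andP; split.
    by apply/negP=> pB; have := Bi _ _ jB pB; rewrite jp.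
  rewrite inE pG; apply/forallP=> k; apply/implyP=> kG; apply/implyP=> pk.
  have -> : k = j by apply: (partner (p j)) => //; rewrite conflict_sym.
  apply/negP=> /orP[|/andP[pj jlt]]; first by rewrite ltNge jpv.
  case/negP: jh; rewrite inE jG; apply/forallP=> l; apply/implyP=> lG.
  apply/implyP=> jl; have -> : l = p j by apply: (partner j).
  by rewrite negb_or -leNgt pj /= negb_and -leqNgt (ltnW jlt) orbT.
rewrite (valuationID i B (heavy i G)) (valuationID i (heavy i G) B).
rewrite [heavy i G :&: B]setIC lerD2l.
apply: le_trans (valuationS i pheavy).
rewrite /valuation big_imset //=; apply: ler_sum => j jD.
by have [] := pP j jD.
Qed.

(** The items that are not heavy form an independent set as well, so [heavy_max] bounds their value
    by that of the heavy ones. *)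
Lemma heavy_half i G : matching G -> v i G <= 2 * v i (heavy i G).
Proof.
move=> Gm; rewrite (valuationID i G (heavy i G)) (setIidPr (heavy_sub i G)).
rewrite mulr_natl mulr2n lerD2l; apply: heavy_max => //; first exact: subsetDl.
have beaten j : j \in G :\: heavy i G -> exists k, [/\ k \in G, adj j k &
    (item_value I i j < item_value I i k) ||
    ((item_value I i j <= item_value I i k) && (k < j)%N)].
  rewrite !inE => /andP[+ jG]; rewrite jG negb_forall => /existsP[k].
  by rewrite !negb_imply => /and4P[kG jk jlt _]; exists k.
apply/independentP=> j k jD kD; have [[jG _] [kG _]] := (setDP jD, setDP kD).
have [[k' [kG' jk' jlt]] [j' [jG' kj' klt]]] := (beaten j jD, beaten k kD).
apply/negP=> jk; have kE := matching_unique Gm jG kG' kG jk' jk.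
have jE : j' = j by apply: (matching_unique Gm kG) => //; rewrite conflict_sym.
subst j' k'; case/orP: jlt => [jlt|/andP[jle jlt]].
  by rewrite ltNge (ltW jlt) leNgt jlt in klt.
rewrite ltNge jle /= in klt; have /andP[_] := klt.
by rewrite ltnNge (ltnW jlt).
Qed.

End Combinatorics.

(** * Meaning of the expressions of the program *)

Section Macros.
Implicit Types (H : store) (env : nat -> nat).

Definition freeset H : {set 'I_m} := [set j : 'I_m | (n <= H OUT j)%N].
Definition active H : {set 'I_n} := [set i : 'I_n | H DONE i == 0%N].
Lemma lt_E env H e1 e2 : beval env H (lt_ e1 e2) = (neval env H e1 < neval env H e2)%N.
Proof. by rewrite /= addn1. Qed.

Lemma eq_E env H e1 e2 : beval env H (eq_ e1 e2) = (neval env H e1 == neval env H e2).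
Proof. by rewrite /= eqn_leq. Qed.

Lemma or_E env H b1 b2 : beval env H (or_ b1 b2) = beval env H b1 || beval env H b2.
Proof. by rewrite /= negb_and !negbK. Qed.

Lemma find_E env H x k b : neval env H (HFind x k b) =
  find (fun i => beval (bind env x i) H b) (iota 0 (bound n m k)).
Proof. by []. Qed.

Lemma nactive_E env H : neval env H nactive_ = #|active H|.
Proof.
rewrite [LHS]/= count_E; apply: eq_card => i.
by rewrite !inE /= leqn0.
Qed.

Lemma degree_E env H : (Delta < n)%N -> neval env H degree_ = Delta.
Proof.
move=> Dn; rewrite /degree_.
have P k : beval (bind env 91 k) H (all_ 92 Items (HLe (HCount 93 Items
     (HAdj (HVar 92) (HVar 93))) (HVar 91))) = (Delta <= k)%N.
  rewrite all_E; apply/forallP/idP => [kP|Dk j].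
    apply/bigmax_leqP => j _; have := kP j; rewrite /= count_E.
    congr (_ <= _)%N; apply: eq_card => l; rewrite !inE /bind /=.
    exact: conflict_atE.
  rewrite /= count_E; apply: leq_trans Dk; apply: leq_trans (degree_le j).
  rewrite subset_leq_card //; apply/subsetP=> l; rewrite !inE /bind /=.
  by rewrite conflict_atE.
change (neval env H _) with (find (fun k => beval (bind env 91 k) H
   (all_ 92 Items (HLe (HCount 93 Items (HAdj (HVar 92) (HVar 93))) (HVar 91))))
   (iota 0 n)).
rewrite (eq_find P).
case: find_iotaP => [k kn Dk kmin|kn].
  apply/eqP; rewrite eqn_leq Dk andbT leqNgt; apply/negP=> /kmin.
  by rewrite leqnn.
by have := kn _ Dn; rewrite leqnn.
Qed.

Lemma is1_E env H : (0 < Delta < n)%N -> neval env H is1_ = (Delta == 1%N).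
Proof. move=> /andP[D0 Dn]; rewrite /= -/degree_; have := degree_E env H Dn; rewrite /= => ->; lia. Qed.

Lemma is2_E env H : (0 < Delta < n)%N -> neval env H is2_ = (Delta == 2%N).
Proof.
move=> D; have := is1_E env H D; have /andP[D0 Dn] := D; have := degree_E env H Dn.
rewrite -[neval env H is2_]/(3 - neval env H degree_ - neval env H is1_ - neval env H is1_)%N.
by move=> -> ->; lia.
Qed.

Lemma ratio_E env H : (0 < Delta < n)%N ->
  0 < (neval env H den_)%:R :> R /\
  (neval env H num_)%:R / (neval env H den_)%:R = alpha.
Proof.
move=> D; have := is2_E env H D; have := is1_E env H D.
have /andP[D0 Dn] := D; have := degree_E env H Dn.
rewrite -[neval env H num_]/(2 - neval env H is1_ + neval env H is2_)%N.
rewrite -[neval env H den_]/(neval env H degree_ + 2 - neval env H is1_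
  + (neval env H is2_ + (neval env H is2_ + neval env H is2_)))%N.
move=> -> -> ->; case: Delta D0 => [|[|[|d]]] //= _.
by rewrite !subn0 !addn0 natrD; split=> //; rewrite -natrD ltr0n addn2.
Qed.

Lemma not_E env H b : beval env H (HNot b) = ~~ beval env H b.
Proof. by []. Qed.

Lemma and_E env H b1 b2 : beval env H (HAnd b1 b2) = beval env H b1 && beval env H b2.
Proof. by []. Qed.

Lemma odd_E env H : (0 < Delta < n)%N -> beval env H odd_ = odd Delta.
Proof.
move=> /andP[D0 Dn]; rewrite /odd_ not_E ex_E.
rewrite -[RHS]negbK; congr negb; apply/existsP/idP => [[d]|oD].
  by rewrite eq_E degree_E // => /eqP <-; rewrite /= addnn odd_double.
have hn : (Delta./2 < n)%N by lia.
exists (Ordinal hn); rewrite eq_E degree_E //; apply/eqP.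
by rewrite /= addnn /bind eqxx even_halfK.
Qed.

Lemma ngroups_E env H : (0 < Delta < n)%N -> neval env H ngroups_ = Delta./2.+1.
Proof.
move=> /andP[D0 Dn]; rewrite -[LHS]/(find (fun p => beval (bind env 94 p) H
   (lt_ degree_ (HAdd (HVar 94) (HVar 94)))) (iota 0 n)).
have P p : beval (bind env 94 p) H (lt_ degree_ (HAdd (HVar 94) (HVar 94))) =
    (Delta < p + p)%N by rewrite lt_E degree_E.
rewrite (eq_find P); case: find_iotaP => [p pn Dp pmin|pn].
  apply/eqP; rewrite eqn_leq; apply/andP; split; last by lia.
  by rewrite leqNgt; apply/negP=> /pmin; lia.
have /pn : (Delta./2.+1 < n)%N by lia.
by lia.
Qed.

Lemma value_reval env H x (ei : hnexp) b (i : 'I_n) (p : pred 'I_m) :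
  (forall j, neval (bind env x j) H ei = i) ->
  (forall j : 'I_m, beval (bind env x j) H b = p j) ->
  reval env H (value_ x ei b) = v i [set j | p j].
Proof.
move=> eiE bE.
rewrite -[LHS]/(\sum_(j <- iota 0 m | beval (bind env x j) H b)
  value_at I (neval (bind env x j) H ei) (bind env x j x)).
rewrite (eq_bigr (fun j => value_at I i j)) => [|j _].
  by rewrite value_E; congr valuation; apply/setP=> j; rewrite !inE bE.
by rewrite eiE /bind eqxx.
Qed.

Lemma enough_E env H (ei : hnexp) b k e (i : 'I_n) (p : pred 'I_m) :
  (0 < Delta < n)%N ->
  (forall j, neval (bind env 95 j) H ei = i) ->
  (forall j : 'I_m, beval (bind env 95 j) H b = p j) ->
  beval env H (enough_ ei b k e) =
  (alpha * v i [set j | p j] <= reval env H e * (neval env H k)%:R).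
Proof.
move=> D eiE bE; have [d0 <-] := ratio_E env H D.
rewrite -[LHS]/(reval env H (value_ 95 ei b) * (neval env H num_)%:R <=
  reval env H e * (neval env H k)%:R * (neval env H den_)%:R).
by rewrite (value_reval eiE bE) -ler_pdivrMr // -mulrA mulrC.
Qed.

Lemma heavy_E env H (ei eg ej : hnexp) a (i : 'I_n) (j : 'I_m) g :
  (forall k, neval (bind env 80 k) H ei = i) ->
  (forall k, neval (bind env 80 k) H eg = g) -> neval env H eg = g ->
  (forall k, neval (bind env 80 k) H ej = j) -> neval env H ej = j ->
  beval env H (heavy_ ei a eg ej) =
  (j \in heavy i [set k in freeset H | H a k == g]).
Proof.
move=> eiE egE egE' ejE ejE'; rewrite /heavy_ and_E and_E not_E eq_E ex_E negb_exists.
rewrite inE; congr (_ && _).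
  by rewrite !inE -[neval env H (HGet a ej)]/(H a (neval env H ej)) egE' /= ejE'.
apply: eq_forallb => k; rewrite 2!and_E eq_E and_E or_E and_E lt_E not_E.
rewrite -[neval _ H (HGet a _)]/(H a k) egE -[beval _ H (free_ _)]/(n <= H OUT k)%N.
rewrite -[beval _ H (HAdj _ _)]/(conflict_at I (neval (bind env 80 k) H ej) k).
rewrite -[beval _ H (HRLe (HVal ei ej) _)]/(value_at I (neval (bind env 80 k) H ei) (neval (bind env 80 k) H ej) <= value_at I (neval (bind env 80 k) H ei) k).
rewrite -[beval _ H (HRLe _ _)]/(value_at I (neval (bind env 80 k) H ei) k <= value_at I (neval (bind env 80 k) H ei) (neval (bind env 80 k) H ej)).
rewrite eiE ejE conflict_atE !value_atE -ltNge !inE.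
rewrite -[neval _ H (HVar 80)]/(k : nat).
by case: (n <= _)%N => //=; case: eqP => //= _; case: conflict.
Qed.

Lemma heavy_value_E env H (ei eg : hnexp) a (i : 'I_n) g :
  (forall j k, neval (bind (bind env 81 j) 80 k) H ei = i) ->
  (forall j, neval (bind env 81 j) H ei = i) ->
  (forall j k, neval (bind (bind env 81 j) 80 k) H eg = g) ->
  (forall j, neval (bind env 81 j) H eg = g) ->
  reval env H (heavy_value_ ei a eg) =
  v i (heavy i [set k in freeset H | H a k == g]).
Proof.
move=> h1 h2 h3 h4; rewrite /heavy_value_ (value_reval h2 (p := fun j => j \in
  heavy i [set k in freeset H | H a k == g])) => [|j].
  by congr valuation; apply/setP=> j; rewrite inE.
by apply: heavy_E => // k; rewrite /= /bind.
Qed.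

End Macros.

(** * Filling an array, and first fit *)

Section Procedures.
Implicit Types (H : store) (env : nat -> nat).

(** The expressions may read the cell x of the array itself, which is still unchanged in round x;
    this lets colours be exchanged in place. *)
Lemma fill_E env H a b e (B : pred nat) (E : nat -> nat) :
  (forall x H', (x < m)%N -> (forall a', a' != a -> H' a' = H a') -> H' a x = H a x ->
     beval (bind env 0 x) H' b = B x /\
     (B x -> neval (bind env 0 x) H' e = E x)) ->
  hrun I env (fill a b e) H =
  put_array H a (fun y => if (y < m)%N && B y then E y else H a y).
Proof.
move=> bE; rewrite /fill.
pose Inv i H' := (forall a', a' != a -> H' a' = H a') /\
  forall y, H' a y = if (y < i)%N && B y then E y else H a y.
have [|i H' im [H'1 H'2]|H1 H2] :=
  @foldl_iota _ Inv (fun H' i => hrun I (bind env 0 i) (when_ b (HSet a (HVar 0) e)) H') m H.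
- by split.
- have [bi ei] : beval (bind env 0 i) H' b = B i /\
      (B i -> neval (bind env 0 i) H' e = E i).
    by apply: bE => //; rewrite H'2 ltnn.
  rewrite -[hrun _ _ _ _]/(if beval (bind env 0 i) H' b
    then put H' a i (neval (bind env 0 i) H' e) else H').
  rewrite bi; case: ifP => Bi; split=> //.
  + by move=> a' a'a; rewrite -H'1 //; exact: put_frame.
  + move=> y; rewrite /put eqxx ltnS leq_eqVlt /=.
    by case: eqP => [->|_] //=; rewrite Bi ei.
  + move=> y; rewrite H'2 [in RHS]ltnS [in RHS]leq_eqVlt; case: eqP => [->|//].
    by rewrite ltnn Bi.
apply: boolp.funext => a'; rewrite /put_array; case: eqP => [->|/eqP/H1 //].
exact: boolp.funext.
Qed.

(** By the last part, an item left at n has neighbours of all available colours. Colours are found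
    by a search among the agents, hence [minn n kk]. *)
Lemma first_fit_spec env H a b k (D : pred nat) (kk : nat) :
  (forall x H', (x < m)%N -> (forall a', a' != a -> H' a' = H a') ->
     beval (bind env 0 x) H' b = D x /\
     forall c, neval (bind (bind env 0 x) 1 c) H' k = kk) ->
  let H1 := hrun I env (first_fit a b k) H in
  [/\ forall x : 'I_m, ~~ (D x && (n <= H a x)%N) -> H1 a x = H a x,
      forall x : 'I_m, D x -> (n <= H a x)%N -> (H1 a x < n)%N ->
        (H1 a x < kk)%N /\ forall y, conflict I x y -> H1 a y != H1 a x &
      forall x : 'I_m, D x -> (n <= H a x)%N ->
        (H1 a x <= n)%N /\ forall c, (c < minn n kk)%N -> (c < H1 a x)%N ->
        exists2 y, conflict I x y & H1 a y = c].
Proof.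
move=> bE H1.
(* A colour once given is not changed, so it remains a witness for the neighbours coloured later;
   these in turn avoid it. *)
pose Inv i H' := [/\ forall a', a' != a -> H' a' = H a',
  forall x : 'I_m, (i <= x)%N || ~~ (D x && (n <= H a x)%N) -> H' a x = H a x,
  forall x : 'I_m, (x < i)%N -> D x -> (n <= H a x)%N -> (H' a x < n)%N ->
        (H' a x < kk)%N /\ forall y, conflict I x y -> H' a y != H' a x &
  forall x : 'I_m, (x < i)%N -> D x -> (n <= H a x)%N ->
        (H' a x <= n)%N /\ forall c, (c < minn n kk)%N -> (c < H' a x)%N ->
        exists2 y, conflict I x y & H' a y = c].
suff [_ h1 h2 h3] : Inv m H1.
  split=> [x hx|x|x]; first by apply: h1; rewrite hx orbT.
    by apply: h2.
  by apply: h3.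
apply: (@foldl_iota _ Inv) => [|i H' im [H'1 H'2 H'3 H'4]]; first by split.
pose io := Ordinal im.
have [bi ki] := bE i H' im H'1.
have xio (x : 'I_m) : x != io -> (x == i :> nat) = false by exact: negbTE.
have ltS x : (x : 'I_m) != io -> (x < i.+1)%N -> (x < i)%N.
  by move=> xi; rewrite ltnS leq_eqVlt xio.
set c := neval (bind env 0 i) H' (fit_ a k).
have step : hrun I (bind env 0 i) (when_ (HAnd b (HLe agents_ (HGet a (HVar 0))))
    (HSet a (HVar 0) (fit_ a k))) H' =
  if D i && (n <= H a i)%N then put H' a i c else H'.
  have Hi : H' a i = H a i by rewrite (H'2 io) ?leqnn.
  rewrite -bi -Hi; by [].
apply: (eq_ind_r (Inv i.+1) _ step).
case: ifP => [/andP[Di ni]|nD]; last first.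
  split=> // x.
  - move=> hx; apply: H'2; case/orP: hx => [/ltnW -> //|->]; by rewrite orbT.
  - case: (eqVneq x io) => [-> _ Dx nx|xi /(ltS _ xi)]; last exact: H'3.
    by rewrite /= Dx nx in nD.
  - case: (eqVneq x io) => [-> _ Dx nx|xi /(ltS _ xi)]; last exact: H'4.
    by rewrite /= Dx nx in nD.
have Hi : H' a io = H a i by rewrite (H'2 io) ?leqnn.
have putE (x : 'I_m) : x != io -> put H' a i c a x = H' a x.
  by move=> xi; rewrite /put eqxx xio.
have putI : put H' a i c a io = c by rewrite /put !eqxx.
have cE : c = find (fun d => (d < kk)%N && ~~ [exists y : 'I_m, conflict I io y && (H' a y == d)]) (iota 0 n).
  rewrite /c find_E; apply: eq_find => d; rewrite and_E lt_E not_E ex_E ki; congr (_ && ~~ _).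
  apply: eq_existsb => y; rewrite and_E eq_E.
  by rewrite -[beval _ _ _]/(conflict_at I io y) conflict_atE.
have clt : (c < n)%N -> (c < kk)%N /\ forall y, conflict I io y -> H' a y != c.
  rewrite cE; case: find_iotaP => [d dn /andP[dk nex] _|_] //.
  move=> _; split=> // y xy; apply: contra nex => /eqP yd.
  by apply/existsP; exists y; rewrite xy yd eqxx.
have cmin : (c <= n)%N /\ forall d, (d < minn n kk)%N -> (d < c)%N ->
    exists2 y, conflict I io y & H' a y = d.
  rewrite cE; case: find_iotaP => [d dn _ dmin|dmin]; split; rewrite ?(ltnW dn) //.
    move=> d'; rewrite leq_min => /andP[_ dk] /dmin; rewrite dk /= negbK => /existsP[y /andP[yc /eqP]].
    by exists y.
  move=> d' ; rewrite leq_min => /andP[dn dk] _; have := dmin d' dn.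
  by rewrite dk /= negbK => /existsP[y /andP[yc /eqP]]; exists y.
have loop_irr : conflict I io io = false by exact: conflict_irr.
split.
- by move=> a' a'a; rewrite -H'1 //; exact: put_frame.
- move=> x hx; case: (eqVneq x io) hx => [->|xi hx]; first by rewrite /= ltnn /= Di ni.
  rewrite putE //; apply: H'2; case/orP: hx => [/ltnW -> //|->]; by rewrite orbT.
- move=> x; case: (eqVneq x io) => [-> _ _ _|xi /(ltS _ xi) xlt Dx nx].
    rewrite putI => /clt[ck cy]; split=> // y xy; rewrite putE ?cy //.
    by apply: contraTneq xy => ->; rewrite loop_irr.
  rewrite putE // => xn; have [xk xy] := H'3 _ xlt Dx nx xn; split=> // y cxy.
  case: (eqVneq y io) => [yi|yi]; last by rewrite putE // xy.
  rewrite yi putI; apply: contraL xn => /eqP cx; rewrite -leqNgt leqNgt.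
  apply/negP=> xn; have [_ /(_ x)] := clt (leq_ltn_trans (eq_leq cx) xn).
  by rewrite cx eqxx -yi conflict_sym => /(_ cxy).
- move=> x; case: (eqVneq x io) => [-> _ _ _|xi /(ltS _ xi) xlt Dx nx].
    rewrite putI; case: cmin => cn cm; split=> // d dm dc.
    have [y xy yd] := cm d dm dc; exists y => //; rewrite putE //.
    by apply: contraTneq xy => ->; rewrite loop_irr.
  rewrite putE //; have [xn xd] := H'4 _ xlt Dx nx; split=> // d dm dx.
  have [y xy yd] := xd d dm dx; exists y => //; rewrite putE //.
  apply: contraTneq dm => yi; rewrite -yd yi Hi leq_min negb_and.
  by rewrite -leqNgt ni.
Qed.

End Procedures.

Hypothesis D : (0 < Delta < n)%N.

(** * Invariants of the partial allocation, and single items *)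

Section Phases.
Implicit Types (H : store) (env : nat -> nat) (i : 'I_n) (j : 'I_m) (S : {set 'I_m}).

Lemma alpha_gt0 : 0 < alpha.
Proof.
have /andP[D0 _] := D; case: Delta D0 => [|[|[|d]]] // _.
- by rewrite divr_gt0.
- by rewrite divr_gt0 // ltr0n.
- by rewrite divr_gt0 // -natrD ltr0n.
Qed.

Definition bundle H i : {set 'I_m} := [set j : 'I_m | H OUT j == i].

(** An agent without bundle owns no item at all, so the set it is given becomes its whole bundle. *)
Record good H : Prop := Good {
  good_independent : forall j k : 'I_m, conflict I j k -> (H OUT j < n)%N ->
    H OUT j != H OUT k;
  good_served : forall i, i \notin active H -> alpha * mu i <= v i (bundle H i);
  good_unserved : forall i j, i \in active H -> H OUT j != i
}.

Lemma good_ext H H' : H' OUT = H OUT -> H' DONE = H DONE -> good H -> good H'.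
Proof.
move=> E1 E2 [g1 g2 g3]; rewrite /active /bundle in g1 g2 g3.
split; rewrite /active /bundle ?E1 ?E2 //.
Qed.

Lemma good_give H H' i S : good H -> i \in active H -> S \subset freeset H ->
  independent I S -> alpha * mu i <= v i S ->
  (forall j, H' OUT j = if j \in S then i : nat else H OUT j) ->
  (forall k : 'I_n, H' DONE k = if k == i then 1%N else H DONE k) ->
  [/\ good H', freeset H' = freeset H :\: S & active H' = active H :\ i].
Proof.
move=> [g1 g2 g3] ia /subsetP SU /independentP Si Sv outE doneE.
have aE : active H' = active H :\ i.
  by apply/setP=> k; rewrite !inE doneE; case: (eqVneq k i).
split=> //; last first.
  apply/setP=> j; rewrite !inE outE; case: ifP => //= _.
  by rewrite leqNgt ltn_ord.
split=> [j k jk|k|k j].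
- rewrite !outE; case: ifP => jS; case: ifP => kS.
  + by have := Si _ _ jS kS; rewrite jk.
  + by move=> _; rewrite eq_sym; exact: g3.
  + by move=> _; exact: g3.
  + exact: g1.
- rewrite aE !inE negb_and negbK => kai.
  have [->|ki] := eqVneq k i.
    rewrite (_ : bundle H' i = S) //; apply/setP=> j; rewrite !inE outE.
    by case: ifP => _; rewrite ?eqxx //; apply/negbTE/g3.
  rewrite (negbTE ki) /= in kai; apply: le_trans (g2 k _) _; first by rewrite inE.
  apply: valuationS; apply/subsetP=> j; rewrite !inE outE.
  case: ifP => // /SU; rewrite inE leqNgt => + /eqP jk; by rewrite jk ltn_ord.
- rewrite aE !inE => /andP[ki ka]; rewrite outE; case: ifP => _.
    by rewrite eq_sym.
  by apply: g3; rewrite inE.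
Qed.

Lemma give_spec env H c a i S : a != OUT -> a != DONE -> good H -> i \in active H ->
  H a 0%N = i -> S \subset freeset H -> independent I S -> alpha * mu i <= v i S ->
  (forall j, (H MARK j == c) = (j \in S)) ->
  let H' := hrun I env (give c (get0 a)) H in
  [/\ good H', freeset H' = freeset H :\: S & active H' = active H :\ i].
Proof.
move=> aO aD gH ia ai SU Si Sv ME.
have E : hrun I env (fill OUT (eq_ (HGet MARK (HVar 0)) (HConst c)) (get0 a)) H =
  put_array H OUT (fun y => if (y < m)%N && (H MARK y == c) then i : nat else H OUT y).
  apply: fill_E => x H' _ H'1 _; rewrite eq_E; split=> [|_].
    by rewrite /= H'1.
  by rewrite /= H'1.
rewrite /give -[hrun _ _ _ _]/(hrun I env (HSet DONE (get0 a) (HConst 1))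
  (hrun I env (fill OUT (eq_ (HGet MARK (HVar 0)) (HConst c)) (get0 a)) H)).
rewrite E; apply: good_give => //.
- by move=> j; rewrite /= /put /put_array /= ltn_ord ME.
- by move=> k; rewrite /= /put /put_array /= (negbTE aO) ai.
Qed.

Definition fair H : Prop :=
  good H /\ forall i, i \in active H -> shares i (freeset H) #|active H|.

Lemma fair_ext H H' : H' OUT = H OUT -> H' DONE = H DONE -> fair H -> fair H'.
Proof.
move=> E1 E2 [g s]; split; first exact: good_ext g.
by rewrite /active /freeset E1 E2.
Qed.

(** The r shares of agent i give r mu_i <= v_i(U), so an item worth alpha v_i(U) / r satisfies it.
    Every other agent loses at most one share while r drops by one as well. *)
Lemma fair_single H H' i j : fair H -> i \in active H -> j \in freeset H ->
  alpha * v i (freeset H) <= item_value I i j * #|active H|%:R ->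
  (forall k : 'I_m, H' OUT k = if k == j then i : nat else H OUT k) ->
  (forall k : 'I_n, H' DONE k = if k == i then 1%N else H DONE k) ->
  [/\ fair H', freeset H' = freeset H :\ j & active H' = active H :\ i].
Proof.
move=> [g s] ia jU ij outE doneE.
have r0 : (0 < #|active H|)%N by apply/card_gt0P; exists i.
have [|||j'||g' fE aE] := @good_give H H' i [set j] g ia.
- by rewrite sub1set.
- by apply/independentP=> k l; rewrite !inE => /eqP -> /eqP ->; rewrite conflict_irr.
- rewrite valuation1 -(@ler_pM2r _ #|active H|%:R) ?ltr0n //.
  apply: le_trans ij; rewrite -mulrA ler_pM2l ?alpha_gt0 // mulrC.
  exact/shares_value/s.
- by rewrite inE outE.
- exact: doneE.
- split=> //; split=> // k ka; rewrite fE aE.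
  have -> : #|active H :\ i| = #|active H|.-1 by rewrite (cardsD1 i (active H)) ia.
  by apply/shares_remove/s; move: ka; rewrite aE in_setD1 => /andP[].
Qed.

Definition no_single H : Prop := forall i j, i \in active H -> j \in freeset H ->
  item_value I i j * #|active H|%:R < alpha * v i (freeset H).

Lemma no_single_ext H H' :
  H' OUT = H OUT -> H' DONE = H DONE -> no_single H -> no_single H'.
Proof. by rewrite /no_single /active /freeset => -> ->. Qed.

Lemma single_E env H (ei ej : hnexp) i j : 
  (forall k, neval (bind env 95 k) H ei = i) ->
  neval env H ei = i -> neval env H ej = j ->
  beval env H (single_ ei ej) = (j \in freeset H) &&
    (alpha * v i (freeset H) <= item_value I i j * #|active H|%:R).
Proof.
move=> ei1 ei2 ej1; rewrite /single_ and_E.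
rewrite -[beval env H (free_ ej)]/(n <= H OUT (neval env H ej))%N ej1 inE; congr (_ && _).
rewrite (@enough_E env H ei _ _ _ i (fun k => (n <= H OUT k)%N)) //.
by rewrite nactive_E -[reval _ _ _]/(value_at I (neval env H ei) (neval env H ej)) ei2 ej1 value_atE.
Qed.

Lemma singles_spec env H : fair H ->
  let H' := hrun I env singles H in fair H' /\ no_single H'.
Proof.
move=> fH.
pose step H' x := hrun I (bind env 0 x) single_step H'.
have [|//|fz _ +] := @foldl_progress _ _ step fair no_single (fun H => #|active H|) 1
    (iota 0 n) H.
  move=> {fH}H x fH; rewrite /step /single_step /seq_.
  set e1 := HFind 1 _ _; set w := neval (bind env 0 x) H e1.
  pose H1 := put H WHO 0 w.
  rewrite -[hrun _ _ _ _]/(hrun I (bind env 0 x) (when_ (lt_ (get0 WHO) agents_) give_single) H1).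
  rewrite -[hrun _ _ _ _]/(if beval (bind env 0 x) H1 (lt_ (get0 WHO) agents_) then
     hrun I (bind env 0 x) give_single H1 else H1) lt_E.
  have wE : neval (bind env 0 x) H1 (get0 WHO) = w by rewrite /= /H1 /put /= .
  rewrite wE -[neval _ _ agents_]/n.
  have fH1 : fair H1 by exact: fair_ext fH.
  move: wE; rewrite /w /e1 find_E; case: find_iotaP => [a an|noa].
    rewrite and_E ex_E => /andP[aa /existsP[j]]; pose i := Ordinal an.
    rewrite (@single_E _ _ _ _ i j) // => /andP[jU ji] _ wE.
    have ia : i \in active H by rewrite inE -leqn0.
    rewrite /give_single /seq_; set e2 := HFind 2 _ _; set q := neval (bind env 0 x) H1 e2.
    have [k qk [kU ki]] : exists2 k : 'I_m, q = k & k \in freeset H /\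
        alpha * v i (freeset H) <= item_value I i k * #|active H|%:R.
      rewrite /q /e2 find_E; case: find_iotaP => [b bm|nob].
        rewrite (@single_E _ _ _ _ i (Ordinal bm)) //.
        - by move=> /andP[bU bi] _; exists (Ordinal bm).
      have := nob j (ltn_ord j); rewrite (@single_E _ _ _ _ i j) //.
      by rewrite -[_ \in _]/(j \in freeset H) jU -[is_true _]/(is_true (~~ (alpha * v i (freeset H) <= item_value I i j * #|active H|%:R))) ji.
    have wa : w = a := wE.
    rewrite -[hrun _ _ _ _]/(put (put (put H1 IT 0 q) OUT q w) DONE w 1) wa.
    have [||f' _ aE] := @fair_single H (put (put (put H1 IT 0 q) OUT q a) DONE a 1) i k fH ia kU ki.
    - by move=> l; rewrite /put /= qk.
    - by move=> l; rewrite /put /=.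
    split=> //.
      by move=> ns; have := ns i j ia jU; rewrite ltNge ji.
    by right; rewrite aE [in X in (_ <= X)%N](cardsD1 i) ia addnC.
  move=> _; split=> //.
  left=> i j ia jU; rewrite ltNge; apply/negP=> ij.
  have := noa i (ltn_ord i); rewrite and_E ex_E => /negP; apply; apply/andP; split.
    by rewrite inE -leqn0 in ia.
  by apply/existsP; exists j; rewrite (@single_E _ _ _ _ i j) // jU.
case=> [|le0]; first by move=> ns; split.
(* After n successful rounds no agent is left and [no_single] is vacuous. *)
split=> // i; suff -> : active (foldl step H (iota 0 n)) = set0 by rewrite inE.
apply/eqP; rewrite -cards_eq0; move: le0; rewrite muln1 size_iota.
have : (#|active H| <= n)%N by rewrite -[X in (_ <= X)%N]card_ord max_card.
lia.
Qed.

End Phases.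

(** * Local search for groups with inner degrees at most one *)

Section LocalSearch.
Implicit Types (H : store) (env : nat -> nat) (i : 'I_n) (j : 'I_m) (S : {set 'I_m}).

Definition inner_degree (l : nat -> nat) j (g : nat) : nat :=
  \sum_(k < m) (conflict I j k && (l k == g)).

(** Ordered pairs are counted, so an edge inside a group counts twice. *)
Definition inner_edges (l : nat -> nat) : nat :=
  \sum_(j < m) inner_degree l j (l j).

Lemma inner_degreeE l j g :
  inner_degree l j g = #|[set k : 'I_m | conflict I j k && (l k == g)]|.
Proof.
rewrite /inner_degree -sum1dep_card [RHS]big_mkcond.
by apply: eq_bigr => k _; case: (_ && _).
Qed.

Lemma inner_edges_le l : (inner_edges l <= m * m)%N.
Proof.
rewrite /inner_edges; apply: (@leq_trans (\sum_(j < m) m)); last first.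
  by rewrite sum_nat_const card_ord.
apply: leq_sum => j _; rewrite inner_degreeE.
by apply: leq_trans (max_card _) _; rewrite card_ord.
Qed.

(** Only pairs that contain j change. Their number is twice the inner degree of j, which falls from
    at least 2 to at most 1. *)
Lemma inner_edges_move (l l' : nat -> nat) j :
  (forall k : 'I_m, k != j -> l' k = l k) ->
  (2 <= inner_degree l j (l j))%N -> (inner_degree l j (l' j) <= 1)%N ->
  (inner_edges l' < inner_edges l)%N.
Proof.
move=> ll' two one.
pose rest (l0 : nat -> nat) := (\sum_(a < m | a != j) \sum_(b < m | b != j)
  (conflict I a b && (l0 (b : nat) == l0 (a : nat))))%N.
have edgesE l0 : inner_edges l0 = (inner_degree l0 j (l0 j) +
    (inner_degree l0 j (l0 j) + rest l0))%N.
  rewrite /inner_edges (bigD1 j) //=; congr (_ + _)%N.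
  have -> : inner_degree l0 j (l0 j) =
      (\sum_(b < m | b != j) (conflict I j b && (l0 b == l0 j)))%N.
    by rewrite /inner_degree (bigD1 j) //= conflict_irr.
  rewrite /rest -big_split /=.
  apply: eq_bigr => a aj; rewrite /inner_degree (bigD1 j) //=; congr (_ + _)%N.
  by rewrite conflict_sym eq_sym.
have restE : rest l' = rest l.
  by apply: eq_bigr => a aj; apply: eq_bigr => b bj; rewrite !ll'.
have degE : inner_degree l' j (l' j) = inner_degree l j (l' j).
  rewrite /inner_degree; apply: eq_bigr => k _.
  have [->|kj] := eqVneq k j; first by rewrite conflict_irr.
  by rewrite ll'.
by rewrite !edgesE restE degE; lia.
Qed.

(** Two neighbours of j in each of floor(Delta / 2) + 1 groups would be more than Delta. *)
Lemma light_group l j :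
  exists2 g, (g < Delta./2.+1)%N & (inner_degree l j g <= 1)%N.
Proof.
case: (boolP [exists g : 'I_(Delta./2.+1), (inner_degree l j g <= 1)%N]).
  by move=> /existsP[g g1]; exists g.
rewrite negb_exists => /forallP gP.
have : (\sum_(g < Delta./2.+1) inner_degree l j g <= Delta)%N.
  rewrite /inner_degree exchange_big /=; apply: leq_trans (degree_le j).
  rewrite -sum1dep_card [leqRHS]big_mkcond; apply: leq_sum => k _.
  case: (conflict I j k) => /=; last by rewrite big1.
  have [kp|kp] := ltnP (l k) Delta./2.+1.
    rewrite (bigD1 (Ordinal kp)) //= eqxx big1 ?addn0 // => g gk.
    apply/eqP; rewrite eqb0; apply: contraNN gk => /eqP lg.
    by apply/eqP/val_inj.
  rewrite big1 // => g _; rewrite gtn_eqF //; exact: leq_trans kp.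
have : (\sum_(g < Delta./2.+1) 2 <= \sum_(g < Delta./2.+1) inner_degree l j g)%N.
  by apply: leq_sum => g _; rewrite ltnNge gP.
by rewrite sum_nat_const card_ord; lia.
Qed.

Lemma local_search_spec env H : (forall j, H LOC j = 0%N) ->
  let H' := hrun I env local_search H in
  (forall j, (H' LOC j < Delta./2.+1)%N) /\
  (forall j, (inner_degree (H' LOC) j (H' LOC j) <= 1)%N).
Proof.
move=> H0.
pose Inv H := forall j, (H LOC j < Delta./2.+1)%N.
pose Done H := forall j, (inner_degree (H LOC) j (H LOC j) <= 1)%N.
pose meas H := inner_edges (H LOC).
pose body := search_step.
have bodyP H1 (e : nat -> nat) : Inv H1 -> let H2 := hrun I e body H1 in
    [/\ Inv H2, Done H1 -> Done H2 & Done H2 \/ (meas H2 + 1 <= meas H1)%N].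
  move=> I1.
  set e1 := HFind 2 Items crowded_.
  pose q := neval e H1 e1; pose H1' := put H1 IT 0 q.
  set e2 := HFind 2 Agents light_.
  pose g := neval e H1' e2.
  rewrite -[hrun _ _ _ _]/(if beval e H1' (lt_ (get0 IT) items_) then
     put H1' LOC q g else H1') lt_E -[neval e H1' (get0 IT)]/q.
  have degE (x : 'I_m) : beval (bind e 2 x) H1 crowded_ =
      (2 <= inner_degree (H1 LOC) x (H1 LOC x))%N.
    rewrite /= count_E inner_degreeE; congr (_ <= _)%N; apply: eq_card => k.
    by rewrite !inE /= -eqn_leq /bind /= conflict_atE.
  have qE : q = find (fun x => beval (bind e 2 x) H1 crowded_) (iota 0 m) by [].
  rewrite -[neval e H1' items_]/m.
  have qP : if (q < m)%N then exists2 x : 'I_m, q = x & (2 <= inner_degree (H1 LOC) x (H1 LOC x))%N else Done H1.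
    rewrite qE; case: find_iotaP => [x xm|nox].
      by rewrite (degE (Ordinal xm)) => x2 _; exists (Ordinal xm).
    by move=> j; have := nox j (ltn_ord j); rewrite degE -ltnNge.
  case: ifP qP => [qm [x qx x2]|_ D1]; last by split=> //; left.
  have [gp g1] : (g < Delta./2.+1)%N /\ (inner_degree (H1 LOC) x g <= 1)%N.
    have ltpn : (Delta./2.+1 <= n)%N by have := D; lia.
    have gE d : beval (bind e 2 d) H1' light_ = (d < Delta./2.+1)%N && (inner_degree (H1 LOC) x d <= 1)%N.
      rewrite and_E lt_E ngroups_E // inner_degreeE; congr (_ && _).
      rewrite /= count_E; congr (_ <= _)%N; apply: eq_card => k.
      rewrite !inE /= -eqn_leq /bind /= -[H1' IT 0%N]/q qx conflict_atE.
      by [].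
    rewrite /g /e2 find_E (eq_find gE); case: find_iotaP => [d _ /andP[d1 d2] _|nod]; first by [].
    have [d dp d1] := light_group (H1 LOC) x.
    by have := nod d (leq_trans dp ltpn); rewrite dp d1.
  have putE (k : nat) : put H1' LOC q g LOC k = if k == x then g else H1 LOC k.
    by rewrite /put /= qx.
  split=> [j|D1|].
  - by rewrite putE; case: ifP.
  - by have := D1 x; rewrite leqNgt x2.
  - right; rewrite addn1; apply: (@inner_edges_move _ _ x) => //.
      by move=> k kx; rewrite putE (negbTE kx : (k == x :> nat) = false).
    by rewrite putE eqxx.
pose step H1 (i : nat) := foldl (fun H' k => hrun I (bind (bind env 0 i) 1 k) body H') H1 (iota 0 m).
have stepP H1 (i : nat) : Inv H1 -> [/\ Inv (step H1 i), Done H1 -> Done (step H1 i)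
    & Done (step H1 i) \/ (meas (step H1 i) + m <= meas H1)%N].
  move=> I1; have [|//|I2 D2] := @foldl_progress _ _
    (fun H' k => hrun I (bind (bind env 0 i) 1 k) body H') Inv Done meas 1 (iota 0 m) H1.
    by move=> H2 k I2; exact: bodyP.
  by rewrite muln1 size_iota => D3; split.
have [||Iz _] := @foldl_progress _ _ step Inv Done meas m (iota 0 m) H.
- by move=> H1 i; exact: stepP.
- by move=> j; rewrite H0.
- rewrite -[hrun _ _ _ _]/(foldl step H (iota 0 m)) size_iota => DM; split=> //.
  case: DM => // DM j; have := inner_edges_le (H LOC) => EM.
  (* m rounds of m steps use up an initial potential of at most m^2, and potential 0 means that all
     inner degrees are 0. *)
  have /eqP : meas (foldl step H (iota 0 m)) = 0%N by rewrite /meas in DM *; lia.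
  rewrite /meas /inner_edges sum_nat_eq0 => /forallP/(_ j)/implyP/(_ isT)/eqP ->.
  by [].
Qed.

End LocalSearch.

(** * Thresholds, and the last agent *)

Section Serving.
Implicit Types (H : store) (env : nat -> nat) (i : 'I_n) (j : 'I_m) (S U : {set 'I_m}).

Lemma seq_E env c1 c2 H : hrun I env (HSeq c1 c2) H = hrun I env c2 (hrun I env c1 H).
Proof. by []. Qed.

Lemma set0_E env a e H : hrun I env (set0_ a e) H = put H a 0 (neval env H e).
Proof. by []. Qed.

Lemma when_E env b c H : hrun I env (when_ b c) H = if beval env H b then hrun I env c H else H.
Proof. by []. Qed.

Lemma if_E env b c1 c2 H :
  hrun I env (HIf b c1 c2) H = if beval env H b then hrun I env c1 H else hrun I env c2 H.
Proof. by []. Qed.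

Lemma fill_set env H a b e S (E : nat -> nat) :
  (forall j H', (forall a', a' != a -> H' a' = H a') -> H' a j = H a j ->
     beval (bind env 0 j) H' b = (j \in S) /\
     (j \in S -> neval (bind env 0 j) H' e = E j)) ->
  forall j, hrun I env (fill a b e) H a j = if j \in S then E j else H a j.
Proof.
move=> bE j; rewrite (@fill_E env H a b e
  (fun x => if insub x is Some k then k \in S else false) E).
  by rewrite /put_array eqxx ltn_ord valK.
move=> x H' xm H'1 H'2; have [b1 b2] := bE (Ordinal xm) H' H'1 H'2.
by rewrite insubT.
Qed.

Lemma mark_set env H b c S :
  (forall j H', (forall a', a' != MARK -> H' a' = H a') ->
     beval (bind env 0 j) H' b = (j \in S)) ->
  forall j, hrun I env (fill MARK b (HConst c)) H MARK j = if j \in S then c else H MARK j.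
Proof.
move=> bE j; apply: (@fill_set env H MARK b (HConst c) S (fun=> c)) => k H' H'1 _.
by split; first exact: bE.
Qed.

Lemma reset_all env H a e (E : nat -> nat) :
  (forall j H', (forall a', a' != a -> H' a' = H a') -> H' a j = H a j ->
     neval (bind env 0 j) H' e = E j) ->
  forall j, hrun I env (fill a true_ e) H a j = E j.
Proof.
move=> eE j; rewrite (@fill_set env H a true_ e setT E) ?inE // => k H' H'1 H'2.
by rewrite inE; split=> // _; exact: eE.
Qed.

Lemma value_blocks i U (l : nat -> nat) p : (forall j, j \in U -> (l j < p)%N) ->
  v i U = \sum_(g < p) v i [set j in U | l j == g].
Proof.
move=> lp; rewrite /valuation.
(* [inord] needs a successor as the size of its type; for p = 0 the hypothesis makes U empty. *)
rewrite (partition_big (fun j : 'I_m => inord (l j) : 'I_p.-1.+1) predT) //=.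
case: p lp => [|p] lp.
  rewrite big_ord0 big1 // => g _; apply: big1 => j /andP[/lp].
  by rewrite ltn0.
apply: eq_bigr => g _; apply: eq_bigl => j; rewrite inE.
case: (boolP (j \in U)) => //= /lp jp.
by apply/eqP/eqP => [<-|lg]; rewrite ?inordK //; apply/val_inj; rewrite /= inordK.
Qed.

(** Otherwise the colours 0, ..., Delta, all below n, would occur at Delta + 1 distinct
    neighbours. *)
Lemma first_fit_le (l : nat -> nat) j :
  (forall c, (c < n)%N -> (c < l j)%N -> exists2 k : 'I_m, conflict I j k & l k = c) ->
  (l j <= Delta)%N.
Proof.
move=> lP; rewrite leqNgt; apply/negP=> Dl.
have Dn : (Delta < n)%N by have /andP[] := D.
suff : (Delta.+1 <= #|[set k | conflict I j k]|)%N.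
  by rewrite leqNgt ltnS degree_le.
have [f fP] : exists f : 'I_Delta.+1 -> 'I_m,
    forall c, conflict I j (f c) /\ l (f c) = c.
  apply: (@fin_all_exists 'I_Delta.+1 (fun=> 'I_m) (fun c k => conflict I j k /\ l k = c)).
  move=> c; have [||k jk kc] := lP c; last by exists k.
    by apply: leq_ltn_trans Dn; rewrite -ltnS.
  by apply: leq_ltn_trans Dl; rewrite -ltnS.
rewrite -[X in (X <= _)%N]card_ord -(@card_imset _ _ f) => [|c d fcd].
  by apply/subset_leq_card/subsetP=> _ /imsetP[c _ ->]; rewrite inE; have [] := fP c.
have [[_ lc] [_ ld]] := (fP c, fP d).
by apply/val_inj; rewrite /= -lc -ld fcd.
Qed.

Lemma first_active_E env H : (0 < #|active H|)%N ->
  exists2 i, i \in active H & hrun I env first_active H = put H AG 0 i.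
Proof.
move=> /card_gt0P[i0 i0a]; rewrite /first_active set0_E find_E.
case: find_iotaP => [i im ia _|noi].
  by exists (Ordinal im) => //; rewrite inE -leqn0.
by have := noi i0 (ltn_ord i0); rewrite inE in i0a; rewrite /= (eqP i0a).
Qed.

Definition base H (a : nat) : {set 'I_m} := [set j : 'I_m | (1 <= H a j)%N].
(** Refers to a recorded set of items and a recorded number of agents, so that it stays fixed while
    bundles are given away. *)
Definition threshold H (a : nat) i : R := alpha * v i (base H a) / (H NUM0 0%N)%:R.

Lemma threshold_ge0 H a i : 0 <= threshold H a i.
Proof.
rewrite /threshold divr_ge0 ?ler0n // mulr_ge0 ?valuation_ge0 //.
exact/ltW/alpha_gt0.
Qed.

Lemma threshold_enough env H (ei : hnexp) a e i : (0 < H NUM0 0%N)%N ->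
  (forall x, neval (bind env 95 x) H ei = i) ->
  beval env H (enough_ ei (HLe (HConst 1) (HGet a (HVar 95))) (get0 NUM0) e) =
  (threshold H a i <= reval env H e).
Proof.
move=> R0 eiE; rewrite (@enough_E _ _ _ _ _ _ i (fun k => (1 <= H a k)%N) D eiE) //.
by rewrite /threshold ler_pdivrMr // ltr0n.
Qed.

Lemma threshold_mms H a i : (0 < H NUM0 0%N)%N ->
  (H NUM0 0%N)%:R * mu i <= v i (base H a) -> alpha * mu i <= threshold H a i.
Proof.
move=> R0 le; rewrite /threshold ler_pdivlMr ?ltr0n // -mulrA.
by rewrite ler_pM2l ?alpha_gt0 // mulrC.
Qed.

Definition group H (a g : nat) : {set 'I_m} := [set j in freeset H | H a j == g].

Lemma matching_group (l : nat -> nat) (B : {set 'I_m}) (g : nat) :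
  (forall j, (inner_degree l j (l j) <= 1)%N) -> matching [set j in B | l j == g].
Proof.
move=> mat j; rewrite inE => /andP[_ /eqP jg]; apply: leq_trans (mat j).
rewrite inner_degreeE; apply/subset_leq_card/subsetP=> k.
by rewrite !inE jg => /andP[/andP[_ ->] ->].
Qed.

Lemma group_le_heavy i H g (B : {set 'I_m}) : B \subset freeset H ->
  (forall j, (inner_degree (H LOC) j (H LOC j) <= 1)%N) -> independent I B ->
  v i [set j in B | H LOC j == g] <= v i (heavy i (group H LOC g)).
Proof.
move=> /subsetP BU mat Bi; apply: heavy_max.
- exact: matching_group.
- apply/subsetP=> j; rewrite !inE => /andP[/BU]; by rewrite inE => -> ->.
- by apply: independentS Bi; apply/subsetP=> j; rewrite inE => /andP[].
Qed.

(** The remaining share splits into its parts in the floor(Delta / 2) + 1 groups, each worth at most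
    the best set of heavy ends. *)
Lemma last_agent_spec env H : good H -> #|active H| = 1%N ->
  (forall i, i \in active H -> shares i (freeset H) 1) ->
  (forall j, (H LOC j < Delta./2.+1)%N) ->
  (forall j, (inner_degree (H LOC) j (H LOC j) <= 1)%N) ->
  let H' := hrun I env last_agent H in good H' /\ active H' = set0.
Proof.
move=> gH a1 sh lab mat; have [|i ia HE] := @first_active_E env H; first by rewrite a1.
rewrite /last_agent /seq_ seq_E HE; set H1 := put H AG 0 i.
rewrite seq_E set0_E; set g := neval env H1 _; set H2 := put H1 CC 0 g.
have hvE e g0 eg : (forall x, neval (bind e 81 x) H1 eg = g0) ->
    (forall x y, neval (bind (bind e 81 x) 80 y) H1 eg = g0) ->
    reval e H1 (heavy_value_ (get0 AG) LOC eg) = v i (heavy i (group H LOC g0)).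
  by move=> h1 h2; rewrite (@heavy_value_E e H1 (get0 AG) eg LOC i g0).
have n0 : (0 < n)%N by exact: leq_ltn_trans (ltn_ord i).
have gP : forall g', (g' < n)%N -> v i (heavy i (group H LOC g')) <= v i (heavy i (group H LOC g)).
  pose F (d : 'I_n) := v i (heavy i (group H LOC d)).
  have allE d : beval (bind env 1 d) H1 best_group_ =
      [forall d' : 'I_n, F d' <= v i (heavy i (group H LOC d))].
    rewrite all_E; apply: eq_forallb => d'.
    rewrite -[beval _ _ _]/(reval (bind (bind env 1 d) 2 d') H1 (heavy_value_ (get0 AG) LOC (HVar 2)) <=
       reval (bind (bind env 1 d) 2 d') H1 (heavy_value_ (get0 AG) LOC (HVar 1))).
    by rewrite (hvE _ d') // (hvE _ d).
  rewrite /g find_E (eq_find allE); case: find_iotaP => [d dn /forallP dP _|nod].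
    by move=> g' g'n; exact: (dP (Ordinal g'n)).
  have [d _ dmax] := @arg_maxP _ R _ (Ordinal n0) xpredT F isT.
  have := nod d (ltn_ord d); rewrite negb_forall => /existsP[d'].
  by rewrite [F d' <= _]dmax.
pose S := heavy i (group H LOC g).
rewrite seq_E; set H3 := hrun I env (fill MARK true_ (HConst 0)) H2.
rewrite seq_E; set H4 := hrun I env (fill MARK _ (HConst 1)) H3.
have H3E a : a != MARK -> H3 a = H2 a by exact: fill_frame.
have H4E a : a != MARK -> H4 a = H2 a.
  move=> aM; rewrite -H3E //; exact: fill_frame.
have M3 j : H3 MARK j = 0%N by apply: (@reset_all env H2 MARK (HConst 0) (fun=> 0%N)).
have M4 j : H4 MARK j = if j \in S then 1%N else H3 MARK j.
  apply: mark_set => k H' H'1.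
  have H'2 a : a != MARK -> H' a = H2 a by move=> aM; rewrite H'1 // H3E.
  rewrite (@heavy_E _ H' (get0 AG) (get0 CC) (HVar 0) LOC i k g) //;
    rewrite /= ?H'2 //.
  congr (k \in heavy i _); apply/setP=> l; rewrite !inE !H'2 //.
have act4 : active H4 = active H by rewrite /active H4E.
have free4 : freeset H4 = freeset H by rewrite /freeset H4E.
have gH4 : good H4 by apply: (good_ext _ _ gH); rewrite H4E.
have SU : S \subset freeset H.
  by apply: subset_trans (heavy_sub _ _) _; apply/subsetP=> j; rewrite !inE => /andP[].
have Si : independent I S by exact: heavy_independent.
have Sv : alpha * mu i <= v i S.
  have [B [BU Bi Bv]] := shares1 (sh i ia).
  have p0 : 0 < (Delta./2.+1)%:R :> R by rewrite ltr0n.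
  have vB : v i B <= (Delta./2.+1)%:R * v i S.
    rewrite (@value_blocks i B (H LOC) Delta./2.+1) // mulr_natl.
    rewrite -[X in _ *+ X](card_ord Delta./2.+1) -sumr_const; apply: ler_sum => d _.
    apply: le_trans (group_le_heavy _ _ BU mat Bi) _; apply: gP.
    by have := D; have := ltn_ord d; lia.
  (* Equality holds for even Delta > 2, so a single agent is a critical case too. *)
  have ap : alpha * (Delta./2.+1)%:R <= 1.
    have /andP[] := D; clear; case: Delta => [|[|[|d]]] //= _ _.
    - by rewrite mulr1; lra.
    - by rewrite -[2%:R]/(2 : R); lra.
    - rewrite mulrAC ler_pdivrMr; last by rewrite -natrD ltr0n.
      rewrite mul1r -natrM -natrD ler_nat; lia.
  apply: le_trans (_ : alpha * v i B <= _); first by rewrite ler_pM2l ?alpha_gt0.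
  apply: le_trans (_ : alpha * ((Delta./2.+1)%:R * v i S) <= _).
    by rewrite ler_pM2l ?alpha_gt0.
  by rewrite mulrA ler_piMl // valuation_ge0.
have [|||||||||g' _ aE] := @give_spec env H4 1 AG i S.
- by [].
- by [].
- by [].
- by rewrite act4.
- by rewrite H4E.
- by rewrite free4.
- by [].
- by [].
- by move=> j; rewrite M4 M3; case: ifP.
split=> //; rewrite aE act4; apply/eqP; rewrite -cards_eq0.
by have := cardsD1 i (active H); rewrite ia a1 add1n => -[<-].
Qed.

End Serving.

(** * Bag filling *)

Section Bags.
Implicit Types (H : store) (env : nat -> nat) (i : 'I_n) (j : 'I_m) (S U : {set 'I_m}).

Lemma items_gt0 : (0 < m)%N.
Proof.
have /andP[+ _] := D; rewrite lt0n; case: m I => // I' /negP[].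
by rewrite /max_degree big_ord0.
Qed.

Lemma pigeonhole i U (l : nat -> nat) p t : (0 < p)%N ->
  (forall j, j \in U -> (l j < p)%N) -> p%:R * t <= v i U ->
  exists2 g, (g < p)%N & t <= v i [set j in U | l j == g].
Proof.
move=> p0 lp; rewrite (value_blocks i lp) => tU.
case: (boolP [exists g : 'I_p, t <= v i [set j in U | l j == g]]).
  by move=> /existsP[g tg]; exists g.
rewrite negb_exists => /forallP gP; move: tU; rewrite leNgt => /negP[].
rewrite mulr_natl -[X in _ *+ X](card_ord p) -sumr_const.
apply: ltr_sum => [|g _]; last by rewrite ltNge gP.
by apply/hasP; exists (Ordinal p0); rewrite ?mem_index_enum.
Qed.

(** Delta + 1 thresholds spread over Delta + 1 colour classes make some class reach the threshold.
    The segment that ends one item before the bag reaches nobody's threshold, so an agent without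
    larger items loses at most two thresholds. *)
Lemma bag_step_spec env H : good H -> (0 < H NUM0 0%N)%N ->
  (forall i, i \in active H -> alpha * mu i <= threshold H BASE i) ->
  (exists2 i, i \in active H & (Delta.+1)%:R * threshold H BASE i <= v i (freeset H)) ->
  let H' := hrun I env bag_step H in
  exists i S, [/\ good H', i \in active H, active H' = active H :\ i,
    S \subset freeset H /\ freeset H' = freeset H :\: S &
    forall k : 'I_n, k \in active H -> k != i ->
      (forall j, j \in freeset H -> item_value I k j <= threshold H BASE k) ->
      v k S <= 2 * threshold H BASE k].
Proof.
move=> gH R0 thr [i0 i0a i0v].
rewrite /bag_step /seq_ seq_E; set H1 := hrun I env (fill COL true_ agents_) H.
have C1 j : H1 COL j = n by apply: (@reset_all env H COL agents_ (fun=> n)).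
rewrite seq_E; set H2 := hrun I env (first_fit COL _ _) H1.
have H1E a : a != COL -> H1 a = H a by exact: fill_frame.
have H2E a : a != COL -> H2 a = H a.
  move=> aM; rewrite -H1E //; exact: first_fit_frame.
have free2 : freeset H2 = freeset H by rewrite /freeset H2E.
have [|ff1 ff2 ff3] := @first_fit_spec env H1 COL (free_ (HVar 0)) agents_
    (fun x => n <= H OUT x)%N n.
  move=> x H' xm H'1; split=> //.
  by rewrite -[beval _ _ _]/(n <= H' OUT x)%N H'1 // H1E.
rewrite -/H2 in ff1 ff2 ff3.
have colD j : j \in freeset H -> (H2 COL j <= Delta)%N.
  rewrite inE => jf; apply: first_fit_le => c cn cl.
  by have [|_ /(_ c)] := ff3 j jf; rewrite ?C1 // minnn; apply.
have Dn : (Delta < n)%N by have /andP[] := D.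
have col_ind j (k : 'I_m) c : j \in freeset H -> H2 COL j = c -> H2 COL k = c -> ~~ conflict I j k.
  move=> jf jc kc; apply/negP=> jk; move: (jf); rewrite inE => jf'.
  have [||_ /(_ k jk)] := ff2 j jf'; first by rewrite C1.
    exact: leq_ltn_trans (colD j jf) Dn.
  by rewrite jc kc eqxx.
pose B c (x : nat) : {set 'I_m} := [set k in freeset H | (H2 COL k == c) && (k <= x)%N].
have claimE e H' (ei ec ej : hnexp) i c x :
    (forall a, a \in [:: OUT; DONE; BASE; NUM0; COL] -> H' a = H2 a) ->
    neval e H' ei = i -> (forall y, neval (bind e 95 y) H' ei = i) ->
    (forall y, neval (bind e 80 y) H' ei = i) ->
    (forall y, neval (bind e 80 y) H' ec = c) ->
    (forall y, neval (bind e 80 y) H' ej = x) ->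
    beval e H' (claims_ ei ec ej) = (i \in active H) && (threshold H BASE i <= v i (B c x)).
  move=> H'E ei1 ei2 ei3 ec1 ej1; rewrite /claims_ and_E; congr (_ && _).
    rewrite -[LHS]/(H' DONE (neval e H' ei) <= 0)%N ei1 leqn0 H'E // H2E //.
    by rewrite inE.
  rewrite (@threshold_enough _ _ _ _ _ i) //; last first.
    by rewrite H'E // H2E.
  rewrite (@value_reval e H' 80 ei _ i (fun k => k \in B c x) ei3).
    rewrite /threshold /base !(H'E BASE) // !(H'E NUM0) // !H2E //.
    by congr (_ <= v i _); apply/setP=> k; rewrite inE.
  move=> k; rewrite /in_bag_ 2!and_E eq_E.
  rewrite -[beval _ _ (free_ _)]/(n <= H' OUT k)%N -[neval _ _ (HGet _ _)]/(H' COL k).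
  rewrite -[beval _ _ (HLe _ _)]/(k <= neval (bind e 80 k) H' ej)%N ec1 ej1.
  by rewrite !inE andbA !H'E // (H2E OUT).
have [c0 c0D c0v] : exists2 c, (c < Delta.+1)%N &
    threshold H BASE i0 <= v i0 [set k in freeset H | H2 COL k == c].
  by apply: pigeonhole => // j /colD.
(* A whole colour class is its initial segment up to item m - 1. *)
have c0v' : threshold H BASE i0 <= v i0 (B c0 m.-1).
  apply: le_trans c0v _; apply: valuationS; apply/subsetP=> k; rewrite !inE.
  by move=> /andP[-> ->] /=; rewrite -ltnS prednK ?ltn_ord ?items_gt0.
have m1 : (m.-1 < m)%N by rewrite prednK ?items_gt0.
rewrite seq_E set0_E; set c := neval env H2 _; set H3 := put H2 CC 0 c.
rewrite seq_E set0_E; set x := neval env H3 _; set H4 := put H3 IT 0 x.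
rewrite seq_E set0_E; set w := neval env H4 _; set H5 := put H4 WHO 0 w.
have [xm _ [i xi]] : exists2 x0 : 'I_m, True & exists i, (i \in active H) && (threshold H BASE i <= v i (B c x0)).
  rewrite /c find_E; case: find_iotaP => [d dn + _|nod].
    rewrite ex_E => /existsP[y]; rewrite ex_E => /existsP[i].
    by rewrite (claimE _ _ _ _ _ i d y) // => bi; exists y => //; exists i.
  have := nod c0 (leq_trans c0D Dn); rewrite ex_E negb_exists => /forallP/(_ (Ordinal m1)).
  rewrite ex_E negb_exists => /forallP/(_ i0).
  by rewrite (claimE _ _ _ _ _ i0 c0 m.-1) // i0a c0v'.
have H3E a : a \in [:: OUT; DONE; BASE; NUM0; COL] -> H3 a = H2 a.
  move=> aM; apply: put_frame.
  by apply: contraL aM => /eqP ->.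
have H4E a : a \in [:: OUT; DONE; BASE; NUM0; COL] -> H4 a = H2 a.
  move=> aM; rewrite -H3E //; apply: put_frame.
  by apply: contraL aM => /eqP ->.
have [xlt xP xmin] : [/\ (x < m)%N,
    exists i, (i \in active H) && (threshold H BASE i <= v i (B c x)) &
    forall y, (y < x)%N -> forall k, k \in active H -> v k (B c y) < threshold H BASE k].
  rewrite /x find_E; case: find_iotaP => [y ym + ymin|noy].
    rewrite ex_E => /existsP[k]; rewrite (claimE _ _ _ _ _ k c y) // => kP.
    split=> //; first by exists k.
    move=> z zy l la; have := ymin z zy; rewrite ex_E negb_exists => /forallP/(_ l).
    by rewrite (claimE _ _ _ _ _ l c z) // la /= -ltNge.
  have := noy xm (ltn_ord xm); rewrite ex_E negb_exists => /forallP/(_ i).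
  by rewrite (claimE _ _ _ _ _ i c xm) // xi.
have [a wa /andP[aa av]] : exists2 a : 'I_n, w = a &
    (a \in active H) && (threshold H BASE a <= v a (B c x)).
  rewrite /w find_E; case: find_iotaP => [y ym + _|noy].
    rewrite (claimE _ _ _ _ _ (Ordinal ym) c x) // => yP.
    by exists (Ordinal ym).
  have [k kP] := xP; have := noy k (ltn_ord k).
  by rewrite (claimE _ _ _ _ _ k c x) // kP.
have H5E b : b \in [:: OUT; DONE; BASE; NUM0; COL] -> H5 b = H2 b.
  move=> aM; rewrite -H4E //; apply: put_frame.
  by apply: contraL aM => /eqP ->.
rewrite seq_E; set H6 := hrun I env (fill MARK true_ (HConst 0)) H5.
rewrite seq_E; set H7 := hrun I env (fill MARK _ (HConst 1)) H6.
have H6E b : b != MARK -> H6 b = H5 b by exact: fill_frame.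
have H7E b : b != MARK -> H7 b = H5 b.
  move=> aM; rewrite -H6E //; exact: fill_frame.
have M6 j : H6 MARK j = 0%N by apply: (@reset_all env H5 MARK (HConst 0) (fun=> 0%N)).
have M7 j : H7 MARK j = if j \in B c x then 1%N else H6 MARK j.
  apply: mark_set => k H' H'1.
  have H'2 b : b != MARK -> H' b = H5 b by move=> aM; rewrite H'1 // H6E.
  rewrite /in_bag_ 2!and_E eq_E.
  rewrite -[beval _ _ (free_ _)]/(n <= H' OUT k)%N -[neval _ _ (HGet COL _)]/(H' COL k).
  rewrite -[beval _ _ (HLe _ _)]/(k <= H' IT 0)%N -[neval _ _ (get0 CC)]/(H' CC 0%N).
  by rewrite !inE andbA !H'2 // !(H5E OUT) // (H5E COL) // (H2E OUT).
have [act7 free7] : active H7 = active H /\ freeset H7 = freeset H.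
  by rewrite /active /freeset !H7E // !H5E // !H2E.
have gH7 : good H7.
  by apply: (good_ext _ _ gH); rewrite H7E // H5E // H2E.
have BU : B c x \subset freeset H by apply/subsetP=> k; rewrite inE => /andP[].
have [|||||||||g' fE aE] := @give_spec env H7 1 WHO a (B c x).
- by [].
- by [].
- by [].
- by rewrite act7.
- by rewrite H7E.
- by rewrite free7.
- apply/independentP=> j k; rewrite inE => /andP[jf /andP[/eqP jc _]].
  rewrite inE => /andP[_ /andP[/eqP kc _]]; exact: col_ind jf jc kc.
- by apply: le_trans av; exact: thr.
- by move=> j; rewrite M7 M6; case: ifP.
exists a, (B c x); rewrite aE fE act7 free7; split=> // k ka kna items.
(* Taking out x matters only for x = 0, where [x.-1] is x itself. *)
have step : v k (B c x) <= v k (B c x.-1 :\ Ordinal xlt) + threshold H BASE k.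
  apply: (@le_trans _ _ (v k ((B c x.-1 :\ Ordinal xlt) :|: (B c x :&: [set Ordinal xlt])))).
    apply: valuationS; apply/subsetP=> j; rewrite !inE.
    have [->|jx] := eqVneq j (Ordinal xlt); first by rewrite andbT orbC => ->.
    move=> /and3P[-> -> jlx] /=; rewrite andbF orbF.
    have : (j != x :> nat) by apply: contra jx => /eqP E; apply/eqP/val_inj.
    by clear -jlx; lia.
  rewrite valuationU ?lerD2l; last first.
    rewrite -setI_eq0; apply/eqP/setP=> j; rewrite !inE.
    by case: eqP; rewrite ?andbF.
  case: (boolP (Ordinal xlt \in B c x)) => xB.
    apply: (@le_trans _ _ (v k [set Ordinal xlt])); first exact/valuationS/subsetIr.
    by rewrite valuation1 items // (subsetP BU).
  rewrite (_ : _ :&: _ = set0) ?valuation0 ?threshold_ge0 //.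
  apply/setP=> j; rewrite in_setI in_set1 in_set0; apply/negP=> /andP[+ /eqP jx].
  by rewrite jx (negbTE xB).
apply: le_trans step _; rewrite mulr_natl mulr2n lerD2r.
have [x0|x0] := posnP x.
  rewrite (_ : _ :\ _ = set0) ?valuation0 ?threshold_ge0 //.
  apply/setP=> j; rewrite !inE; apply/negP=> /and3P[/eqP jx _ /andP[_ jx1]].
  by apply: jx; apply/val_inj; move: jx1; clear -x0; rewrite /=; lia.
apply: le_trans (ltW (xmin x.-1 _ k ka)); last by rewrite prednK.
exact/valuationS/subsetDl.
Qed.

(* When only [s] agents are left, each of them still has [kappa] thresholds. *)
Definition bag_inv (kappa : R) (s : nat) H : Prop :=
  good H /\ forall i, i \in active H ->
    [/\ alpha * mu i <= threshold H BASE i,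
        forall j, j \in freeset H -> item_value I i j <= threshold H BASE i &
        (kappa + 2 * (#|active H|%:R - s%:R)) * threshold H BASE i <= v i (freeset H)].

(** A bag is filled only while more than [stop], hence at least s, agents are active; the surplus 2
    (r - s) t is then nonnegative and Delta + 1 thresholds are at hand. A bag costs 2 t, exactly
    what the surplus loses when r drops by one. *)
Lemma bags_spec env (kappa : R) s stop H : (0 < H NUM0 0%N)%N ->
  (Delta.+1)%:R <= kappa -> (s <= stop.+1)%N -> (stop <= #|active H|)%N ->
  bag_inv kappa s H ->
  let H' := hrun I env (bags stop) H in bag_inv kappa s H' /\ #|active H'| = stop.
Proof.
move=> R0 Dk ss sa iH.
pose Inv H1 := [/\ bag_inv kappa s H1, (stop <= #|active H1|)%N & (0 < H1 NUM0 0%N)%N].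
pose Done H1 := #|active H1| = stop.
have [||[i1 sa1 _] _ D1] := @foldl_progress _ _ (fun H' x => hrun I (bind env 9 x)
   (when_ (lt_ (HConst stop) nactive_) bag_step) H') Inv Done
   (fun H1 => #|active H1|) 1 (iota 0 n) H; last first.
- split=> //; case: D1 => //; rewrite size_iota muln1; move: sa1.
  rewrite -[hrun _ _ _ _]/(foldl (fun H' x => hrun I (bind env 9 x)
    (when_ (lt_ (HConst stop) nactive_) bag_step) H') H (iota 0 n)).
  have : (#|active H| <= n)%N by rewrite -[X in (_ <= X)%N]card_ord max_card.
  by move: #|active H| #|active _| => a b; lia.
- by [].
move=> {R0 sa iH}H x [[gH iH] sa R0]; rewrite when_E lt_E nactive_E.
case: ifP => [lt|nlt]; last first.
  split=> //; left; apply/eqP; rewrite eqn_leq sa andbT leqNgt.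
  by apply/negbT; rewrite -[X in (X < _)%N]/(neval (bind env 9 x) H (HConst stop)).
have {}lt : (stop < #|active H|)%N by [].
have [||k [S [g' ka aE [SU fE] loss]]] := @bag_step_spec (bind env 9 x) H gH R0.
- by move=> i /iH[].
- have /card_gt0P[i ia] : (0 < #|active H|)%N by apply: leq_ltn_trans lt.
  exists i => //; have [_ _ le] := iH i ia; apply: le_trans le.
  apply: ler_wpM2r; first exact: threshold_ge0.
  apply: le_trans Dk _; rewrite lerDl mulr_ge0 // subr_ge0 ler_nat.
  exact: leq_trans ss lt.
set H' := hrun I _ _ H in g' aE fE *.
have cE : #|active H| = #|active H'|.+1 by rewrite aE (cardsD1 k) ka add1n.
have thE i : threshold H' BASE i = threshold H BASE i.
  by rewrite /threshold /base /H' !hrun_frame.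
have NE : H' NUM0 = H NUM0 by exact: hrun_frame.
split; last by right; rewrite cE addn1.
  split; last by rewrite NE.
    split=> // i; rewrite aE in_setD1 => /andP[ik ia]; have [h1 h2 h3] := iH i ia.
    rewrite thE fE; split=> [//|j|].
      by rewrite inE => /andP[_]; exact: h2.
    rewrite valuationDS // -aE; have := loss i ia ik h2.
    by move: h3; rewrite cE -natr1; lra.
  by rewrite -ltnS -cE.
by rewrite /Done cE => E; move: lt; rewrite cE -E; lia.
Qed.

End Bags.

(** * Even split of a matching *)

Section Pair.
Implicit Types (H : store) (env : nat -> nat) (i : 'I_n) (j : 'I_m) (S U : {set 'I_m}).

Definition marked H (c : nat) : {set 'I_m} := [set j : 'I_m | H MARK j == c].

Lemma marked_put i H j c d : H MARK j = 0%N -> (0 < c)%N ->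
  v i (marked (put H MARK j d) c) =
  v i (marked H c) + (if d == c then item_value I i j else 0).
Proof.
move=> j0 c0; have jc : j \notin marked H c by rewrite inE j0; lia.
have pE (k : 'I_m) : put H MARK j d MARK k = if k == j then d else H MARK k by [].
case: (eqVneq d c) => dc; last first.
  rewrite addr0; congr valuation; apply/setP=> k; rewrite !inE pE.
  have [->|//] := eqVneq k j; by rewrite (negbTE dc) j0; lia.
rewrite -valuation1 -valuationU; last by rewrite disjoint_sym disjoints1.
congr valuation; apply/setP=> k; rewrite !inE pE orbC.
by have [->|] := eqVneq k j; rewrite ?dc ?eqxx ?orbF ?orbT //=.
Qed.

Lemma marked_value_E env H a c i : a != MARK -> H a 0%N = i ->
  reval env H (marked_value_ (get0 a) c) = v i (marked H c).
Proof.
move=> aM ai; rewrite /marked_value_ (@value_reval env H 80 _ _ i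
   (fun k => H MARK k == c)) => [//|//|k].
by rewrite eq_E.
Qed.

Lemma value_at_out i : value_at I i m = 0.
Proof. by rewrite /value_at valK; case: insubP => // u; rewrite ltnn. Qed.

(** Each edge shifts the difference of the two sides by at most t, in favour of the lighter side, so
    the difference never exceeds t. *)
Lemma split_group_spec env H i t :
  H AG 0%N = i -> matching (group H GRP (H CC 0%N)) -> 0 <= t ->
  (forall j, j \in group H GRP (H CC 0%N) -> item_value I i j <= t) ->
  (forall j, H MARK j = 0%N) ->
  let H' := hrun I env split_group H in
  [/\ forall c, (0 < c)%N -> marked H' c \subset group H GRP (H CC 0%N),
      forall c, (0 < c)%N -> independent I (marked H' c),
      v i (marked H' 1) + v i (marked H' 2) = v i (group H GRP (H CC 0%N)),
      v i (marked H' 1) <= v i (marked H' 2) + t &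
      v i (marked H' 2) <= v i (marked H' 1) + t].
Proof.
move=> ai mat t0 items M0; set G := group H GRP _ in mat items *.
(* The sides are 1 and 2, exchanged by c -> 3 - c; an edge of the group has either both ends marked
   or none. *)
pose Inv x H1 := [/\ forall a, a \in [:: OUT; GRP; CC; AG] -> H1 a = H a,
   forall j, if j \in G then (H1 MARK j <= 2)%N /\ ((j < x)%N -> H1 MARK j != 0%N)
             else H1 MARK j = 0%N,
   forall j k : 'I_m, j \in G -> k \in G -> conflict I j k -> H1 MARK j != 0%N ->
     H1 MARK k = (3 - H1 MARK j)%N,
   v i (marked H1 1) <= v i (marked H1 2) + t &
   v i (marked H1 2) <= v i (marked H1 1) + t].
suff [iE iM iC i1 i2] : Inv m (hrun I env split_group H).
  set H' := hrun I env split_group H in iE iM iC i1 i2 *.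
  have MG j c : (0 < c)%N -> j \in marked H' c -> j \in G.
    by rewrite inE => c0; have := iM j; case: ifP => // _ ->; rewrite eq_sym => /eqP c0'; rewrite c0' in c0.
  split=> //.
  - by move=> c c0; apply/subsetP=> j; exact: MG.
  - move=> c c0; apply/independentP=> j k jc kc; apply/negP=> jk.
    have [jG kG] := (MG j c c0 jc, MG k c c0 kc).
    move: jc kc; rewrite !inE => /eqP jc /eqP kc.
    have := iC j k jG kG jk; rewrite jc kc => /(_ (lt0n_neq0 c0)).
    by have := iM j; rewrite jG jc; lia.
  - rewrite -valuationU; last first.
      rewrite -setI_eq0; apply/eqP/setP=> j; rewrite !inE.
      by case: eqP => //= ->.
    congr valuation; apply/setP=> j; rewrite in_setU; apply/orP/idP.
      by case=> /MG; apply.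
    move=> jG; have := iM j; rewrite jG => -[j2 /(_ (ltn_ord j))]; rewrite !inE.
    by case: (H' MARK j) j2 => [|[|[|q]]] //; [left | right].
apply: (@foldl_iota _ Inv) => [|x H1 xm [iE iM iC i1 i2]].
  split=> // [j|j k jG kG jk||].
  - by case: ifP => _; rewrite M0.
  - by rewrite M0.
  - suff -> : marked H 1 = marked H 2 by rewrite lerDl.
    by apply/setP=> j; rewrite !inE M0.
  - suff -> : marked H 1 = marked H 2 by rewrite lerDl.
    by apply/setP=> j; rewrite !inE M0.
pose e := bind env 0 x; change (Inv x.+1 (hrun I e split_step H1)).
pose xo := Ordinal xm.
have gE e' a (k : 'I_m) H' : (forall a, a \in [:: OUT; GRP; CC; AG] -> H' a = H a) ->
    neval e' H' a = k ->
    beval e' H' (HAnd (free_ a) (eq_ (HGet GRP a) (get0 CC))) = (k \in G).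
  move=> H'E ak; rewrite and_E eq_E -[beval _ _ _]/(n <= H' OUT (neval e' H' a))%N.
  rewrite -[neval _ _ (HGet _ _)]/(H' GRP (neval e' H' a)) -[neval _ _ (get0 CC)]/(H' CC 0%N).
  by rewrite ak !H'E // !inE.
rewrite /split_step when_E and_E eq_E (gE e _ xo) //; case: ifP => [/andP[xG xM0]|nx]; last first.
  split=> // j; have := iM j; case: ifP => // jG [j2 jx]; split=> //.
  rewrite ltnS leq_eqVlt => /orP[/eqP jx'|/jx //].
  apply: contraFN nx => j0; rewrite -[xo]/(xo) (_ : xo = j) ?jG //; last exact/val_inj.
  by rewrite -[neval _ _ _]/(H1 MARK x) -jx' (eqP j0).
have {}xM0 : H1 MARK xo = 0%N by apply/eqP.
have AGi : H1 AG 0%N = i by rewrite iE.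
rewrite /seq_ seq_E set0_E; set q := neval e H1 _; set H2 := put H1 IT 0 q.
have H2E a : a != IT -> H2 a = H1 a by exact: put_frame.
have qP : (exists2 y : 'I_m, q = y & y \in G /\ conflict I xo y) \/
    q = m /\ forall y, y \in G -> ~~ conflict I xo y.
  have qE (y : 'I_m) : beval (bind e 1 y) H1 (HAnd
        (HAnd (free_ (HVar 1)) (eq_ (HGet GRP (HVar 1)) (get0 CC)))
        (HAdj (HVar 0) (HVar 1))) = (y \in G) && conflict I xo y.
    rewrite and_E (gE _ _ y) // -[beval _ _ (HAdj _ _)]/(conflict_at I xo y).
    by rewrite conflict_atE.
  rewrite /q find_E; case: find_iotaP => [y ym + _|noy].
    by rewrite (qE (Ordinal ym)) => /andP[yG xy]; left; exists (Ordinal ym).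
  right; split=> // y yG; have := noy y (ltn_ord y).
  by rewrite qE yG.
rewrite seq_E; set H3 := hrun I e (HIf _ _ _) H2.
have vE c : reval e H2 (marked_value_ (get0 AG) c) = v i (marked H1 c).
  by rewrite (@marked_value_E e H2 AG c i) ?(H2E AG) //.
have [s [s12 H3E sP]] : exists s, [/\ (0 < s < 3)%N, H3 = put H2 SIDE 0 s &
    if s == 1%N then v i (marked H1 1) <= v i (marked H1 2)
    else v i (marked H1 2) <= v i (marked H1 1)].
  rewrite /H3 if_E -[beval _ _ _]/(reval e H2 (marked_value_ (get0 AG) 1) <= reval e H2 (marked_value_ (get0 AG) 2)).
  rewrite !vE; case: leP => w12; first by exists 1%N.
  by exists 2%N; split=> //; exact: ltW.
have vqE : reval e H3 (HVal (get0 AG) (get0 IT)) = value_at I i q.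
  by rewrite H3E -AGi.
have vxE : reval e H3 (HVal (get0 AG) (HVar 0)) = item_value I i xo.
  by rewrite H3E -value_atE -AGi.
rewrite if_E -[beval _ _ _]/(reval e H3 (HVal (get0 AG) (get0 IT)) <= reval e H3 (HVal (get0 AG) (HVar 0))).
rewrite vqE vxE; set H4 := if _ then _ else _.
(* Item x gets side d and its partner 3 - d, where d is the lighter side s if the partner is worth
   no more than x, and 3 - s otherwise. *)
have [d [d12 H4E dP]] : exists d, [/\ (0 < d < 3)%N,
    H4 = put (put H3 MARK q (3 - d)) MARK x d &
    if d == s then value_at I i q <= item_value I i xo
    else item_value I i xo <= value_at I i q].
  rewrite /H4; case: leP => vqx.
    by exists s; rewrite eqxx; split=> //; rewrite H3E.
  exists (3 - s)%N; split; first by clear -s12; lia.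
    rewrite (_ : (3 - (3 - s) = s)%N); last by clear -s12; lia.
    by rewrite H3E.
  by rewrite ifN ?ltW //; clear -s12; lia.
have H4a a : a \notin [:: IT; SIDE; MARK] -> H4 a = H1 a.
  rewrite !inE !negb_or => /and3P[a1 a2 a3]; rewrite -H2E //.
  by rewrite H4E !put_frame // H3E put_frame.
have H3M (j : 'I_m) : H3 MARK j = H1 MARK j by rewrite H3E /put /= H2E.
have H4M (j : 'I_m) : H4 MARK j = if j == xo then d
    else if j == q :> nat then (3 - d)%N else H1 MARK j.
  by rewrite -(H3M j) H4E.
have d0 : (0 < 3 - d)%N by clear -d12; lia.
have qx : xo != q :> nat.
  case: qP => [[y -> [_ xy]]|[-> _]]; last by rewrite neq_ltn ltn_ord.
  by apply: contraTneq xy => /val_inj <-; rewrite conflict_irr.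
have q0 (j : 'I_m) : j = q :> nat -> H1 MARK j = 0%N.
  case: qP => [[y -> [yG xy]] /val_inj ->|[-> _] jm]; last first.
    by have := ltn_ord j; rewrite jm ltnn.
  apply/eqP; apply: contraTT isT => My; have := iC y xo yG xG.
  rewrite conflict_sym => /(_ xy My); rewrite xM0.
  by have := iM y; rewrite yG => -[My2 _]; clear -My2; lia.
have wE c : (0 < c)%N -> v i (marked H4 c) = v i (marked H1 c) +
    (if (3 - d)%N == c then value_at I i q else 0) +
    (if d == c then item_value I i xo else 0).
  move=> c0; rewrite H4E -[x]/(xo : nat) marked_put //; last first.
    by rewrite /put eqxx (negbTE qx) H3M.
  congr (_ + _); have m31 : marked H3 c = marked H1 c.
    by apply/setP=> j; rewrite !inE H3M.
  case: qP => [[y qy [yG xy]]|[qm _]].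
    by rewrite qy marked_put ?m31 ?value_atE // H3M q0.
  (* Without a partner, the other mark is written to cell m, which is no item. *)
  rewrite qm value_at_out if_same addr0 -m31; congr valuation; apply/setP=> j.
  by rewrite !inE /put /= (ltn_eqF (ltn_ord j)).
have vx : 0 <= item_value I i xo <= t by rewrite item_value_ge0 items.
have vq : 0 <= value_at I i q <= t.
  case: qP => [[y -> [yG _]]|[-> _]]; first by rewrite value_atE item_value_ge0 items.
  by rewrite value_at_out lexx t0.
have w1 := wE 1%N isT; have w2 := wE 2%N isT.
split.
- by move=> a aI; rewrite H4a ?iE //; move: aI; rewrite !inE => /or4P[] /eqP ->.
- move=> j; rewrite H4M; have := iM j; have [->|jx] := eqVneq j xo.
    by rewrite xG => _; clear -d12; lia.
  case: ifP => jG.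
    case: (eqVneq (j : nat) q) => [_ _|_ [j2 jl]]; first by clear -d12; lia.
    split=> //; rewrite ltnS leq_eqVlt => /orP[/eqP jx'|/jl //].
    by case/eqP: jx; apply/val_inj.
  case: (eqVneq (j : nat) q) => // jq _; case: qP => [[y qy [yG _]]|[qm _]].
    by rewrite -jq in qy; rewrite (ord_inj qy : j = y) yG in jG.
  by have := ltn_ord j; rewrite jq qm ltnn.
- move=> j k jG kG jk; rewrite !H4M.
  have partner y : y \in G -> conflict I xo y -> y = q :> nat.
    move=> yG xy; case: qP => [[z -> [zG xz]]|[_ /(_ y yG)]]; last by rewrite xy.
    by congr nat_of_ord; exact: matching_unique mat xG yG zG xy xz.
  have [jx|jx] := eqVneq j xo.
    rewrite jx in jk; rewrite (partner k) // eqxx ifN ?eqxx //.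
    by apply: contraTneq jk => ->; rewrite conflict_irr.
  have [kx|kx] := eqVneq k xo.
    by rewrite kx conflict_sym in jk; rewrite (partner j) // eqxx => _; clear -d12; lia.
  case: qP => [[y qy [yG xy]]|[qm _]]; last first.
    by rewrite qm !(ltn_eqF (ltn_ord _)); exact: iC.
  rewrite qy; have [/ord_inj jy|jy] := eqVneq (j : nat) y.
    rewrite jy in jk; case/eqP: kx; apply: (matching_unique mat yG) => //.
    by rewrite conflict_sym.
  have [/ord_inj ky|_] := eqVneq (k : nat) y; last exact: iC.
  rewrite ky conflict_sym in jk; case/eqP: jx; apply: (matching_unique mat yG) => //.
  by rewrite conflict_sym.
- rewrite w1 w2; move: sP dP i1 i2 vx vq; clear -s12 d12; case: (s) s12 => [|[|[|?]]] // _;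
    case: (d) d12 => [|[|[|?]]] //= _; lra.
- rewrite w1 w2; move: sP dP i1 i2 vx vq; clear -s12 d12; case: (s) s12 => [|[|[|?]]] // _;
    case: (d) d12 => [|[|[|?]]] //= _; lra.
Qed.

End Pair.

(** * Serving two agents *)

Section ServePair.
Implicit Types (H : store) (env : nat -> nat) (i : 'I_n) (j : 'I_m) (S U : {set 'I_m}).

(** An agent that remains and had Delta + 2 thresholds keeps Delta + 1, which is enough for a final
    bag. *)
Definition served H H' : Prop :=
  [/\ good H', (#|active H'| <= 1)%N, active H' \subset active H,
      freeset H' \subset freeset H &
      forall i, i \in active H' ->
        v i (freeset H) - threshold H BASE i <= v i (freeset H')].

Lemma serve_marks env H (i k : 'I_n) : good H -> k != i -> active H = [set i; k] ->
  H AG 0%N = i -> H AG2 0%N = k -> (0 < H NUM0 0%N)%N ->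
  alpha * mu k <= threshold H BASE k ->
  (forall c, (0 < c)%N -> marked H c \subset freeset H) ->
  (forall c, (0 < c)%N -> independent I (marked H c)) ->
  alpha * mu i <= v i (marked H 1) -> alpha * mu i <= v i (marked H 2) ->
  served H (hrun I env hand_out H).
Proof.
move=> gH ki aH AGi AGk R0 thk MU Mi v1 v2.
have [ia ka] : i \in active H /\ k \in active H by rewrite aH !inE !eqxx orbT.
rewrite if_E (@threshold_enough _ _ _ _ _ k) //.
rewrite (@marked_value_E env H AG2 1 k) //.
case: leP => kv.
  rewrite seq_E; set H1 := hrun I env (give 1 (get0 AG2)) H.
  have [|||||||||g1 f1 a1] := @give_spec env H 1 AG2 k (marked H 1) => //.
  - exact: MU.
  - exact: Mi.
  - exact: le_trans kv.
  - by move=> j; rewrite inE.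
  rewrite -/H1 in g1 f1 a1.
  have H1E a : a \in [:: MARK; AG] -> H1 a = H a.
    by rewrite !inE => aI; apply: hrun_frame; case/orP: aI => /eqP ->.
  have [|||||||||g2 f2 a2] := @give_spec env H1 2 AG i (marked H 2) => //.
  - by rewrite a1 aH !inE eqxx eq_sym ki.
  - by rewrite H1E.
  - rewrite f1; apply/subsetP=> j jM; rewrite in_setD (subsetP (MU 2%N isT)) // andbT.
    by move: jM; rewrite !inE => /eqP ->.
  - exact: Mi.
  - by move=> j; rewrite inE H1E.
  have a0 : active (hrun I env (give 2 (get0 AG)) H1) = set0.
    rewrite a2 a1 aH; apply/setP=> l; rewrite !inE.
    by case: (eqVneq l i) => //; case: (eqVneq l k).
  split=> //; rewrite ?a0 ?cards0 ?sub0set //.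
    by rewrite f2 f1; apply: subset_trans (subsetDl _ _) (subsetDl _ _).
  by move=> l; rewrite inE.
set H1 := hrun I env (give 1 (get0 AG)) H.
have [|||||||||g1 f1 a1] := @give_spec env H 1 AG i (marked H 1) => //.
- exact: MU.
- exact: Mi.
- by move=> j; rewrite inE.
rewrite -/H1 in g1 f1 a1.
have aE : active H1 = [set k].
  rewrite a1 aH; apply/setP=> l; rewrite !inE.
  by have [->|] := eqVneq l i; rewrite //= eq_sym (negbTE ki).
split=> //; rewrite ?aE ?cards1 // ?sub1set // ?f1 ?subsetDl //.
move=> l; rewrite inE => /eqP ->; rewrite valuationDS ?MU // lerD2l lerN2.
exact: ltW.
Qed.

Lemma group_enough_E env H i e g : H AG 0%N = i -> (0 < H NUM0 0%N)%N ->
  (forall x, neval (bind env 81 x) H e = g) ->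
  (forall x y, neval (bind (bind env 81 x) 80 y) H e = g) ->
  beval env H (group_enough_ e) =
  (threshold H BASE1 i <= v i (heavy i (group H GRP g))).
Proof.
move=> AGi R0 e1 e2; rewrite /group_enough_ (@threshold_enough _ _ _ _ _ i) //.
by rewrite (@heavy_value_E env H (get0 AG) e GRP i g).
Qed.

(** The last hypothesis is for the case that only one group has heavy ends worth t: the two sides of
    its split sum to at least 3 t and differ by at most t, so each is worth t. *)
Lemma serve_pair_spec env H i : good H -> #|active H| = 2 -> i \in active H ->
  H AG 0%N = i -> (0 < H NUM0 0%N)%N ->
  (forall k, k \in active H -> alpha * mu k <= threshold H BASE k) ->
  alpha * mu i <= threshold H BASE1 i ->
  (forall g, (g < n)%N -> matching (group H GRP g)) ->
  (forall j, j \in freeset H -> (H GRP j < n)%N -> item_value I i j <= threshold H BASE1 i) ->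
  (exists2 g, (g < n)%N & threshold H BASE1 i <= v i (heavy i (group H GRP g))) ->
  (forall g, (g < n)%N -> (forall g', (g' < n)%N -> g' != g ->
      v i (heavy i (group H GRP g')) < threshold H BASE1 i) ->
    3 * threshold H BASE1 i <= v i (group H GRP g)) ->
  served H (hrun I env serve_pair H).
Proof.
move=> gH a2 ia AGi R0 thr thi mat items [g0 g0n g0v] big.
have [k ki aH] : exists2 k, k != i & active H = [set i; k].
  have : #|active H :\ i| = 1%N by move: a2; rewrite (cardsD1 i) ia => -[].
  move=> /eqP/cards1P[k kE]; exists k.
    by have : k \in active H :\ i by [rewrite kE inE]; rewrite in_setD1 => /andP[].
  by rewrite -kE setD1K.
have ka : k \in active H by rewrite aH !inE eqxx orbT.
rewrite /serve_pair /seq_ seq_E set0_E.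
have -> : neval env H (HFind 1 Agents
    (HAnd (active_ (HVar 1)) (HNot (eq_ (HVar 1) (get0 AG))))) = k.
  have aE (l : 'I_n) : beval (bind env 1 l) H
      (HAnd (active_ (HVar 1)) (HNot (eq_ (HVar 1) (get0 AG)))) = (l == k).
    rewrite and_E not_E eq_E -[neval _ _ (get0 AG)]/(H AG 0%N) AGi.
    transitivity ((l \in active H) && (l != i)); first by rewrite inE -leqn0.
    rewrite aH !inE; have [->|_] := eqVneq l i; last by rewrite andbT.
    by rewrite andbF eq_sym (negbTE ki).
  rewrite find_E; case: find_iotaP => [l ln + _|nol].
    by rewrite (aE (Ordinal ln)) => /eqP <-.
  by have := nol k (ltn_ord k); rewrite aE eqxx.
set H1 := put H AG2 0 k; rewrite seq_E set0_E; set g := neval env H1 _.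
set H2 := put H1 CC 0 g; rewrite seq_E set0_E; set g' := neval env H2 _.
set H3 := put H2 CC2 0 g'.
set t := threshold H BASE1 i in thi items g0v big *.
have H3E a : a \notin [:: AG2; CC; CC2] -> H3 a = H a.
  rewrite !inE !negb_or => /and3P[b1 b2 b3].
  by rewrite /H3 /H2 /H1 !put_frame.
have enoughE e H' eg d : (forall a, a \in [:: OUT; AG; NUM0; BASE1; GRP] -> H' a = H a) ->
    (forall x, neval (bind e 81 x) H' eg = d) ->
    (forall x y, neval (bind (bind e 81 x) 80 y) H' eg = d) ->
    beval e H' (group_enough_ eg) = (t <= v i (heavy i (group H GRP d))).
  move=> H'E e1 e2; rewrite (@group_enough_E e H' i eg d) ?H'E //.
  by rewrite /t /threshold /base /group /freeset !H'E.
have H1E a : a \in [:: OUT; AG; NUM0; BASE1; GRP] -> H1 a = H a.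
  move=> aI; apply: put_frame.
  by apply: contraL aI => /eqP ->.
have H2E a : a \in [:: OUT; AG; NUM0; BASE1; GRP] -> H2 a = H a.
  move=> aI; rewrite -H1E //; apply: put_frame.
  by apply: contraL aI => /eqP ->.
have [gn gv gmin] : [/\ (g < n)%N, t <= v i (heavy i (group H GRP g)) &
    forall d, (d < g)%N -> v i (heavy i (group H GRP d)) < t].
  rewrite /g find_E; case: find_iotaP => [d dn + dmin|nod].
    rewrite (enoughE _ _ _ d H1E) // => dv; split=> // c cd; have := dmin c cd.
    by rewrite (enoughE _ _ _ c H1E) // -ltNge.
  by have := nod g0 g0n; rewrite (enoughE _ _ _ g0 H1E) // g0v.
have g'P : if (g' < n)%N then (g < g')%N /\ t <= v i (heavy i (group H GRP g'))
    else forall d, (d < n)%N -> (g < d)%N -> v i (heavy i (group H GRP d)) < t.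
  have cE d : beval (bind env 1 d) H2 (HAnd (lt_ (get0 CC) (HVar 1)) (group_enough_ (HVar 1)))
      = (g < d)%N && (t <= v i (heavy i (group H GRP d))).
    by rewrite and_E lt_E (enoughE _ _ _ d H2E).
  rewrite /g' find_E; case: find_iotaP => [d dn + _|nod].
    by rewrite cE => /andP[].
  by move=> d dn gd; have := nod d dn; rewrite cE gd /= -ltNge.
rewrite seq_E; set H4 := hrun I env (fill MARK true_ (HConst 0)) H3.
have H4E a : a \notin [:: MARK; AG2; CC; CC2] -> H4 a = H a.
  rewrite inE negb_or => /andP[aM aC]; rewrite -H3E //.
  exact: fill_frame.
have M4 j : H4 MARK j = 0%N by apply: (@reset_all env H3 MARK (HConst 0) (fun=> 0%N)).
have CC4 : [/\ H4 AG2 0%N = k, H4 CC 0%N = g & H4 CC2 0%N = g'].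
  by rewrite /H4 !hrun_frame.
case: CC4 => AG24 CC4 CC24.
have free4 : freeset H4 = freeset H by rewrite /freeset H4E.
have act4 : active H4 = active H by rewrite /active H4E.
have grp4 d : group H4 GRP d = group H GRP d by rewrite /group free4 H4E.
rewrite seq_E; set H5 := hrun I env (HIf (lt_ (get0 CC2) agents_) _ _) H4.
have H5E a : a \notin [:: MARK; AG2; CC; CC2; IT; SIDE] -> H5 a = H a.
  rewrite -[[:: MARK; AG2; CC; CC2; IT; SIDE]]/([:: MARK; AG2; CC; CC2] ++ [:: IT; SIDE]).
  rewrite mem_cat negb_or => /andP[aM aI]; rewrite -H4E //.
  apply: hrun_frame; move: aM aI; rewrite !inE !negb_or.
  by move=> /and4P[-> _ _ _] /andP[-> ->].
have grpU d : group H GRP d \subset freeset H.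
  by apply/subsetP=> j; rewrite inE => /andP[].
have [MU Mi M1 M2] : [/\ forall c, (0 < c)%N -> marked H5 c \subset freeset H,
    forall c, (0 < c)%N -> independent I (marked H5 c),
    t <= v i (marked H5 1) & t <= v i (marked H5 2)].
  rewrite /H5 if_E lt_E -[neval _ _ (get0 CC2)]/(H4 CC2 0%N) CC24.
  rewrite -[neval _ _ agents_]/n; case: ifP g'P => [g'n [gg' g'v]|_ g'none].
    rewrite seq_E; set H6 := hrun I env (fill MARK _ (HConst 1)) H4.
    set H7 := hrun I env (fill MARK _ (HConst 2)) H6.
    have M6 j : H6 MARK j = if j \in heavy i (group H GRP g) then 1%N else H4 MARK j.
      apply: mark_set => l H' H'1.
      rewrite (@heavy_E _ H' (get0 AG) (get0 CC) (HVar 0) GRP i l g) //;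
        rewrite /= ?H'1 ?CC4 ?(H4E AG) //.
      by congr (l \in heavy i _); apply/setP=> y; rewrite -grp4 !inE ?H'1.
    have M7 j : H7 MARK j = if j \in heavy i (group H GRP g') then 2%N else H6 MARK j.
      apply: mark_set => l H' H'1.
      have H'2 a : a != MARK -> H' a = H4 a.
        move=> aM; rewrite H'1 //; exact: fill_frame.
      rewrite (@heavy_E _ H' (get0 AG) (get0 CC2) (HVar 0) GRP i l g') //;
        rewrite /= ?H'2 ?CC24 ?(H4E AG) //.
      by congr (l \in heavy i _); apply/setP=> y; rewrite -grp4 !inE ?H'2.
    have dis j : j \in heavy i (group H GRP g) -> j \notin heavy i (group H GRP g').
      move=> /(subsetP (heavy_sub _ _)); rewrite inE => /andP[_ /eqP jg].
      apply/negP=> /(subsetP (heavy_sub _ _)); rewrite inE => /andP[_].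
      by rewrite jg (ltn_eqF gg').
    have m1 : marked H7 1 = heavy i (group H GRP g).
      apply/setP=> j; rewrite inE M7 M6 M4.
      case: (boolP (j \in heavy i (group H GRP g))) => [jg|_]; last by case: ifP.
      by rewrite (negbTE (dis _ jg)).
    have m2 : marked H7 2 = heavy i (group H GRP g').
      apply/setP=> j; rewrite inE M7 M6 M4.
      by case: ifP => _ //; case: ifP.
    have m3 c : (2 < c)%N -> marked H7 c = set0.
      move=> c2; apply/setP=> j; rewrite !inE M7 M6 M4.
      by case: ifP => _; [|case: ifP => _]; apply/negbTE; move: c2; clear; lia.
    split; rewrite ?m1 ?m2 //; case=> [|[|[|c]]] // _; rewrite ?m1 ?m2 ?m3 ?sub0set ?heavy_independent //.
    - exact: subset_trans (heavy_sub _ _) (grpU _).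
    - exact: subset_trans (heavy_sub _ _) (grpU _).
    - by apply/independentP=> j l; rewrite inE.
  have t0 : 0 <= t by exact: threshold_ge0.
  have [|||||s1 s2 s3 s4 s5] := @split_group_spec env H4 i t.
  - by rewrite H4E.
  - by rewrite CC4 grp4; exact: mat.
  - by [].
  - rewrite CC4 grp4 => j; rewrite inE => /andP[jf /eqP jg]; apply: items => //.
    by rewrite jg.
  - exact: M4.
  rewrite CC4 grp4 in s1 s3.
  have b3 : 3 * t <= v i (group H GRP g).
    apply: big => // d dn; rewrite neq_ltn => /orP[|]; [exact: gmin | exact: g'none].
  split=> //.
  - by move=> c /s1 cg; exact: subset_trans cg (grpU _).
  - by clear -b3 s3 s4 s5; lra.
  - by clear -b3 s3 s4 s5; lra.
have free5 : freeset H5 = freeset H by rewrite /freeset H5E.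
have act5 : active H5 = active H by rewrite /active H5E.
have thE l : threshold H5 BASE l = threshold H BASE l by rewrite /threshold /base !H5E.
have gH5 : good H5 by apply: (good_ext _ _ gH); rewrite H5E.
have [|||||||||h1 h2 h3 h4 h5] := @serve_marks env H5 i k gH5 ki.
- by rewrite act5.
- by rewrite H5E.
- rewrite -AG24 /H5 hrun_frame //.
- by rewrite H5E.
- by rewrite thE; exact: thr.
- by move=> c c0; rewrite free5; exact: MU.
- exact: Mi.
- exact: le_trans M1.
- exact: le_trans M2.
split=> //; rewrite -?act5 -?free5 //.
by move=> l la; rewrite -thE; exact: h5.
Qed.

End ServePair.

(** * Odd cycles in a graph of degree at most two *)

Section Drop.
Implicit Types (H : store) (env : nat -> nat) (i : 'I_n) (j k y z : 'I_m) (S U W Z : {set 'I_m}).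

Definition closed_in W Z : Prop :=
  forall a b : 'I_m, a \in Z -> b \in W -> adj a b -> b \in Z.

Definition rel_in (Q : {set 'I_m}) : rel 'I_m :=
  [rel a b | [&& a \in Q, b \in Q & adj a b]].

(** A two-coloured path joins the neighbours y and z of j, which have different colours; with j it
    forms an odd cycle K, and two independent sets cannot cover that. Degrees at most 2 keep every
    edge of W from leaving K, and a closed set that meets the connected set K contains it, hence
    j. *)
Lemma odd_cycle W (Q : {set 'I_m}) (f : 'I_m -> nat) j y z (B C : {set 'I_m}) :
  {in W, forall a, (#|[set b in W | adj a b]| <= 2)%N} ->
  Q \subset W -> j \in W -> j \notin Q -> y \in Q -> z \in Q ->
  adj j y -> adj j z -> connect (rel_in Q) y z -> f y != f z ->
  {in Q &, forall a b, adj a b -> f a != f b} ->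
  (forall a, a \in Q -> (f a == f y) || (f a == f z)) ->
  [disjoint B & C] -> independent I B -> independent I C ->
  exists K : {set 'I_m}, [/\ j \in K, K \subset j |: Q, closed_in W K,
    exists2 u, u \in K & u \notin B :|: C &
    forall Z, closed_in W Z -> j \notin Z -> [disjoint K & Z]].
Proof.
move=> deg2 /subsetP QW jW jQ yQ zQ jy jz /connectP[p0 p0P p0z] fyz fproper f2.
move=> BC /independentP Bi /independentP Ci.
have [p [pP pU _ pz]] : exists p, [/\ path (rel_in Q) y p, uniq (y :: p), true & last y p = z].
  by case: (shortenP p0P) p0z => p pP pU _ ->; exists p.
have pQ a : a \in y :: p -> a \in Q.
  rewrite inE => /orP[/eqP -> //|ap].
  have : path (rel_in Q) y p := pP.
  elim: (p) (y) ap => // b q IH c; rewrite inE /= => + /andP[/and3P[_ bQ _] qP].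
  by case/orP=> [/eqP -> //|aq]; exact: IH aq qP.
have padj : path adj y p.
  by apply: sub_path pP => a b /and3P[].
pose c := j :: y :: p.
have cU : uniq c.
  by rewrite /c cons_uniq pU andbT; apply: contra jQ; exact: pQ.
have cC : cycle adj c.
  by rewrite /c /= jy rcons_path padj pz conflict_sym.
have pn0 : p != [::] by apply: contra fyz => /eqP p0E; rewrite -pz p0E.
have cW a : a \in c -> a \in W.
  by rewrite inE => /orP[/eqP -> //|/pQ/QW].
(* Rotated to start at a, the cycle has neighbours of a in second and in last place. They are
   distinct because it has at least three items, so a has no third neighbour in W. *)
have nbrs a b : a \in c -> b \in W -> adj a b -> b \in c.
  move=> ac bW ab; have aW := cW a ac.
  have [q s sE] := rot_to ac.
  have sU : uniq (a :: s) by rewrite -sE rot_uniq.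
  have sC : cycle adj (a :: s) by rewrite -sE rot_cycle.
  have sM d : (d \in c) = (d \in a :: s) by rewrite -sE mem_rot.
  have : size (a :: s) = (size p).+2 by rewrite -sE size_rot.
  case: s sE sU sC sM => [|d [|e s]] sE sU sC sM.
  - by [].
  - by case: (p) pn0.
  move=> _; have ad : adj a d by move: sC => /= /andP[].
  have al : adj a (last e s).
    by move: sC; rewrite /= rcons_path => /and4P[_ _ _]; rewrite conflict_sym.
  have dl : d != last e s.
    move: sU; rewrite /= => /and3P[_ + _]; apply: contra => /eqP ->.
    exact: mem_last.
  have [dc lc] : d \in c /\ last e s \in c.
    by rewrite !sM !(in_cons a) mem_head (in_cons d) mem_last !orbT.
  apply: contraT => bc; have := deg2 a aW; rewrite leqNgt => /negP[].
  apply: (@leq_trans #|[set b; d; last e s]|).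
    rewrite -setUA cardsU1 cards2 dl !inE negb_or.
    have -> : b != d by apply: contraNneq bc => ->.
    by have -> : b != last e s by apply: contraNneq bc => ->.
  apply/subset_leq_card/subsetP=> g; rewrite !inE => /orP[/orP[]|] /eqP ->;
    by rewrite ?bW ?ab ?ad ?al ?cW.
exists [set a in c]; split.
- by rewrite inE mem_head.
- apply/subsetP=> a; rewrite inE in_cons => /orP[/eqP ->|/pQ aQ]; first by rewrite setU11.
  by rewrite in_setU aQ orbT.
- by move=> a b; rewrite ![_ \in [set _ in _]]inE; exact: nbrs.
- case: (boolP [exists u, (u \in c) && (u \notin B :|: C)]).
    by move=> /existsP[u /andP[uc uBC]]; exists u => //; rewrite [_ \in _]inE.
  rewrite negb_exists => /forallP inBC.
  have g_alt a b : a \in c -> b \in c -> adj a b -> (b \in B) = (a \notin B).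
    move=> ac bc ab; have := inBC a; have := inBC b; rewrite ac bc /= !negbK !inE.
    case: (boolP (a \in B)) => aB; case: (boolP (b \in B)) => bB //=.
      by have := Bi _ _ aB bB; rewrite ab.
    by move=> bC aC; have := Ci _ _ aC bC; rewrite ab.
  (* If B and C covered the cycle, membership in B would alternate along the path just as the colour
     does, and their sum modulo 2 would be constant. But y and z differ in colour and, as neighbours
     of j, agree in membership. *)
  have alt q a : path adj a q -> {subset a :: q <= y :: p} ->
      ((f (last a q) == f y) (+) (last a q \in B)) = ((f a == f y) (+) (a \in B)).
    elim: q a => //= b q IH a /andP[ab bq] sub.
    have bM : b \in y :: p by apply: sub; rewrite !inE eqxx orbT.
    have aM : a \in y :: p by apply: sub; rewrite mem_head.
    rewrite IH // => [|d dq]; last by apply: sub; rewrite inE dq orbT.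
    rewrite (g_alt a b) ?in_cons -1?in_cons ?aM ?bM ?orbT //.
    have fab := fproper a b (pQ _ aM) (pQ _ bM) ab.
    have -> : (f b == f y) = (f a != f y).
      apply/idP/idP => [/eqP fby|fay]; first by rewrite -fby.
      have := f2 a (pQ _ aM); rewrite (negbTE fay) /= => /eqP faz.
      by have := f2 b (pQ _ bM); rewrite -faz [f b == f a]eq_sym (negbTE fab) orbF.
    by case: (f a == f y); case: (a \in B).
  have := alt p y padj (fun _ => id); rewrite pz eqxx eq_sym (negbTE fyz) /=.
  have yc : y \in c by rewrite !inE eqxx orbT.
  have zc : z \in c by rewrite -pz in_cons mem_last orbT.
  rewrite (g_alt j y) ?mem_head // (g_alt j z) ?mem_head //.
  by case: (j \in B).
- move=> Z Zc jZ; rewrite disjoint_subset; apply/subsetP=> a; rewrite inE => ac.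
  (* Closedness would pass membership in Z from an item of the path to its predecessor and finally
     to j. *)
  rewrite !inE; have yZ : y \notin Z.
    by apply: contra jZ => yZ; apply: Zc yZ jW _; rewrite conflict_sym.
  move: ac; rewrite inE => /orP[/eqP -> //|].
  have : path adj y p by [].
  have : {subset y :: p <= W} by move=> b /pQ/QW.
  elim: (p) (y) yZ => [|b q IH] d dZ sub /=; first by rewrite inE => _ /eqP ->.
  move=> /andP[db bq]; rewrite inE => /orP[/eqP -> //|]; apply: IH => //.
    apply: contra dZ => bZ; apply: Zc bZ _ _; last by rewrite conflict_sym.
    by apply: sub; rewrite mem_head.
  by move=> g gq; apply: sub; rewrite inE gq orbT.
Qed.

End Drop.

(** * Kempe exchanges and dropped items *)

Section EvenDegree.
Hypothesis D2 : (2 <= Delta)%N.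
Implicit Types (H : store) (env : nat -> nat) (i : 'I_n) (j k y z : 'I_m) (S U W Z : {set 'I_m}).

Definition twocol H : {set 'I_m} := [set k : 'I_m | (Delta - 2 <= H GRP k < n)%N].

Lemma col0_E env H : neval env H col0_ = (Delta - 2)%N.
Proof.
have /andP[_ Dn] := D.
by rewrite -[LHS]/(neval env H degree_ - 2)%N degree_E.
Qed.

Lemma col1_E env H : neval env H col1_ = (Delta - 1)%N.
Proof.
have /andP[_ Dn] := D.
by rewrite -[LHS]/(neval env H degree_ - 1)%N degree_E.
Qed.

(** M is the Kempe component of y: connected to y at every stage of its growth, and closed among the
    two-coloured items once no further item can be added. *)
Lemma flip_spec env H j : H IT 0%N = j ->
  (exists2 y, adj j y & H GRP y = (Delta - 2)%N) ->
  let H' := hrun I env flip H in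
  exists y (M : {set 'I_m}), [/\ adj j y /\ H GRP y = (Delta - 2)%N,
    y \in M /\ M \subset twocol H,
    forall a b, a \in M -> b \in twocol H -> adj a b -> b \in M,
    forall a, a \in M -> connect (rel_in (twocol H)) y a &
    forall k, H' GRP k = if k \in M then (Delta - 2 + (Delta - 1) - H GRP k)%N
                         else H GRP k].
Proof.
have Dn : (Delta < n)%N by have /andP[] := D.
move=> ITj [y0 jy0 y0c].
rewrite /flip /seq_ seq_E; set H1 := hrun I env (fill MARK true_ (HConst 0)) H.
have H1E a : a != MARK -> H1 a = H a by exact: fill_frame.
have M1 k : H1 MARK k = 0%N by apply: (@reset_all env H MARK (HConst 0) (fun=> 0%N)).
rewrite seq_E; set H2 := hrun I env (HSet MARK _ _) H1.
have [y [jy yc] H2E] : exists2 y : 'I_m, adj j y /\ H GRP y = (Delta - 2)%N &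
    H2 = put H1 MARK y 1.
  rewrite /H2 -[hrun _ _ _ _]/(put H1 MARK (neval env H1 (HFind 1 Items (HAnd (HAdj (get0 IT) (HVar 1))
                                 (eq_ (HGet GRP (HVar 1)) col0_)))) 1).
  have fE (k : 'I_m) : beval (bind env 1 k) H1 (HAnd (HAdj (get0 IT) (HVar 1))
       (eq_ (HGet GRP (HVar 1)) col0_)) = adj j k && (H GRP k == Delta - 2)%N.
    rewrite and_E eq_E col0_E -[beval _ _ _]/(conflict_at I (H1 IT 0%N) k) H1E // ITj.
    by rewrite conflict_atE -[neval _ _ _]/(H1 GRP k) H1E.
  rewrite find_E; case: find_iotaP => [k km + _|nok].
    by rewrite (fE (Ordinal km)) => /andP[jk /eqP kc]; exists (Ordinal km).
  by have := nok y0 (ltn_ord y0); rewrite fE jy0 y0c eqxx.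
have yQ : y \in twocol H by rewrite inE yc leqnn; clear -Dn; lia.
pose Mk H' : {set 'I_m} := [set k : 'I_m | (1 <= H' MARK k)%N].
pose Inv H' := [/\ H' GRP = H GRP, y \in Mk H', Mk H' \subset twocol H &
  forall a, a \in Mk H' -> connect (rel_in (twocol H)) y a].
pose Done H' := forall a b, a \in Mk H' -> b \in twocol H -> adj a b -> b \in Mk H'.
rewrite seq_E.
rewrite -[hrun I env (HFor 8 Items grow) H2]/(foldl (fun H' x => hrun I (bind env 8 x) grow H') H2 (iota 0 m)).
have [||[iG iy iQ iC] _ iD] := @foldl_progress _ _ (fun H' x => hrun I (bind env 8 x) grow H')
   Inv Done (fun H' => #|~: Mk H'|) 1 (iota 0 m) H2.
- move=> H' x [iG iy iQ iC]; rewrite /grow /seq_ seq_E set0_E.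
  set e := bind env 8 x; set q := neval e H' _; set H3 := put H' CC 0 q.
  rewrite when_E lt_E -[neval _ _ (get0 CC)]/q -[neval _ _ items_]/m.
  have qE (k : 'I_m) : beval (bind e 1 k) H'
      fringe_ =
      [&& k \notin Mk H', k \in twocol H & [exists l, (l \in Mk H') && adj k l]].
    rewrite 3!and_E lt_E ex_E [in RHS]andbA; congr (_ && _ && _).
    - by rewrite !inE -ltnNge.
    - by rewrite inE -iG -[beval _ _ _]/(neval (bind e 1 k) H' col0_ <= H' GRP k)%N col0_E.
    - apply: eq_existsb => l; rewrite and_E inE; congr (_ && _).
      by rewrite -[LHS]/(conflict_at I k l) conflict_atE.
  have qP : if (q < m)%N then exists2 k : 'I_m, q = k &
        [&& k \notin Mk H', k \in twocol H & [exists l, (l \in Mk H') && adj k l]]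
      else Done H'.
    rewrite /q find_E; case: find_iotaP => [k km + _|nok].
      by rewrite (qE (Ordinal km)) => kP; exists (Ordinal km).
    move=> a b aM bQ ab; apply: contraT => bM; have := nok b (ltn_ord b).
    rewrite qE bM bQ /= => /negP[]; apply/existsP; exists a; rewrite aM.
    by rewrite conflict_sym.
  have Mk3 : Mk H3 = Mk H' by [].
  case: ifP qP => [_ [k qk /and3P[kM kQ /existsP[l /andP[lM kl]]]]|_ dn]; last first.
    by split=> //; left.
  have MkE : Mk (put H3 MARK q 1) = k |: Mk H'.
    apply/setP=> l'; rewrite !inE /put /= qk -[(l' == k :> nat)]/(l' == k).
    by case: (l' == k).
  rewrite -[hrun _ _ _ _]/(put H3 MARK q 1); split.
  + split.
    * exact: iG.
    * by rewrite MkE in_setU iy orbT.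
    * by rewrite MkE subUset sub1set kQ.
    * move=> a; rewrite MkE in_setU1 => /orP[/eqP ->|]; last exact: iC.
      apply: connect_trans (iC l lM) (connect1 _).
      by rewrite /rel_in /= (subsetP iQ) // kQ conflict_sym.
  + move=> dn; case/negP: kM; apply: dn lM kQ _; by rewrite conflict_sym.
  + right; have := cardsC (Mk H'); rewrite -(cardsC (k |: Mk H')) cardsU1 kM add1n MkE.
    by rewrite addSn -addnS => /addnI ->; rewrite addn1.
- split.
  + by rewrite H2E -(H1E GRP).
  + by rewrite inE H2E /put !eqxx.
  + apply/subsetP=> k; rewrite inE H2E /put /=; case: eqP => [/ord_inj -> //|_].
    by rewrite M1.
  + move=> k; rewrite inE H2E /put /=; case: eqP => [/ord_inj -> //|_].
    by rewrite M1.
- set H3 := foldl _ _ _ in iG iy iQ iC iD *; exists y, (Mk H3).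
  have dn : Done H3.
    case: iD => // le; have Z0 : ~: Mk H3 = set0.
      apply/eqP; rewrite -cards_eq0; move: le; rewrite size_iota muln1.
      have : (#|~: Mk H2| <= m)%N by rewrite -[X in (_ <= X)%N]card_ord max_card.
      by clear; lia.
    move=> a b _ _ _; have : b \notin ~: Mk H3 by rewrite Z0 inE.
    by rewrite inE negbK.
  split=> // k.
  have := @fill_set env H3 GRP (HLe (HConst 1) (HGet MARK (HVar 0)))
    (HSub (HAdd col0_ col1_) (HGet GRP (HVar 0))) (Mk H3)
    (fun x => Delta - 2 + (Delta - 1) - H GRP x)%N.
  rewrite -iG; apply=> k' H' H'1 H'2; split.
    by rewrite -[LHS]/(1 <= H' MARK k')%N H'1 // inE.
  move=> _; rewrite -[LHS]/(neval (bind env 0 k') H' col0_ + neval (bind env 0 k') H' col1_ - H' GRP k')%N.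
  by rewrite col0_E col1_E H'2 iG.
Qed.


Definition seen H : {set 'I_m} := [set k : 'I_m | H SEEN k != 0%N].

(* In [ins_drop], [Z] is the union of the odd cycles whose least items have been
   dropped; it is closed in [W], so that a new cycle is disjoint from it. *)
Record inserting W i (g0 : nat -> nat) (H0 H : store) : Prop := Inserting {
  ins_frame : H OUT = H0 OUT /\ H AG = H0 AG;
  ins_old : forall k, k \notin W -> H GRP k = g0 k;
  ins_range : forall k, k \in W -> (H GRP k < n)%N ->
    (Delta - 2 <= H GRP k <= Delta - 1)%N /\ k \in seen H;
  ins_proper : forall j k, j \in W -> k \in W -> adj j k -> (H GRP j < n)%N ->
    H GRP j != H GRP k;
  ins_order : forall j k, j \in W -> k \in W -> j \in seen H -> k \notin seen H ->
    item_value I i k <= item_value I i j;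
  ins_drop : forall B C : {set 'I_m}, [disjoint B & C] -> independent I B ->
    independent I C -> exists Z, [/\ Z \subset W :&: seen H, closed_in W Z,
      forall j, j \in W -> j \in seen H -> (n <= H GRP j)%N -> j \in Z &
      v i [set j in W :&: seen H | (n <= H GRP j)%N] <= v i (Z :\: (B :|: C))]
}.

Lemma sees_E env H j (c : hnexp) d : H IT 0%N = j ->
  (forall x, neval (bind env 3 x) H c = d) ->
  beval env H (sees_ (get0 IT) c) = [exists k, adj j k && (H GRP k == d)].
Proof.
move=> ITj cd; rewrite /sees_ ex_E; apply: eq_existsb => k; rewrite and_E eq_E cd.
by rewrite -[beval _ _ _]/(conflict_at I (H IT 0%N) k) ITj conflict_atE.
Qed.

(** If j sees both colours even after the exchange, its two neighbours in W lie in one component and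
    close an odd cycle with j. Items come by decreasing value, so the item of the cycle that B and C
    leave out is worth at least j and pays for dropping it. *)
Lemma insert_spec W i (g0 : nat -> nat) H0 env H :
  {in W, forall a, (#|[set b in W | adj a b]| <= 2)%N} ->
  W \subset freeset H0 ->
  (forall k, k \in freeset H0 -> k \notin W -> (g0 k < Delta - 2)%N) ->
  (forall k, k \notin freeset H0 -> (n <= g0 k)%N) -> H0 AG 0%N = i ->
  inserting W i g0 H0 H -> let H' := hrun I env insert H in
  [/\ inserting W i g0 H0 H', W \subset seen H -> W \subset seen H' &
      W \subset seen H' \/ (#|W :\: seen H'| + 1 <= #|W :\: seen H|)%N].
Proof.
have Dn : (Delta < n)%N by have /andP[] := D.
move=> deg2 WU g0lo g0hi AGi [[iO iA] iG iR iP iV iZ].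
have outW k : k \notin W -> (Delta - 2 <= g0 k < n)%N = false.
  move=> kW; case: (boolP (k \in freeset H0)) => kU.
    by have := g0lo k kU kW; clear -Dn; lia.
  by have := g0hi k kU; clear -Dn; lia.
have pendE e H' (ev : hnexp) k : H' OUT = H OUT -> H' GRP = H GRP -> H' SEEN = H SEEN ->
    neval e H' ev = k -> beval e H' (pending_ ev) = (k \in W :\: seen H).
  move=> E1 E2 E3 evk; rewrite -[LHS]/[&& (n <= H' OUT (neval e H' ev))%N,
    (n <= H' GRP (neval e H' ev))%N & (H' SEEN (neval e H' ev) <= 0)%N].
  rewrite evk E1 E2 E3 iO leqn0 in_setD [k \in seen H]inE negbK.
  have UE : (n <= H0 OUT k)%N = (k \in freeset H0) by rewrite inE.
  rewrite UE; case: (eqVneq (H SEEN k) 0%N) => sk; last by rewrite !andbF.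
  rewrite andbT; case: (boolP (k \in W)) => kW.
    rewrite (subsetP WU k kW) /= leqNgt; apply/negP=> /(iR k kW)[_].
    by rewrite inE sk.
  rewrite iG //; case: (boolP (k \in freeset H0)) => //= kU.
  by have := g0lo k kU kW; clear -Dn; lia.
rewrite /insert /seq_ seq_E set0_E; set q := neval env H _; set H1 := put H IT 0 q.
rewrite when_E lt_E -[neval _ _ (get0 IT)]/q -[neval _ _ items_]/m.
have H1E a : a != IT -> H1 a = H a by exact: put_frame.
have AG0 H' : H' AG = H AG -> H' AG 0%N = i by move=> ->; rewrite iA.
have maxE k : beval (bind env 1 k) H next_ =
    (k \in W :\: seen H) && [forall l, (l \in W :\: seen H) ==> (item_value I i l <= item_value I i k)].
  rewrite and_E (pendE _ _ _ k) // all_E; congr (_ && _).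
  apply: eq_forallb => l; rewrite or_E not_E (pendE _ _ _ l) // implybE; congr (_ || _).
  rewrite -[LHS]/(value_at I (H AG 0%N) l <= value_at I (H AG 0%N) k).
  by rewrite AG0 // !value_atE.
have qP : if (q < m)%N then exists2 j : 'I_m, q = j & (j \in W :\: seen H) /\
      forall l, l \in W :\: seen H -> item_value I i l <= item_value I i j
    else W \subset seen H.
  rewrite /q find_E; case: find_iotaP => [k km + _|nok].
    rewrite (maxE (Ordinal km)) => /andP[kP /forallP kM]; exists (Ordinal km) => //.
    by split=> // l lP; have := kM l; rewrite lP.
  rewrite -setD_eq0; apply: contraT => /set0Pn[j0 j0P].
  have [j jP jM] := @arg_maxP _ R _ j0 (fun l => l \in W :\: seen H) (item_value I i) j0P.
  have := nok j (ltn_ord j); rewrite maxE => /negP[]; apply/andP; split=> //.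
  by apply/forallP=> l; apply/implyP=> lP; exact: jM.
case: ifP qP => [_ [j qj [+ jM]]|_ allseen]; last first.
  by split; [split | | left].
rewrite in_setD => /andP[jnS jW].
set H2 := put H1 SEEN j 1.
rewrite seq_E -[hrun I env (HSet SEEN _ _) H1]/(put H1 SEEN q 1) qj -/H2.
have H2E a : a \notin [:: IT; SEEN] -> H2 a = H a.
  rewrite !inE !negb_or => /andP[aI aS]; rewrite -H1E //; exact: put_frame.
have IT2 : H2 IT 0%N = j by rewrite /H2 /H1 /put /= qj.
have S2 k : (H2 SEEN k != 0%N) = (k == j) || (k \in seen H).
  by rewrite /H2 /H1 /put inE /= -[(k == j :> nat)]/(k == j); case: (k == j).
have jG : (n <= H GRP j)%N.
  by rewrite leqNgt; apply/negP=> /(iR j jW)[_]; rewrite (negbTE jnS).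
have twoW H' : (forall k, k \notin W -> H' GRP k = g0 k) -> twocol H' \subset W.
  move=> G'; apply/subsetP=> k; rewrite inE; apply: contraLR => kW.
  by rewrite G' // outW.
have colW H' k d : (forall k, k \notin W -> H' GRP k = g0 k) ->
    H' GRP k = d -> (Delta - 2 <= d <= Delta - 1)%N -> k \in W.
  move=> G' kd dd; apply: contraT => kW; have := outW k kW.
  by rewrite -G' // kd; clear -dd Dn; lia.
rewrite seq_E; set H3 := hrun I env (when_ _ flip) H2.
have [H3E G3 R3 P3 both] : [/\ forall a, a \notin [:: IT; SEEN; GRP; MARK; CC] -> H3 a = H a,
    forall k, k \notin W -> H3 GRP k = g0 k,
    forall k, k \in W -> (H3 GRP k < n)%N = (H GRP k < n)%N /\
       ((H3 GRP k < n)%N -> (Delta - 2 <= H3 GRP k <= Delta - 1)%N),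
    forall a b : 'I_m, a \in W -> b \in W -> adj a b -> (H3 GRP a < n)%N ->
      H3 GRP a != H3 GRP b &
    (exists2 k, adj j k & H3 GRP k = (Delta - 2)%N) ->
    (exists2 k, adj j k & H3 GRP k = (Delta - 1)%N) ->
    exists y z, [/\ adj j y /\ adj j z, y \in twocol H3 /\ z \in twocol H3,
      connect (rel_in (twocol H3)) y z & H3 GRP y != H3 GRP z]].
  have see2 e : neval e H2 col0_ = (Delta - 2)%N /\ neval e H2 col1_ = (Delta - 1)%N.
    by rewrite col0_E ?col1_E.
  rewrite /H3 when_E and_E (@sees_E env H2 j col0_ (Delta - 2)%N) //; last first.
    by move=> x; case: (see2 (bind env 3 x)).
  rewrite (@sees_E env H2 j col1_ (Delta - 1)%N) //; last first.
    by move=> x; case: (see2 (bind env 3 x)).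
  have s2 d : [exists k, adj j k && (H2 GRP k == d)] = [exists k, adj j k && (H GRP k == d)].
    by apply: eq_existsb => k; rewrite H2E.
  rewrite !s2; case: ifP => [/andP[/existsP[y0 /andP[jy0 /eqP y0c]] /existsP[z /andP[jz /eqP zc]]]|nb]; last first.
    split=> [a aI|k|k kW|a b aW bW|].
    - by rewrite H2E //; apply: contra aI; rewrite !inE => /orP[->|->]; rewrite ?orbT.
    - by rewrite H2E //; exact: iG.
    - by rewrite H2E //; split=> // /(iR k kW)[].
    - by rewrite H2E //; exact: iP.
    - case=> y jy; rewrite H2E // => yc [z jz zc].
      case/negP: (negbT nb); apply/andP; split; apply/existsP; [exists y | exists z];
        by rewrite ?jy ?jz ?yc ?zc eqxx.
  have [|y [M [[jy yc] [yM MQ] Mc Mconn flipE]]] := @flip_spec env H2 j IT2.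
    by exists y0; rewrite // H2E.
  rewrite H2E // in yc.
  have QE : twocol H2 = twocol H by apply/setP=> k; rewrite !inE H2E.
  rewrite QE in MQ Mc Mconn.
  have QW := twoW H iG.
  have MW k : k \in M -> k \in W by move=> /(subsetP MQ)/(subsetP QW).
  have Mr k : k \in M -> (Delta - 2 <= H GRP k <= Delta - 1)%N.
    by move=> kM; have := iR k (MW k kM); have := subsetP MQ k kM; rewrite inE => /andP[_ kn] /(_ kn)[].
  have fE k : hrun I env flip H2 GRP k = if k \in M then (Delta - 2 + (Delta - 1) - H GRP k)%N else H GRP k.
    by rewrite flipE H2E.
  have fr a : a \notin [:: IT; SEEN; GRP; MARK; CC] -> hrun I env flip H2 a = H a.
    move=> aI; rewrite hrun_frame ?H2E //; first by apply: contra aI; rewrite !inE => /orP[->|->]; rewrite ?orbT.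
    by move: aI; rewrite !inE !negb_or => /and5P[_ _ -> -> ->].
  have fR k : k \in W -> (hrun I env flip H2 GRP k < n)%N = (H GRP k < n)%N /\
       ((hrun I env flip H2 GRP k < n)%N -> (Delta - 2 <= hrun I env flip H2 GRP k <= Delta - 1)%N).
    move=> kW; rewrite fE; case: ifP => [/Mr kr|_]; last by split=> // /(iR k kW)[].
    by split; move: kr; clear -Dn D2; lia.
  have MinQ a : (a \in twocol (hrun I env flip H2)) = (a \in twocol H).
    rewrite !inE fE; case: ifP => // /Mr; clear -Dn D2; lia.
  (* Degree at most 2 in W makes y and z the only neighbours of j there. *)
  have zM (k : 'I_m) : k \in W -> adj j k -> k = y \/ k = z.
    move=> kW jk; apply/pred2P; apply: contraT; rewrite negb_or => /andP[ky kz].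
    have := deg2 j jW; rewrite leqNgt => /negP[].
    have yz : y != z by apply/negP=> /eqP E; move: zc; rewrite -E yc; clear -D2; lia.
    have yW : y \in W by exact: MW.
    have zW : z \in W by apply: (colW H z (Delta - 1)%N) => //; clear -D2; lia.
    apply: (@leq_trans #|[set k; y; z]|).
      by rewrite -setUA cardsU1 cards2 yz !inE negb_or ky kz.
    by apply/subset_leq_card/subsetP=> l; rewrite !inE => /orP[/orP[]|] /eqP ->;
      rewrite ?kW ?yW ?zW ?jk ?jy ?jz.
  split=> //.
  - move=> k kW; rewrite fE ifN ?iG //; by apply: contra kW => /MW.
  - move=> a b aW bW ab; rewrite (fR a aW).1 => an; rewrite !fE.
    have ar := (iR a aW an).1; have nab := iP a b aW bW ab an.
    case: (boolP (a \in M)) => aM; case: (boolP (b \in M)) => bM //.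
    + by move: (Mr a aM) (Mr b bM) nab; clear; lia.
    + apply: contraNneq bM => bE; apply: Mc aM _ ab; rewrite inE -bE.
      by move: ar; clear -Dn; lia.
    + apply: contraNneq aM => aE; apply: (Mc b a bM); last by rewrite conflict_sym.
      by rewrite inE; move: ar; clear -Dn; lia.
  (* After the exchange y has the second colour, so the neighbour with the first one is z. It has
     been flipped too and hence lies in the component of y. *)
  - move=> [k jk kc] _; have kW : k \in W.
      apply: contraT => kW; have := outW k kW; rewrite -iG //.
      by move: kc; rewrite fE; case: ifP => [/MW|_ ->]; [rewrite (negbTE kW) | clear -Dn D2; lia].
    have yf : hrun I env flip H2 GRP y = (Delta - 1)%N by rewrite fE yM yc; clear -D2; lia.
    have kz : k = z.
      case: (zM k kW jk) => // ky; move: kc; rewrite ky yf; clear -D2; lia.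
    have zMM : z \in M.
      move: kc; rewrite kz fE; case: ifP => // _; rewrite zc; clear -D2; lia.
    exists y, z; split=> //.
    + by rewrite !MinQ (subsetP MQ y yM) (subsetP MQ z zMM).
    + rewrite (_ : twocol (hrun I env flip H2) = twocol H); last by apply/setP=> a; exact: MinQ.
      exact: Mconn.
    + by rewrite -kz kc yf; clear -D2; lia.
have IT3 : H3 IT 0%N = j by rewrite /H3 hrun_frame.
have S3 k : (H3 SEEN k != 0%N) = (k == j) || (k \in seen H) by rewrite -S2 /H3 hrun_frame.
have sE0 : beval env H3 (sees_ (get0 IT) col0_) = [exists k, adj j k && (H3 GRP k == Delta - 2)%N].
  by apply: sees_E => // x; rewrite col0_E.
have sE1 : beval env H3 (sees_ (get0 IT) col1_) = [exists k, adj j k && (H3 GRP k == Delta - 1)%N].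
  by apply: sees_E => // x; rewrite col1_E.
set H4 := hrun I env (HIf _ _ _) H3.
have H4P : (exists c, [/\ (Delta - 2 <= c <= Delta - 1)%N,
      forall k, adj j k -> H3 GRP k != c & H4 = put H3 GRP j c]) \/
    [/\ exists2 k, adj j k & H3 GRP k = (Delta - 2)%N,
        exists2 k, adj j k & H3 GRP k = (Delta - 1)%N & H4 = H3].
  have setE c e : neval env H3 e = c -> hrun I env (HSet GRP (get0 IT) e) H3 = put H3 GRP j c.
    by move=> <-; rewrite -[LHS]/(put H3 GRP (H3 IT 0%N) (neval env H3 e)) IT3.
  rewrite /H4 if_E when_E not_E sE0 sE1 (setE _ _ (col0_E env H3)) (setE _ _ (col1_E env H3)).
  case: (boolP [exists k, adj j k && (H3 GRP k == Delta - 2)%N]) => [/existsP[k0 /andP[jk0 /eqP k0c]]|/existsPn nk0].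
    case: (boolP [exists k, adj j k && (H3 GRP k == Delta - 1)%N]) => [/existsP[k1 /andP[jk1 /eqP k1c]]|/existsPn nk1].
      by right; split; [exists k0 | exists k1 |].
    left; exists (Delta - 1)%N; split=> // [|k jk]; first by clear -D2; lia.
    by have := nk1 k; rewrite jk.
  left; exists (Delta - 2)%N; split=> // [|k jk]; first by clear -D2; lia.
  by have := nk0 k; rewrite jk.
have jS3 : seen H3 = j |: seen H by apply/setP=> k; rewrite inE S3 in_setU1.
have seen4 : seen H4 = j |: seen H.
  by case: H4P => [[c [_ _ ->]]|[_ _ ->]].
have fr4 : H4 OUT = H0 OUT /\ H4 AG = H0 AG.
  rewrite -iO -iA; case: H4P => [[c [_ _ ->]]|[_ _ ->]].
    by rewrite !put_frame // !H3E.
  by rewrite !H3E.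
have W4 : (#|W :\: seen H4| + 1 <= #|W :\: seen H|)%N.
  have -> : W :\: seen H4 = (W :\: seen H) :\ j.
    by rewrite seen4; apply/setP=> k; rewrite !inE negb_or andbA.
  rewrite [leqRHS](cardsD1 j) in_setD jnS jW; by rewrite addnC.
have order4 a k : a \in W -> k \in W -> a \in seen H4 -> k \notin seen H4 ->
    item_value I i k <= item_value I i a.
  move=> aW kW; rewrite seen4 !in_setU1 => /orP[/eqP -> |aS]; rewrite negb_or => /andP[_ kS].
    by apply: jM; rewrite in_setD kS.
  exact: iV.
have Wseen : W \subset seen H -> W \subset seen H4.
  by move=> /subset_trans; apply; rewrite seen4 subsetUr.
have XinE H' k : (k \in [set a in W :&: seen H' | (n <= H' GRP a)%N]) =
    [&& k \in W, k \in seen H' & (n <= H' GRP k)%N].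
  by rewrite in_set in_setI andbA.
have j3 : (n <= H3 GRP j)%N by rewrite leqNgt (R3 j jW).1 -leqNgt.
split=> //; last by right.
case: H4P => [[c [cc cn H4E]]|[b0 b1 H4E]].
  have G4 k : H4 GRP k = if k == j then c else H3 GRP k by rewrite H4E.
  split=> //.
  - by move=> k kW; rewrite G4 ifN ?G3 //; apply: contraNneq kW => ->.
  - move=> k kW; rewrite G4 seen4 in_setU1; case: eqP => //= _ kn.
    by rewrite (R3 k kW).2 //; split=> //; apply: (iR k kW _).2; rewrite -(R3 k kW).1.
  - move=> a k aW kW ak; rewrite !G4; case: (eqVneq a j) => aj; case: (eqVneq k j) => kj.
    + by move: ak; rewrite aj kj conflict_irr.
    + by move=> _; rewrite eq_sym cn // -aj.
    + by move=> _; apply: cn; rewrite -kj conflict_sym.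
    + exact: P3.
  (* Colouring j adds no dropped item, so the old Z still serves. *)
  - move=> B C BC Bi Ci; have [Z [ZW Zc ZX Zv]] := iZ B C BC Bi Ci.
    have XE k : k \in W -> (n <= H4 GRP k)%N = (k != j) && (n <= H GRP k)%N.
      move=> kW; rewrite G4; case: (eqVneq k j) => _ /=; first by clear -cc Dn D2; lia.
      by rewrite leqNgt (R3 k kW).1 -leqNgt.
    exists Z; split=> //.
    + apply: subset_trans ZW _; apply: setIS; by rewrite seen4 subsetUr.
    + move=> k kW; rewrite XE // seen4 in_setU1 => + /andP[kj kn].
      by rewrite (negbTE kj) => kS; exact: ZX.
    + apply: le_trans Zv; apply: valuationS; apply/subsetP=> k; rewrite !XinE seen4 in_setU1.
      move=> /and3P[kW kS]; rewrite XE // => /andP[kj kn].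
      by rewrite kW kn andbT /=; move: kS; rewrite (negbTE kj).
have [y [z [[jy jz] [yQ zQ] yz fyz]]] := both b0 b1.
have QW := twoW H3 G3.
have jQ : j \notin twocol H3.
  by rewrite inE negb_and -!leqNgt j3 orbT.
split=> //.
- by move=> k kW; rewrite H4E G3.
- move=> k kW; rewrite H4E jS3 in_setU1 => kn; rewrite (R3 k kW).2 //; split=> //.
  by rewrite (iR k kW _).2 ?orbT // -(R3 k kW).1.
- by rewrite H4E.
move=> B C BC Bi Ci; have [Z [ZW Zc ZX Zv]] := iZ B C BC Bi Ci.
have Qrange a : a \in twocol H3 -> (Delta - 2 <= H3 GRP a <= Delta - 1)%N.
  move=> aQ; apply: (R3 a (subsetP QW a aQ)).2; by move: aQ; rewrite inE => /andP[].
have [||K [jK KQ Kc [u uK uBC] KZ]] := @odd_cycle W (twocol H3) (fun a => H3 GRP a) j y z B C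
  deg2 QW jW jQ yQ zQ jy jz yz fyz _ _ BC Bi Ci.
- move=> a b aQ bQ ab; apply: P3 => //; try exact: (subsetP QW).
  by move: aQ; rewrite inE => /andP[].
- move=> a aQ; move: (Qrange a aQ) (Qrange y yQ) (Qrange z zQ) fyz; clear -D2.
  by move=> h1 h2 h3 h4; apply/orP; lia.
have jZ : j \notin Z.
  by apply: contra jnS => /(subsetP ZW); rewrite inE => /andP[].
have KZ0 := KZ Z Zc jZ.
have Kseen a : a \in K -> a \in W /\ a \in seen H4.
  move=> /(subsetP KQ); rewrite in_setU1 seen4 in_setU1 => /orP[/eqP ->|aQ].
    by rewrite eqxx.
  have aW := subsetP QW a aQ; split=> //; rewrite (iR a aW _).2 ?orbT //.
  by rewrite -(R3 a aW).1; move: aQ; rewrite inE => /andP[].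
(* K is disjoint from Z, so its item u has not been charged for an earlier drop. *)
exists (Z :|: K); split.
- apply/subsetP=> a; rewrite in_setU in_setI => /orP[/(subsetP ZW)|/Kseen[-> ->]] //.
  by rewrite seen4 in_setI in_setU1 => /andP[-> ->]; rewrite orbT.
- move=> a b; rewrite !in_setU => /orP[aZ|aK] bW ab.
    by rewrite (Zc a b aZ bW ab).
  by rewrite (Kc a b aK bW ab) orbT.
- move=> a aW; rewrite seen4 in_setU1 in_setU H4E => /orP[/eqP ->|aS] an.
    by rewrite jK orbT.
  by rewrite ZX // leqNgt -(R3 a aW).1 -leqNgt.
- have uval : item_value I i j <= item_value I i u.
    have [uW uS] := Kseen u uK; move: uS; rewrite seen4 in_setU1 => /orP[/eqP -> //|uS].
    by apply: iV.
  apply: (@le_trans _ _ (item_value I i j + v i (Z :\: (B :|: C)))).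
    apply: (@le_trans _ _ (v i (j |: [set k in W :&: seen H | (n <= H GRP k)%N]))).
      apply: valuationS; apply/subsetP=> k; rewrite in_setU1 !XinE seen4 in_setU1 H4E.
      move=> /and3P[kW /orP[-> //|kS] kn].
      by rewrite kW kS leqNgt -(R3 k kW).1 -leqNgt kn orbT.
    rewrite valuationU ?valuation1 ?lerD2l //.
    by rewrite disjoints1 XinE (negbTE jnS) andbF.
  apply: (@le_trans _ _ (v i [set u] + v i (Z :\: (B :|: C)))).
    by rewrite valuation1 lerD2r.
  rewrite -valuationU; last first.
    by rewrite disjoints1 in_setD negb_and (disjointFr KZ0 uK) orbT.
  apply: valuationS; apply/subsetP=> a; rewrite in_setU1 !in_setD (in_setU _ Z K).
  by case/orP=> [/eqP ->|/andP[aBC aZ]]; rewrite ?uBC ?uK ?aBC ?aZ ?orbT.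
Qed.


Definition coloured H : {set 'I_m} := [set j : 'I_m | (H GRP j < n)%N].

(** The dropped items are worth at most Z without B and C. Hence the coloured items are worth at
    least all free items but those of that set, and these include B and C. *)
Lemma colour_drop_spec env H i : H AG 0%N = i ->
  let H' := hrun I env colour_drop H in
  [/\ coloured H' \subset freeset H,
      forall j, (H' GRP j < n)%N -> (H' GRP j < Delta)%N,
      forall j k, adj j k -> (H' GRP j < n)%N -> H' GRP j != H' GRP k &
      forall B C : {set 'I_m}, [disjoint B & C] -> independent I B -> independent I C ->
        B \subset freeset H -> C \subset freeset H ->
        v i B + v i C <= v i (coloured H')].
Proof.
have Dn : (Delta < n)%N by have /andP[] := D.
move=> AGi; rewrite /colour_drop /seq_ seq_E; set H1 := hrun I env (fill GRP true_ agents_) H.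
have H1E a : a != GRP -> H1 a = H a by exact: fill_frame.
have G1 j : H1 GRP j = n by apply: (@reset_all env H GRP agents_ (fun=> n)).
rewrite seq_E; set H2 := hrun I env (first_fit GRP _ _) H1.
have H2E a : a != GRP -> H2 a = H a.
  move=> aM; rewrite -H1E //; exact: first_fit_frame.
have [|ff1 ff2 ff3] := @first_fit_spec env H1 GRP (free_ (HVar 0)) col0_
    (fun x => n <= H OUT x)%N (Delta - 2)%N.
  move=> x H' xm H'1; split=> [|c]; last by rewrite col0_E.
  by rewrite -[beval _ _ _]/(n <= H' OUT x)%N H'1 // H1E.
rewrite -/H2 in ff1 ff2 ff3.
have UE j : (n <= H OUT j)%N = (j \in freeset H) by rewrite inE.
rewrite seq_E; set H3 := hrun I env (fill SEEN true_ (HConst 0)) H2.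
have H3E a : a != SEEN -> H3 a = H2 a by exact: fill_frame.
have S3 j : H3 SEEN j = 0%N by apply: (@reset_all env H2 SEEN (HConst 0) (fun=> 0%N)).
pose W := [set j in freeset H | (n <= H2 GRP j)%N].
have WU : W \subset freeset H by apply/subsetP=> j; rewrite inE => /andP[].
have g0lo k : k \in freeset H -> k \notin W -> (H2 GRP k < Delta - 2)%N.
  move=> kU; rewrite inE kU /= -ltnNge => kn; move: kU; rewrite -UE => kU.
  by have [||] := ff2 k kU; rewrite ?G1.
have g0hi k : k \notin freeset H -> (n <= H2 GRP k)%N.
  by rewrite -UE => kU; rewrite ff1 ?G1 // negb_and kU.
(* An item refused by first fit with Delta - 2 colours has that many distinct neighbours outside W,
   which leaves at most two inside. *)
have deg2 : {in W, forall a : 'I_m, (#|[set b in W | adj a b]| <= 2)%N}.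
  move=> a aW; have aU := subsetP WU a aW; have an : (n <= H2 GRP a)%N by move: aW; rewrite inE => /andP[].
  rewrite -UE in aU; have [|_ nb] := ff3 a aU; first by rewrite G1.
  have [f fP] : exists f : 'I_(Delta - 2) -> 'I_m, forall c, adj a (f c) /\ H2 GRP (f c) = c.
    apply: (@fin_all_exists 'I_(Delta - 2) (fun=> 'I_m) (fun c k => adj a k /\ H2 GRP k = c)).
    move=> c; have cl := ltn_ord c; have [||k ak kc] := nb c; last by exists k.
    - by rewrite leq_min; move: cl; clear -Dn; lia.
    - by move: cl an; clear -Dn; lia.
  have finj : injective f.
    move=> c d fcd; apply/val_inj; have [_ lc] := fP c; have [_ ld] := fP d.
    by rewrite /= -lc -ld fcd.
  have dis : [disjoint f @: 'I_(Delta - 2) & [set b in W | adj a b]].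
    rewrite -setI_eq0; apply/eqP/setP=> b; rewrite in_setI in_set in_set0.
    apply/negP=> /andP[/imsetP[c _ ->] /andP[+ _]]; rewrite inE (fP c).2.
    by have := ltn_ord c; clear -Dn; lia.
  have sub : f @: 'I_(Delta - 2) :|: [set b in W | adj a b] \subset [set b | adj a b].
    apply/subsetP=> b; rewrite in_setU !in_set => /orP[/imsetP[c _ ->]|/andP[_ ->] //].
    by rewrite (fP c).1.
  have := leq_trans (subset_leq_card sub) (degree_le a).
  rewrite cardsU disjoint_setI0 // cards0 subn0 card_imset // card_ord.
  by move: #|_| D2 => c; clear; lia.
have ins3 : inserting W i (H2 GRP) H H3.
  split.
  - by rewrite !H3E // !H2E.
  - by move=> k _; rewrite H3E.
  - by move=> k; rewrite inE H3E // => /andP[_ kn]; rewrite ltnNge kn.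
  - by move=> j k; rewrite inE H3E // => /andP[_ kn]; rewrite ltnNge kn.
  - by move=> j k _ _; rewrite inE S3.
  - move=> B C _ _ _; exists set0; split.
    + exact: sub0set.
    + by move=> a b; rewrite inE.
    + by move=> j _; rewrite inE S3.
    + rewrite set0D valuation0 (_ : [set _ in _ | _] = set0) ?valuation0 //.
      by apply/setP=> k; rewrite in_set in_setI [_ \in seen H3]inE S3 andbF in_set0.
have [||i4 _] := @foldl_progress _ _ (fun H' x => hrun I (bind env 9 x) insert H')
   (inserting W i (H2 GRP) H) (fun H' => W \subset seen H') (fun H' => #|W :\: seen H'|) 1 (iota 0 m) H3.
- move=> H' x ins; exact: insert_spec.
- exact: ins3.
rewrite -[hrun I env (HFor 9 Items insert) H3]/(foldl (fun H' x => hrun I (bind env 9 x) insert H') H3 (iota 0 m)).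
set H4 := foldl _ _ _ in i4 *.
have [_ G4 R4 P4 _ Z4] := i4; move=> done4.
have {}done4 : W \subset seen H4.
  case: done4 => //; rewrite size_iota muln1 => le; rewrite -setD_eq0 -cards_eq0.
  have : (#|W :\: seen H3| <= m)%N by rewrite -[X in (_ <= X)%N]card_ord max_card.
  by move: le; move: #|_| #|_| => a b; clear; lia.
have TU : coloured H4 \subset freeset H.
  apply/subsetP=> k; rewrite inE => kn; apply: contraTT kn => kU.
  by rewrite -leqNgt G4 ?g0hi //; apply: contra kU; exact: (subsetP WU).
have lo k : k \notin W -> (H4 GRP k < n)%N -> (H4 GRP k < Delta - 2)%N.
  move=> kW kn; have kU : k \in freeset H by apply: (subsetP TU); rewrite inE.
  by rewrite G4 // g0lo.
split=> //.
- move=> j jn; case: (boolP (j \in W)) => jW; last by have := lo j jW jn; clear; lia.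
  by have [+ _] := R4 j jW jn; clear -D2; lia.
- move=> j k jk jn; case: (boolP (j \in W)) => jW; case: (boolP (k \in W)) => kW.
  + exact: P4.
  + have [+ _] := R4 j jW jn; have [kn|] := ltnP (H4 GRP k) n; last by move: jn; clear; lia.
    by have := lo k kW kn; clear; lia.
  + have jl := lo j jW jn; have [kn|] := ltnP (H4 GRP k) n; last by move: jn; clear; lia.
    by have [+ _] := R4 k kW kn; move: jl; clear; lia.
  + have jU : (n <= H OUT j)%N by rewrite UE (subsetP TU) // inE.
    have [||_ /(_ k jk)] := ff2 j jU; first by rewrite G1.
      by rewrite -G4.
    by rewrite !G4 // eq_sym.
- move=> B C BC Bi Ci BU CU; have [Z [ZW _ _ Zv]] := Z4 B C BC Bi Ci.
  rewrite -valuationU //; set X := [set j in W :&: seen H4 | _] in Zv.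
  have UX : freeset H = coloured H4 :|: X.
    apply/setP=> k; rewrite in_setU /X in_set in_setI.
    case: (boolP (k \in coloured H4)) => [/(subsetP TU) -> //|kn] /=.
    have {}kn : (n <= H4 GRP k)%N by move: kn; rewrite inE -leqNgt.
    rewrite kn andbT; case: (boolP (k \in W)) => kW.
      by rewrite (subsetP done4) // (subsetP WU).
    apply/negbTE/negP=> kU; have := g0lo k kU kW; rewrite -G4 //.
    by move: kn; clear -Dn; lia.
  have TX : [disjoint coloured H4 & X].
    rewrite -setI_eq0; apply/eqP/setP=> k; rewrite in_setI inE /X in_set in_set0.
    by rewrite [(n <= _)%N]leqNgt; case: (_ < n)%N; rewrite ?andbF.
  have UZ : Z :\: (B :|: C) \subset freeset H.
    by apply: subset_trans (subsetDl _ _) (subset_trans ZW (subset_trans (subsetIl _ _) WU)).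
  have : v i (B :|: C) <= v i (freeset H :\: (Z :\: (B :|: C))).
    apply: valuationS; rewrite subsetD subUset BU CU /= -setI_eq0.
    by apply/eqP/setP=> k; rewrite in_setI in_setD in_set0; case: (k \in B :|: C).
  rewrite valuationDS // {1}UX (valuationU i TX) => le.
  by move: le Zv; clear; lra.
Qed.

(** Two shares of the first agent are disjoint independent sets, so the coloured items are worth 2
    mu_i and the threshold measured on them suffices. If a coloured item reaches it, giving it away
    costs the other agent at most one of its two shares. *)
Lemma even_pair_spec env H : fair H -> #|active H| = 2%N -> H NUM0 0%N = 2%N ->
  let H' := hrun I env even_pair H in
  [/\ good H', #|active H'| = 1%N & forall i, i \in active H' -> shares i (freeset H') 1] \/
  exists i, [/\ i \in active H /\ H' AG 0%N = i, H' OUT = H OUT /\ H' DONE = H DONE,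
      alpha * mu i <= threshold H' BASE1 i,
      base H' BASE1 = coloured H' /\ coloured H' \subset freeset H &
      [/\ forall j, (H' GRP j < n)%N -> (H' GRP j < Delta)%N,
      forall j k, adj j k -> (H' GRP j < n)%N -> H' GRP j != H' GRP k &
      forall j, j \in coloured H' -> item_value I i j < threshold H' BASE1 i]].
Proof.
move=> [gH shH] a2 N2; have [|i ia HE] := @first_active_E env H; first by rewrite a2.
rewrite /even_pair /seq_ seq_E HE; set H1 := put H AG 0 i.
rewrite seq_E; set H2 := hrun I env colour_drop H1.
have H1E a : a != AG -> H1 a = H a by exact: put_frame.
have AG1 : H1 AG 0%N = i by [].
have [T1 T2 T3 T4] := @colour_drop_spec env H1 i AG1; rewrite -/H2 in T1 T2 T3 T4.
have free1 : freeset H1 = freeset H by [].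
rewrite free1 in T1 T4.
have H2E a : a \notin [:: GRP; SEEN; MARK; IT; CC; AG] -> H2 a = H a.
  move=> aI; rewrite -H1E; last by apply: contra aI => /eqP ->.
  by apply: hrun_frame; apply: contra aI; rewrite !inE; do ![case: eqP => //= _].
have AG2 : H2 AG 0%N = i by rewrite /H2 hrun_frame.
rewrite seq_E; set H3 := hrun I env (fill BASE1 true_ _) H2.
rewrite seq_E; set H4 := hrun I env (fill BASE1 (lt_ _ _) _) H3.
have H3E a : a != BASE1 -> H3 a = H2 a by exact: fill_frame.
have H4E a : a != BASE1 -> H4 a = H2 a.
  move=> aM; rewrite -H3E //; exact: fill_frame.
have B3 j : H3 BASE1 j = 0%N by apply: (@reset_all env H2 BASE1 (HConst 0) (fun=> 0%N)).
have B4 : base H4 BASE1 = coloured H2.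
  apply/setP=> j; rewrite inE /H4 (@fill_set env H3 BASE1 _ (HConst 1) (coloured H2) (fun=> 1%N)).
    by rewrite B3; case: ifP.
  move=> k H' H'1 _; split=> //.
  rewrite lt_E inE -[neval _ _ (HGet _ _)]/(H' GRP k) H'1 // H3E //.
have th4 : threshold H4 BASE1 i = alpha * v i (coloured H2) / 2.
  by rewrite /threshold B4 H4E // H2E // N2.
have R4 : (0 < H4 NUM0 0%N)%N by rewrite H4E // H2E // N2.
have thmu : alpha * mu i <= threshold H4 BASE1 i.
  apply: threshold_mms => //; rewrite B4 H4E // H2E // N2.
  have := shH i ia; rewrite a2 => /shares2[B [C [BC [BU CU] [Bi Ci] [Bv Cv]]]].
  have := T4 B C BC Bi Ci BU CU; clear -Bv Cv; lra.
rewrite seq_E set0_E; set q := neval env H4 _; set H5 := put H4 IT 0 q.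
have H5E a : a \notin [:: GRP; SEEN; MARK; IT; CC; AG; BASE1] -> H5 a = H a.
  move=> aI; have aI' : a != IT by apply: contra aI => /eqP ->.
  have aB : a != BASE1 by apply: contra aI => /eqP ->.
  rewrite -H2E; last by apply: contra aI; rewrite !inE; do ![case: eqP => //= _].
  rewrite -H4E //; exact: put_frame.
have qE (k : 'I_m) : beval (bind env 1 k) H4 pair_single_ =
    (k \in coloured H2) && (threshold H4 BASE1 i <= item_value I i k).
  rewrite and_E lt_E (@threshold_enough _ _ _ _ _ i) //; last first.
    by move=> x; rewrite -[LHS]/(H4 AG 0%N) H4E.
  rewrite inE -[neval _ _ (HGet _ _)]/(H4 GRP k) H4E //; congr (_ && (_ <= _)).
  by rewrite -[LHS]/(value_at I (H4 AG 0%N) k) H4E // AG2 value_atE.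
have qP : if (q < m)%N then exists2 k : 'I_m, q = k & (k \in coloured H2) && (threshold H4 BASE1 i <= item_value I i k)
    else forall k, k \in coloured H2 -> item_value I i k < threshold H4 BASE1 i.
  rewrite /q find_E; case: find_iotaP => [k km + _|nok].
    by rewrite (qE (Ordinal km)) => kP; exists (Ordinal km).
  by move=> k kT; have := nok k (ltn_ord k); rewrite qE kT -ltNge.
rewrite when_E lt_E -[neval _ _ (get0 IT)]/q -[neval _ _ items_]/m.
case: ifP qP => [_ [j qj /andP[jT jv]]|_ nosing]; last first.
  right; exists i; split.
  - by split=> //; rewrite -[H5 AG 0%N]/(H4 AG 0%N) H4E.
  - by rewrite !H5E.
  - exact: thmu.
  - rewrite -[base H5 _]/(base H4 BASE1) B4 /coloured.
    have -> : H5 GRP = H2 GRP by rewrite -(H4E GRP).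
    by [].
  - have -> : H5 GRP = H2 GRP by rewrite -(H4E GRP).
    split=> // k; rewrite -[threshold H5 _ _]/(threshold H4 BASE1 i) => kT; apply: nosing.
    by move: kT; rewrite !inE -(H4E GRP).
left; set H6 := hrun I env _ H5.
have jU := subsetP T1 j jT.
have [|||k|k|g6 f6 a6] := @good_give H H6 i [set j] gH ia.
- by rewrite sub1set.
- by apply/independentP=> k l; rewrite !inE => /eqP -> /eqP ->; rewrite conflict_irr.
- by rewrite valuation1; exact: le_trans jv.
- rewrite inE -[H6 OUT k]/(put H5 OUT q (H4 AG 0%N) OUT k) /put /= qj H4E // AG2.
  by rewrite -(H5E OUT).
- rewrite -[H6 DONE k]/(put (put H5 OUT q (H4 AG 0%N)) DONE (H4 AG 0%N) 1 DONE k) /put /= H4E // AG2.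
  by rewrite -(H5E DONE).
have c6 : #|active H6| = 1%N.
  by rewrite a6; move: a2; rewrite (cardsD1 i) ia => -[].
split=> // k; rewrite a6 f6 in_setD1 => /andP[_ ka].
by have := shares_remove j (shH k ka); rewrite a2.
Qed.

End EvenDegree.

(** * Two agents, by the parity of the maximum degree *)

Section Main.
Implicit Types (H : store) (env : nat -> nat) (i : 'I_n) (j k : 'I_m) (S U W Z : {set 'I_m}).

Lemma bags_idle env stop H : (#|active H| <= stop)%N -> hrun I env (bags stop) H = H.
Proof.
move=> ac; rewrite -[LHS]/(foldl (fun H' x => hrun I (bind env 9 x)
  (when_ (lt_ (HConst stop) nactive_) bag_step) H') H (iota 0 n)).
elim: (iota 0 n) => // x s IH.
rewrite -[LHS]/(foldl _ (hrun I (bind env 9 x) (when_ (lt_ (HConst stop) nactive_) bag_step) H) s).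
by rewrite when_E lt_E nactive_E ltnNge ac.
Qed.

Lemma served_bag_inv H H' : (forall i, threshold H' BASE i = threshold H BASE i) ->
  served H H' ->
  (forall i, i \in active H -> [/\ alpha * mu i <= threshold H BASE i,
     forall j, j \in freeset H -> item_value I i j <= threshold H BASE i &
     (Delta%:R + 2) * threshold H BASE i <= v i (freeset H)]) ->
  bag_inv (Delta.+1)%:R 1 H'.
Proof.
move=> thE [g' a' aS fS sv] iH; split=> // i ia.
have [h1 h2 h3] := iH i (subsetP aS i ia); rewrite thE; split=> //.
  by move=> j /(subsetP fS); exact: h2.
have -> : #|active H'| = 1%N.
  by apply/eqP; rewrite eqn_leq a'; apply/card_gt0P; exists i.
have := sv i ia; rewrite -natr1 subrr mulr0 addr0; move: h3; clear; lra.
Qed.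

(** For p = (Delta + 1) / 2 matchings, c = 2 and 2 (p - 1) + 3 = Delta + 2. *)
Lemma odd_serve env H : odd Delta -> (0 < H NUM0 0%N)%N ->
  bag_inv (Delta%:R + 2) 2 H -> #|active H| = 2%N ->
  (forall j, (H LOC j < Delta./2.+1)%N) ->
  (forall j, (inner_degree (H LOC) j (H LOC j) <= 1)%N) ->
  bag_inv (Delta.+1)%:R 1 (hrun I env serve_pair (hrun I env odd_pair H)).
Proof.
move=> oD R0 [gH iH] a2 lab mat.
have [|i ia HE] := @first_active_E env H; first by rewrite a2.
rewrite {1}/odd_pair /seq_ seq_E HE; set H1 := put H AG 0 i.
rewrite seq_E; set H2 := hrun I env (fill GRP true_ agents_) H1.
rewrite seq_E; set H3 := hrun I env (fill GRP (free_ _) _) H2.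
set H4 := hrun I env (fill BASE1 _ _) H3.
have H1E a : a != AG -> H1 a = H a by exact: put_frame.
have H2E a : a \notin [:: AG; GRP] -> H2 a = H a.
  rewrite !inE negb_or => /andP[a1 a3]; rewrite -H1E //; apply: hrun_frame.
  by rewrite inE.
have H3E a : a \notin [:: AG; GRP] -> H3 a = H a.
  move=> aI; rewrite -H2E //; apply: hrun_frame; move: aI.
  by rewrite !inE negb_or => /andP[].
have H4E a : a \notin [:: AG; GRP; BASE1] -> H4 a = H a.
  rewrite !inE !negb_or => /and3P[a1 a3 a4]; rewrite -H3E; last by rewrite !inE negb_or a1.
  exact: fill_frame.
have G2 j : H2 GRP j = n by apply: (@reset_all env H1 GRP agents_ (fun=> n)).
have G4 j : H4 GRP j = if j \in freeset H then H LOC j else n.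
  have -> : H4 GRP = H3 GRP by exact: hrun_frame.
  rewrite /H3 (@fill_set env H2 GRP _ _ (freeset H) (H LOC)) ?G2 // => k H' H'1 _.
  split; first by rewrite -[LHS]/(n <= H' OUT k)%N H'1 // H2E // inE.
  by move=> _; rewrite -[LHS]/(H' LOC k) H'1 // H2E.
have B4 j : H4 BASE1 j = H BASE j.
  apply: (@reset_all env H3 BASE1 _ (H BASE)) => k H' H'1 _.
  by rewrite -[LHS]/(H' BASE k) H'1 // H3E.
have th4 (k : 'I_n) : threshold H4 BASE k = threshold H BASE k by rewrite /threshold /base !H4E.
have th1 : threshold H4 BASE1 i = threshold H BASE i.
  rewrite /threshold H4E //; congr (_ * v i _ / _); apply/setP=> j.
  by rewrite !inE B4.
have [free4 act4] : freeset H4 = freeset H /\ active H4 = active H.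
  by rewrite /freeset /active !H4E.
have gH4 : good H4 by apply: (good_ext _ _ gH); rewrite H4E.
have Dn : (Delta < n)%N by have /andP[] := D.
have grpE g : (g < n)%N -> group H4 GRP g = [set j in freeset H | H LOC j == g].
  move=> gn; rewrite /group free4; apply/setP=> j; rewrite in_set [in RHS]in_set G4.
  by case: (j \in freeset H).
have matg (g : nat) : matching [set j in freeset H | H LOC j == g] by exact: matching_group.
have [thmu items vfree] := iH i ia.
rewrite a2 subrr mulr0 addr0 in vfree.
set t := threshold H BASE i in thmu items vfree.
have t0 : 0 <= t by exact: threshold_ge0.
pose w (g : nat) := v i [set j in freeset H | H LOC j == g].
pose h (g : nat) := v i (heavy i [set j in freeset H | H LOC j == g]).
have wh (d : nat) : w d <= 2 * h d by exact: heavy_half.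
have sumw : (2 * ((Delta./2.+1)%:R - 1) + 3) * t <= \sum_(d < Delta./2.+1) w d.
  rewrite -(value_blocks i (fun j _ => lab j)); apply: le_trans vfree.
  rewrite ler_wpM2r //.
  have -> : Delta%:R = 1 + 2 * (Delta./2)%:R :> R.
    by rewrite -{1}(odd_double_half Delta) oD natrD -mul2n natrM.
  by rewrite -natr1; lra.
have [d dp dh] : exists2 d, (d < Delta./2.+1)%N & t <= h d.
  apply: (@some_group R w h _ 2 t) => //; first by rewrite ltr_nat.
  by move=> d; exact: valuation_ge0.
have ltn' e : (e < Delta./2.+1)%N -> (e < n)%N by clear -Dn D; lia.
have srv : served H4 (hrun I env serve_pair H4).
  apply: (@serve_pair_spec env H4 i gH4) => //.
  - by rewrite act4.
  - by rewrite act4.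
  - have -> : H4 AG = H1 AG by rewrite /H4 /H3 /H2 !hrun_frame.
    by [].
  - by rewrite H4E.
  - by move=> k; rewrite act4 th4 => /iH[].
  - by rewrite th1.
  - by move=> g gn; rewrite grpE //; exact: matg.
  - by move=> j; rewrite free4 th1 => jU _; exact: items.
  - by exists d; [exact: ltn' | rewrite th1 grpE //; exact: ltn'].
  - move=> g gn others; rewrite th1 grpE //.
    apply: (@big_group R w Delta./2.+1 2 t g) => //; first by rewrite ltr_nat.
      by move=> e; exact: valuation_ge0.
    move=> e ep eg; apply: le_trans (wh e) _; rewrite ler_pM2l //.
    by have := others e (ltn' e ep) eg; rewrite th1 grpE ?ltn' // => /ltW.
apply: served_bag_inv srv _.
  by move=> k; rewrite /threshold /base !hrun_frame.
move=> k; rewrite act4 th4 free4 => ka; have [h1 h2 h3] := iH k ka; split=> //.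
by move: h3; rewrite a2 subrr mulr0 addr0.
Qed.

(** For p = Delta independent groups, c = 1 and (p - 1) + 3 = Delta + 2. The first agent's threshold
    refers to the coloured items, the second agent's to all free ones. *)
Lemma even_serve env H i : (2 <= Delta)%N -> fair H -> no_single H ->
  #|active H| = 2%N -> H NUM0 0%N = 2%N -> i \in active H -> H AG 0%N = i ->
  base H BASE = freeset H -> alpha * mu i <= threshold H BASE1 i ->
  base H BASE1 = coloured H -> coloured H \subset freeset H ->
  (forall j, (H GRP j < n)%N -> (H GRP j < Delta)%N) ->
  (forall j k, adj j k -> (H GRP j < n)%N -> H GRP j != H GRP k) ->
  (forall j, j \in coloured H -> item_value I i j < threshold H BASE1 i) ->
  bag_inv (Delta.+1)%:R 1 (hrun I env serve_pair H).
Proof.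
move=> D2 [gH sH] nsH a2 N2 ia AGi bE thi b1E cU lt proper items.
have Dn : (Delta < n)%N by have /andP[] := D.
have R0 : (0 < H NUM0 0%N)%N by rewrite N2.
have thE (k : 'I_n) : threshold H BASE k = alpha * v k (freeset H) / 2.
  by rewrite /threshold bE N2.
have thr (k : 'I_n) : k \in active H -> alpha * mu k <= threshold H BASE k.
  move=> ka; apply: threshold_mms => //; rewrite bE N2 -a2.
  exact/shares_value/sH.
have itemle (k : 'I_n) j : k \in active H -> j \in freeset H -> item_value I k j <= threshold H BASE k.
  move=> ka jU; have := nsH k j ka jU; rewrite a2 thE.
  by move: (alpha * _) => x; clear; lra.
have pairle (k : 'I_n) S : (Delta%:R + 2) * (alpha * v k S / 2) <= v k S.
  have := ratio_pair R (_ : 0 < Delta)%N; have := valuation_ge0 k S.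
  have := ltnW D2; move: (Delta%:R : R) alpha (v k S) => x y z d0 z0 /(_ d0).
  by clear -z0; nra.
set t := threshold H BASE1 i in thi items.
have t0 : 0 <= t by exact: threshold_ge0.
have grpE (g : nat) : (g < n)%N -> group H GRP g = [set j in coloured H | H GRP j == g].
  move=> gn; apply/setP=> j; rewrite in_set [in RHS]in_set.
  have [jg|] := eqVneq (H GRP j) g; last by rewrite !andbF.
  have jc : j \in coloured H by rewrite inE jg.
  by rewrite jc (subsetP cU).
have indg (g : nat) : (g < n)%N -> independent I (group H GRP g).
  move=> gn; apply/independentP=> j k; rewrite !inE => /andP[_ /eqP jg] /andP[_ /eqP kg].
  apply/negP=> jk; have := proper j k jk; rewrite jg kg eqxx.
  by move=> /(_ gn).
pose w (g : nat) := v i [set j in coloured H | H GRP j == g].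
have hw (g : nat) : (g < n)%N -> v i (heavy i (group H GRP g)) = w g.
  by move=> gn; rewrite heavy_id ?indg // grpE.
have sumw : (1 * (Delta%:R - 1) + 3) * t <= \sum_(d < Delta) w d.
  rewrite -(@value_blocks i (coloured H) (H GRP) Delta) => [|j]; last first.
    by rewrite inE; exact: lt.
  have -> : 1 * (Delta%:R - 1) + 3 = Delta%:R + 2 :> R by lra.
  by apply: le_trans (pairle i _); rewrite /t /threshold b1E N2.
have w0 (d : nat) : 0 <= w d by exact: valuation_ge0.
have ltn' (e : nat) : (e < Delta)%N -> (e < n)%N by move/ltn_trans; apply.
have [d dp dh] : exists2 d, (d < Delta)%N & t <= w d.
  apply: (@some_group R w w _ 1 t) => //; first exact: ltnW.
    by rewrite ltr1n.
  by move=> d _; rewrite mul1r.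
have srv : served H (hrun I env serve_pair H).
  apply: (@serve_pair_spec env H i gH) => //.
  - by move=> g gn; apply/matching_independent/indg.
  - by move=> j _ jn; apply/ltW/items; rewrite inE.
  - by exists d; [exact: ltn' | rewrite hw //; exact: ltn'].
  - move=> g gn others; rewrite grpE //.
    apply: (@big_group R w Delta 1 t g) => //; first by rewrite ltr1n.
    move=> e ep eg; rewrite mul1r -hw ?ltn' //.
    exact/ltW/others/eg/ltn'.
apply: served_bag_inv srv _.
  by move=> k; rewrite /threshold /base !hrun_frame.
move=> k ka; split; [exact: thr | by move=> j; exact: itemle | by rewrite thE].
Qed.

End Main.

(** * The whole algorithm *)

Section Final.
Implicit Types (H : store) (env : nat -> nat) (i : 'I_n) (j k : 'I_m) (S U W Z : {set 'I_m}).

Definition ready H : Prop :=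
  [/\ fair H, no_single H, base H BASE = freeset H,
      H NUM0 0%N = #|active H| &
      (forall j, (H LOC j < Delta./2.+1)%N) /\
      (forall j, (inner_degree (H LOC) j (H LOC j) <= 1)%N)].

Lemma start_spec env : exists2 H, ready H & hrun I env program (fun _ _ => 0%N) =
  hrun I env (seq_ [::
  rounds;
  first_fit OUT true_ agents_]) H.
Proof.
rewrite /program /seq_.
rewrite seq_E; set H1 := hrun I env (fill OUT _ _) _.
rewrite seq_E; set H2 := hrun I env local_search H1.
rewrite seq_E; set H3 := hrun I env singles H2.
rewrite seq_E; set H4 := hrun I env (fill BASE _ _) H3.
rewrite seq_E set0_E nactive_E; set H5 := put H4 NUM0 0 _.
exists H5 => //.
have O1 j : H1 OUT j = n by apply: (@reset_all env (fun _ _ => 0%N) OUT agents_ (fun=> n)).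
have D1 : H1 DONE = fun=> 0%N by rewrite /H1 hrun_frame.
have L1 j : H1 LOC j = 0%N by rewrite /H1 hrun_frame.
have act1 : active H1 = setT by apply/setP=> i; rewrite !inE D1.
have free1 : freeset H1 = setT by apply/setP=> j; rewrite !inE O1 leqnn.
have fair1 : fair H1.
  split=> [|i _]; last by rewrite act1 free1 cardsT card_ord; exact: shares_setT.
  split=> [j k _|i|i j _]; first by rewrite O1 ltnn.
    by rewrite act1 inE.
  by rewrite O1 gtn_eqF.
have [lab mat] := @local_search_spec env H1 L1; rewrite -/H2 in lab mat.
have fair2 : fair H2 by apply: fair_ext fair1; rewrite /H2 hrun_frame.
have [fair3 single3] := @singles_spec env H2 fair2; rewrite -/H3 in fair3 single3.
have L3 : H3 LOC = H2 LOC by rewrite /H3 hrun_frame.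
have H4E a : a != BASE -> H4 a = H3 a by exact: fill_frame.
have B3 j : H3 BASE j = 0%N by rewrite /H3 /H2 /H1 !hrun_frame.
have B4 j : (1 <= H4 BASE j)%N = (j \in freeset H3).
  rewrite /H4 (@fill_set env H3 BASE _ _ (freeset H3) (fun=> 1%N)).
    by rewrite B3; case: ifP.
  move=> k H' H'1 _; split=> //.
  by rewrite -[LHS]/(n <= H' OUT k)%N H'1 // inE.
have H5E a : a \notin [:: BASE; NUM0] -> H5 a = H3 a.
  rewrite !inE negb_or => /andP[aB aN]; rewrite -H4E //; exact: put_frame.
have free5 : freeset H5 = freeset H3 by rewrite /freeset H5E.
have act5 : active H5 = active H3 by rewrite /active H5E.
split.
- by apply: fair_ext fair3; rewrite H5E.
- by apply: no_single_ext single3; rewrite H5E.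
- by rewrite free5; apply/setP=> j; rewrite inE -B4.
- by rewrite act5 -[LHS]/#|active H4| /active H4E.
- by rewrite H5E // L3.
Qed.

(** Multiplied by v_i(U) / r, the condition on alpha becomes the required number of thresholds. *)
Lemma ready_bag H (kappa : R) (s : nat) : ready H -> (0 < #|active H|)%N ->
  (kappa + 2 * (#|active H|%:R - s%:R)) * alpha <= #|active H|%:R -> bag_inv kappa s H.
Proof.
move=> [[gH sH] nsH bE NE _] r0 le; split=> // i ia.
have r0' : 0 < #|active H|%:R :> R by rewrite ltr0n.
have thE : threshold H BASE i = alpha * v i (freeset H) / #|active H|%:R.
  by rewrite /threshold bE NE.
split.
- apply: threshold_mms => //; first by rewrite NE.
  by rewrite bE NE; exact/shares_value/sH.
- by move=> j jU; rewrite thE ler_pdivlMr //; exact/ltW/nsH.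
- rewrite thE mulrA ler_pdivrMr // mulrA [leRHS]mulrC.
  by rewrite ler_wpM2r ?valuation_ge0.
Qed.

Definition served_all H : Prop := good H /\ active H = set0.

(** The later phases run even after [last_agent]; with no active agent they leave [OUT] and [DONE]
    alone. *)
Lemma tail_idle env H : served_all H ->
  served_all (hrun I env late_rounds H).
Proof.
move=> [gH a0]; rewrite /seq_ seq_E; set H1 := hrun I env (when_ odd_ _) H.
have E1 : H1 OUT = H OUT /\ H1 DONE = H DONE.
  rewrite /H1 when_E; case: ifP => // _.
  by rewrite seq_E bags_idle ?a0 ?cards0 // !hrun_frame.
have a1 : active H1 = set0 by rewrite -a0 /active E1.2.
move: H1 E1 a1 => H1 E1 a1.
rewrite seq_E when_E and_E eq_E nactive_E a1 cards0 -[X in hrun _ _ (bags 0) X]/H1 bags_idle ?a1 ?cards0 //.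
by split=> //; apply: good_ext gH; [exact: E1.1 | exact: E1.2].
Qed.

Lemma last_bags env H : (0 < H NUM0 0%N)%N -> bag_inv (Delta.+1)%:R 1 H ->
  served_all (hrun I env (bags 0) H).
Proof.
move=> R0 iH.
have [[gz _] /eqP] := @bags_spec env _ 1 0 H R0 (lexx _) isT (leq0n _) iH.
by rewrite cards_eq0 => /eqP.
Qed.

Lemma rounds_spec env H : ready H -> served_all (hrun I env rounds H).
Proof.
move=> rH; have [fH nsH bE NE [lab mat]] := rH.
have D0 : (0 < Delta)%N by have /andP[] := D.
rewrite /seq_ seq_E when_E and_E eq_E not_E odd_E //.
rewrite -[neval env H (get0 NUM0)]/(H NUM0 0%N) -[neval env H (HConst 2)]/2%N NE.
have one H1 : good H1 -> #|active H1| = 1%N ->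
    (forall i, i \in active H1 -> shares i (freeset H1) 1) -> H1 LOC = H LOC ->
  served_all (hrun I env (HSeq (when_ (eq_ nactive_ (HConst 1)) last_agent) late_rounds) H1).
  move=> g1 a1 s1 L1; rewrite /seq_ seq_E when_E eq_E nactive_E a1.
  by apply: tail_idle; apply: last_agent_spec => //; rewrite L1.
have [r2|r2] := ltnP #|active H| 2.
  rewrite (ltn_eqF r2) -[X in hrun _ _ _ X]/H.
  have [r1|r1] := eqVneq #|active H| 1%N.
    by apply: one => //; [exact: fH.1 | move=> i /fH.2; rewrite r1].
  have r0 : #|active H| = 0%N by move: r1 r2; case: #|_| => [|[]].
  rewrite seq_E when_E eq_E nactive_E r0 -[X in hrun _ _ _ X]/H; apply: tail_idle.
  by split; [exact: fH.1 | apply/eqP; rewrite -cards_eq0 r0].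
have [oD|eD] := boolP (odd Delta); rewrite ?andbF ?andbT.
  (* At r = 2 this is (Delta + 2) alpha <= 2, and 2 alpha <= 1 pays for each further agent. *)
  have iH : bag_inv (Delta%:R + 2) 2 H.
    apply: ready_bag => //; first exact: ltnW.
    have := ratio_pair R D0; have := ratio_twice R D0.
    have : 2 <= #|active H|%:R :> R by rewrite ler_nat.
    by move: (#|_|%:R : R) (Delta%:R : R) alpha => x y z; clear; nra.
  rewrite seq_E when_E eq_E nactive_E [_ == _]gtn_eqF //.
  rewrite seq_E when_E odd_E // oD seq_E; set H1 := hrun I env (bags 2) H.
  have [||||i1 a1] := @bags_spec env (Delta%:R + 2) 2 2 H _ _ _ _ iH => //.
  - by rewrite NE; exact: ltnW.
  - by rewrite -natr1 lerD2l ler1n.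
  rewrite -/H1 in i1 a1; set H2 := hrun I env odd_pair H1.
  have a2 : active H2 = active H1 by rewrite /active /H2 hrun_frame.
  rewrite seq_E when_E and_E or_E eq_E odd_E // oD nactive_E a2 a1
    -[X in hrun _ _ _ X]/(hrun I env serve_pair H2).
  have N1 : H1 NUM0 = H NUM0 by rewrite /H1 hrun_frame.
  have R0 : (0 < H1 NUM0 0%N)%N by rewrite N1 NE; exact: ltnW.
  apply: last_bags; first by rewrite hrun_frame // /H2 hrun_frame.
  have L1 : H1 LOC = H LOC by rewrite /H1 hrun_frame.
  by apply: odd_serve; rewrite ?L1.
have D2 : (2 <= Delta)%N by case: Delta D0 eD => [|[]].
have [r2'|r2'] := eqVneq #|active H| 2%N.
  set H1 := hrun I env even_pair H.
  have [|[g1 a1 s1]|[i [[ia AGi] [E1 E2] thi [bc cU] [lt proper items]]]] :=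
    @even_pair_spec D2 env H fH r2'.
  - by rewrite NE.
  (* The first agent has received a single item, and the other one is now the last. *)
  - by apply: one => //; rewrite /H1 hrun_frame.
  rewrite -/H1 in AGi E1 E2 thi bc cU lt proper items *.
  have a1 : active H1 = active H by rewrite /active E2.
  have f1 : freeset H1 = freeset H by rewrite /freeset E1.
  have N1 : H1 NUM0 0%N = 2%N by rewrite /H1 hrun_frame // NE.
  rewrite seq_E when_E eq_E nactive_E a1 r2'.
  rewrite -[(_ == _)]/false seq_E when_E odd_E // (negbTE eD) seq_E when_E and_E or_E !eq_E.
  rewrite nactive_E a1 r2' -[neval _ _ (get0 NUM0)]/(H1 NUM0 0%N) N1 orbT.
  apply: last_bags; first by rewrite hrun_frame // N1.
  apply: (@even_serve env H1 i) => //.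
  - exact: fair_ext fH.
  - exact: no_single_ext nsH.
  - by rewrite a1.
  - by rewrite a1.
  - by rewrite f1 -bE /base /H1 hrun_frame.
  - by rewrite f1.
have r3 : (3 <= #|active H|)%N by rewrite ltn_neqAle eq_sym r2'.
rewrite -[X in hrun _ _ _ X]/H seq_E when_E eq_E nactive_E [_ == _]gtn_eqF //.
rewrite seq_E when_E odd_E // (negbTE eD) seq_E when_E and_E eq_E nactive_E.
rewrite [_ == _]gtn_eqF //; apply: last_bags; first by rewrite NE; exact: leq_trans r3.
by apply: ready_bag => //; [exact: leq_trans r3 | exact: ratio_even].
Qed.

(** As n > Delta, first fit finds an agent for every item that is left, and additional items never
    lower the value of a bundle. *)
Lemma complete_spec env H : served_all H ->
  approx_MMS I alpha [ffun i : 'I_n => [set j : 'I_m | hrun I env (first_fit OUT true_ agents_) H OUT j == i]].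
Proof.
move=> [[g1 g2 _] a0].
have [|f1 f2 f3] := @first_fit_spec env H OUT true_ agents_ xpredT n.
  by move=> x H' _ _.
set H1 := hrun I env _ H in f1 f2 f3 *.
have keep j : (H OUT j < n)%N -> H1 OUT j = H OUT j.
  by move=> jn; rewrite f1 // -ltnNge.
have lt j : (H1 OUT j < n)%N.
  have [jn|jn] := ltnP (H OUT j) n; first by rewrite keep.
  have /andP[_ Dn] := D; apply: leq_ltn_trans Dn; apply: (@first_fit_le) => c cn cj.
  by have [_ /(_ c)] := f3 j isT jn; rewrite minnn; exact.
have proper j k : adj j k -> H1 OUT j != H1 OUT k.
  move=> jk; have [jn|jn] := ltnP (H OUT j) n; last first.
    by rewrite eq_sym; have [_ ->] := f2 j isT jn (lt j).
  have [kn|kn] := ltnP (H OUT k) n; last first.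
    by have [_ ->] := f2 k isT kn (lt k); rewrite // conflict_sym.
  by rewrite !keep // g1.
split=> [|i]; last first.
  rewrite ffunE; apply: le_trans (g2 i _) _; first by rewrite a0 inE.
  apply: valuationS; apply/subsetP=> j; rewrite !inE => /eqP ji.
  by rewrite keep ji ?ltn_ord.
apply/andP; split; last first.
  apply/forallP=> i; apply/independentP=> j k; rewrite ffunE !inE => /eqP ji /eqP ki.
  by apply/negP=> /proper; rewrite ji ki eqxx.
apply/andP; split.
  apply/forallP=> i; apply/forallP=> l; apply/implyP=> il.
  rewrite -setI_eq0; apply/eqP/setP=> j; rewrite !ffunE !inE.
  by apply/negP=> /andP[/eqP -> /eqP/val_inj]; exact/eqP.
apply/eqP/setP=> j; rewrite inE; apply/bigcupP; exists (Ordinal (lt j)) => //.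
by rewrite ffunE inE.
Qed.

Lemma program_spec env : approx_MMS I alpha
  [ffun i : 'I_n => [set j : 'I_m | hrun I env program (fun _ _ => 0%N) OUT j == i]].
Proof.
have [H rH ->] := start_spec env; exact/complete_spec/(rounds_spec env rH).
Qed.

End Final.

End Algorithm.

Theorem theorem2 (R : realType) :
  (exists c : cmd,
     @solves_in_poly_time R c
       (fun n m I => (0 < max_degree I)%N /\ (max_degree I < n)%N)
       (fun n m I A => approx_MMS I (mms_ratio R (max_degree I)) A)) /\
  (forall (n m : nat) (I : instance R n m),
     (2 < max_degree I)%N -> 1 / (max_degree I)%:R < mms_ratio R (max_degree I)).
Proof.
split=> [|n m I D3].
  exists (compile program); apply: solves_compile.
  - exact: program_scoped.
  - by move=> n m I [_ /(leq_trans _) n0]; rewrite addn_gt0 n0.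
  - by move=> n m I [D0 Dn]; apply: program_spec; rewrite D0.
(* 2 / (d + 2) > 1 / d amounts to d > 2. *)
have := ratio_frac R D3; have : 3%:R <= (max_degree I)%:R :> R by rewrite ler_nat.
move: (mms_ratio R _) ((max_degree I)%:R : R) => a d d3 E.
by rewrite ltr_pdivrMr; nra.
Qed.
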